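(* Fix $\theta>0$ and let $\eta^*_\theta:[1,\infty)\to\mathbb{R}$ be the unique global solution of $$(y\eta)'(y)+\beta\,(T_1\mathbb{Q}[\eta])(y)=0 \quad (y\ge1),\qquad \eta(1)=\beta,$$ with $\beta=\theta/q$. Then: a) $\eta^*_\theta\in\mathbb{P}$ if and only if $0<\theta\le1$. b) If $\theta\in(0,1]$, $\eta^*_\theta\in\mathbb{P}$ is positive and strictly decreasing, so that $y\,\eta^*_\theta(y)\to0$ as $y\to\infty$. c) If $0<\theta<1$, then $$\lim_{y\to\infty}y^{1+\theta}\eta^*_\theta(y)=\frac{\theta\,e^{\theta\gamma_E}}{\kappa\,\Gamma(1-\theta)},$$ where $\Gamma$ is the Gamma function and $\gamma_E=-\Gamma'(1)$ is Euler's constant. d) If $\theta=1$, then $$\int_1^\infty y\,\eta^*_1(y)\,dy=\frac{e^{\gamma_E}}{\kappa}.$$ Moreover, if $\deg Q>1$, there exists $\lambda>0$ such that $$\lim_{y\to\infty}\frac{\log\eta^*_1(y)}{y}=-\lambda.$$ For $Q(z)=z$ we have $$\lim_{y\to\infty}\frac{\log\eta^*_1(y)}{y\log y}=-1.$$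
   Context: Fix an integer $N\ge 1$ and real numbers $p_1,\dots,p_N\ge 0$ with $p_1+\dots+p_N=1$; let $Q(z)=\sum_{j=1}^N p_jz^j$ and $\mathbb{Q}[\rho]=\sum_{j=1}^N p_j\,\rho^{*j}$, where $\rho^{*j}$ is the $j$-fold convolution power on $\mathbb{R}$. Functions on $[1,\infty)$ are extended by $0$ to $(-\infty,1)$, so that $\mathbb{Q}[\eta]$ is well defined for every $\eta\in L^1_{\rm loc}([1,\infty))$. $(T_1\eta)(y)=\eta(y-1)$ for $y\ge2$ and $0$ for $y<2$. $\mathbb{P}=\{\eta\in L^1((1,\infty),\mathbb{R}_+) : \int_1^\infty \eta(y)\,dy=1\}$. $q=Q'(1)\ge1$ and $\kappa=\exp\left(\int_0^1\left(\frac{1}{1-z}-\frac{q}{1-Q(z)}\right)dz\right)\le1$. A solution of the differential equation is a locally absolutely continuous function satisfying it for almost all $y>1$ together with $\eta(1)=\beta$; such a solution exists on $[1,\infty)$ and is unique for every $\beta\in\mathbb{R}$. *)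

(* Defs.v *)
From HB Require Import structures.
From mathcomp Require Import all_boot all_order all_algebra.
From mathcomp Require Import all_classical all_reals all_analysis.
Set Implicit Arguments.
Unset Strict Implicit.
Unset Printing Implicit Defensive.
Import Order.TTheory GRing.Theory Num.Theory.
Import numFieldNormedType.Exports.
Local Open Scope classical_set_scope.
Local Open Scope ring_scope.

Definition Qpoly (R : realType) (N : nat) (p : nat -> R) : {poly R} :=
  \sum_(1 <= j < N.+1) p j *: 'X^j.

Definition q_of (R : realType) (Q : {poly R}) : R := (deriv Q).[1].

(* The integrand is a division by zero at z = 1 only, a null set. *)
Definition kappa_of (R : realType) (Q : {poly R}) : R :=
  expR (\int[lebesgue_measure]_(z in `[0, 1])
          ((1 - z)^-1 - q_of Q / (1 - Q.[z]))).

(* A function on [1, +oo) is represented by a function R -> R whose values on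
   (-oo, 1) are irrelevant; ext0 replaces them by 0. *)
Definition ext0 (R : realType) (eta : R -> R) (y : R) : R :=
  if 1 <= y then eta y else 0.

Definition conv (R : realType) (f g : R -> R) (y : R) : R :=
  \int[lebesgue_measure]_(x in [set: R]) (f x * g (y - x)).

(* convpow f j is the (j+1)-fold convolution power f^{*(j+1)}; in particular
   convpow f 0 = f. *)
Definition convpow (R : realType) (f : R -> R) (j : nat) : R -> R :=
  iter j (conv f) f.

Definition Qconv (R : realType) (N : nat) (p : nat -> R) (eta : R -> R)
    (y : R) : R :=
  \sum_(1 <= j < N.+1) p j * convpow (ext0 eta) j.-1 y.

Definition T1 (R : realType) (eta : R -> R) (y : R) : R :=
  if 2 <= y then eta (y - 1) else 0.

Definition abs_continuous (R : realType) (a b : R) (f : R -> R) : Prop :=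
  forall e : R, 0 < e -> exists2 d : R, 0 < d &
  forall (n : nat) (u v : 'I_n -> R),
    (forall i, a <= u i /\ u i <= v i /\ v i <= b) ->
    (forall i j, i != j -> v i <= u j \/ v j <= u i) ->
    \sum_i (v i - u i) < d -> \sum_i `|f (v i) - f (u i)| < e.

Definition loc_abs_continuous (R : realType) (f : R -> R) : Prop :=
  forall b : R, 1 <= b -> abs_continuous 1 b f.

Definition is_solution (R : realType) (N : nat) (p : nat -> R) (beta : R)
    (eta : R -> R) : Prop :=
  [/\ loc_abs_continuous eta,
      {ae lebesgue_measure, forall y : R, 1 < y ->
        is_derive y 1 (fun z : R => z * eta z)
                  (- (beta * T1 (Qconv N p eta) y))}
    & eta 1 = beta].

(* The set P of nonnegative L^1 functions on (1, +oo) with integral 1; its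
   elements are classes modulo equality almost everywhere. *)
Definition in_P (R : realType) (eta : R -> R) : Prop :=
  [/\ lebesgue_measure.-integrable `]1, +oo[ (EFin \o eta),
      {ae lebesgue_measure, forall y : R, 1 < y -> 0 <= eta y}
    & (\int[lebesgue_measure]_(y in `]1%R, +oo[) (eta y)%:E = 1)%E].

Definition Gamma (R : realType) (x : R) : R :=
  \int[lebesgue_measure]_(t in `]0, +oo[) (t `^ (x - 1) * expR (- t)).

Definition gammaE (R : realType) : R := - derive1 (@Gamma R) 1.

(* Main.v *)
Require Import Defs.
From HB Require Import structures.
From mathcomp Require Import all_boot all_order all_algebra.
From mathcomp Require Import all_classical all_reals all_analysis.
From mathcomp Require Import measurable_realfun ring lra zify.
Import Order.TTheory GRing.Theory Num.Theory.
Import numFieldNormedType.Exports.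
Local Open Scope classical_set_scope.
Local Open Scope ring_scope.
Set Implicit Arguments.
Unset Strict Implicit.
Unset Printing Implicit Defensive.

(** Let [f] be the solution extended by 0 and [beta = theta / q]. Integrating the
    equation gives [y f(y) = beta P(S > y - 1)], where [S] is the sum of a
    [Q]-distributed number of independent variables [X] of density [f]; so
    [y f(y)] is nonincreasing. For [theta <= 1] the bound
    [E min(S, a) <= q E min(X, a)] excludes a first zero, and the total mass is 1,
    since otherwise [y f(y)] would stay away from 0.

    For the Laplace transform [F] of [f] the equation reads
    [x (- F'(x)) = beta exp(- x) (1 - Q(F(x)))]. The variables separate:
    [- ln(1 - F(x)) = K(F(x)) + theta E_1(x)], where [E_1] is the exponential
    integral and [exp(K(1)) = kappa], whence
    [1 - F(x) ~ x^theta exp(theta gamma_E) / kappa] at [0]. As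
    [1 - F(x) >= 1 - exp(- x)], mass 1 forces [theta <= 1]. Part c) follows by
    Karamata's Tauberian argument for the monotone function [y f(y)], and the mean
    in d) by monotone convergence.

    For [theta = 1] the truncated exponential moments [E exp(s min(X, A))] satisfy a
    differential inequality in [s] that bounds them uniformly in [A], so [f] decays
    exponentially. If [Q] has degree greater than one, [P(S > a + b)] is at least a
    multiple of [P(X > a) P(X > b)], so [- ln f] is subadditive up to a logarithm
    and a Fekete argument yields the rate. If [Q(z) = z], the tail [H] of [f]
    satisfies [y H(y) <= H(y - 1)] and [f(y) >= (d / y) f(y - 1 + d)] for every [d]
    in [(0, 1)], which gives the rate [y ln y]. *)

(** * Absolutely continuous functions *)

(** Before positivity is known, [eta] need not be a density. But all summands are at least 1, so a
    convolution up to [Y] depends only on values up to [Y], and the early steps work with the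
    truncation at [Y], a bounded density of finite mass. Most estimates are instances of one
    identity, the integrated equation tested by Tonelli: [E[X w(X)] = beta E[W(S)]], with [W(s)] the
    integral of [w] over [[1, s + 1]]. The choices of [w] are the indicator of [y <= a] (no first
    zero), [x exp(- x y)] (Laplace transform), [s exp(s min(y, A))] (exponential moments) and the
    indicator of [y > A] (recursion for [H]). The third is delicate: the cap at [A] leaves multiples
    of [E (X - A)^+] for which no bound uniform in [A] is available beforehand. They cancel, since
    [j] summands produce [j] of them, [q] on average, against the factor [beta = 1 / q]. The
    constant of integration of the separated equation is fixed at infinity, where all terms vanish;
    Euler's constant enters because [E_1] is integrated by parts, which leaves the integral for
    [Gamma'(1)]. *)

Lemma real_induction (R : realType) (a b : R) (P : R -> Prop) :
  P a ->
  (forall x, a <= x -> x < b -> (forall t, a <= t <= x -> P t) ->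
    exists2 y, x < y & forall t, x < t <= y -> t <= b -> P t) ->
  (forall x, a < x -> x <= b -> (forall t, a <= t -> t < x -> P t) -> P x) ->
  forall t, a <= t <= b -> P t.
Proof.
move=> Pa Pr Pl t0 /andP[at0 t0b].
(* The supremum of [S] lies in [S] by the left-limit clause; if it were below [b], the
   right-extension clause would give a larger element. The lemma takes the place of compactness of
   [[a, b]] in the covering argument, and later runs the first-zero and bootstrap arguments. *)
pose S := [set x | a <= x <= b /\ forall t, a <= t <= x -> P t].
have ab : a <= b := le_trans at0 t0b.
have Sa : S a.
  split; first by rewrite lexx.
  by move=> t tax; have -> : t = a by apply/eqP; rewrite eq_le andbC.
have hS : has_sup S.
  by split; [exists a | exists b => x [/andP[_ ?] _]].
have as_ : a <= sup S by apply: sup_upper_bound.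
have sb : sup S <= b by apply: ge_sup; [exists a|move=> x [/andP[_ ?] _]].
have lts t : a <= t -> t < sup S -> P t.
  move=> at_ ts; have [x [xab Sx] tx] := sup_gt hS.1 ts.
  by apply: Sx; rewrite at_ ltW.
have Ps : P (sup S).
  have [<-//|neq] := eqVneq a (sup S).
  by apply: Pl => //; rewrite lt_neqAle neq.
have les t : a <= t <= sup S -> P t.
  move=> /andP[at_]; rewrite le_eqVlt => /orP[/eqP->//|]; exact: lts.
have [bs|sltb] := leP b (sup S).
  by apply: les; rewrite at0 (le_trans t0b).
have [y sy Py] := Pr _ as_ sltb les.
have : S (Num.min y b).
  split; first by rewrite le_min ab (ltW (le_lt_trans as_ sy)) /= ge_min lexx orbT.
  move=> t /andP[at_ ty]; have [ts|st] := leP t (sup S).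
    by apply: les; rewrite at_.
  by move: ty; rewrite le_min => /andP[ty tb]; apply: Py => //; rewrite st.
move=> /(sup_upper_bound hS); rewrite leNgt lt_min sy sltb //.
Qed.

Section absolute_continuity.
Context {R : realType}.
Notation mu := (@lebesgue_measure R).

Lemma is_derive0_small_increment (f : R -> R) (x e : R) : 0 < e ->
  is_derive x 1 f 0 ->
  exists2 d, 0 < d & forall t, `|t - x| < d -> `|f t - f x| <= e * `|t - x|.
Proof.
move=> e0 [dfx df0].
have /cvgrPdist_le /(_ _ e0) : h^-1 *: (f (h *: 1 + x) - f x) @[h --> 0^'] --> 'D_1 f x.
  by apply: dfx.
rewrite df0 => -[d /= d0 H]; exists d => // t td.
have [->|tx] := eqVneq t x; first by rewrite !subrr normr0 mulr0.
have tx0 : t - x != 0 by rewrite subr_eq0.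
have := H (t - x); rewrite /= sub0r normrN => /(_ td tx0).
rewrite sub0r normrN scaler1 subrK normrZ normfV.
by rewrite ler_pdivrMl ?normr_gt0// mulrC.
Qed.

(* [covers f U e a x]: up to a Lipschitz error of slope [e], the increment of
   [f] on [a, x] is carried by finitely many non-overlapping intervals whose
   total length is at most the measure of [U] in [a, x]. *)
Definition covers (f : R -> R) (U : set R) (e a x : R) : Prop :=
  exists (n : nat) (u v : 'I_n -> R),
  [/\ (forall i, a <= u i /\ u i <= v i /\ v i <= x),
      (forall i j, i != j -> v i <= u j \/ v j <= u i),
      ((\sum_i (v i - u i))%:E <= mu (U `&` `]a, x]%classic))%E &
      `|f x - f a| <= e * (x - a) + \sum_i `|f (v i) - f (u i)|].

(** A further piece [[s, t]] is paid for in one of two ways: its increment goes into the Lipschitz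
    error, or it is appended as one more interval whose length is covered by the measure of [U] in
    []s, t]]. *)
Lemma covers_extend (f : R -> R) (U : set R) (e a s t : R) :
  measurable U -> 0 < e -> a <= s -> s <= t -> covers f U e a s ->
  (`|f t - f s| <= e * (t - s) \/ `]s, t]%classic `<=` U) ->
  covers f U e a t.
Proof.
move=> mU e0 as_ st [n [u [v [uv no mle fle]]]] [fst|stU].
  exists n, u, v; split => //.
  - by move=> i; have [? [? vs]] := uv i; do 2 split => //; apply: le_trans st.
  - apply: le_trans mle _; apply: le_measure; rewrite ?inE.
    + exact: measurableI.
    + exact: measurableI.
    + by apply: setIS; apply: subset_itvl; rewrite bnd_simp.
  - have -> : f t - f a = (f s - f a) + (f t - f s) by ring.
    apply: (le_trans (ler_normD _ _)).
    have -> : e * (t - a) = e * (s - a) + e * (t - s) by ring.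
    by move: fle fst; lra.
pose u' (i : 'I_n.+1) := if unlift ord_max i is Some j then u j else s.
pose v' (i : 'I_n.+1) := if unlift ord_max i is Some j then v j else t.
have liftE (i : 'I_n) : widen_ord (leqnSn n) i = lift ord_max i.
  by apply: val_inj; rewrite /= /bump leqNgt ltn_ord.
have u'w (i : 'I_n) : u' (widen_ord (leqnSn n) i) = u i by rewrite liftE /u' liftK.
have v'w (i : 'I_n) : v' (widen_ord (leqnSn n) i) = v i by rewrite liftE /v' liftK.
have u'm : u' ord_max = s by rewrite /u' unlift_none.
have v'm : v' ord_max = t by rewrite /v' unlift_none.
exists n.+1, u', v'; split.
- move=> i; rewrite /u' /v'; case: unliftP => [j _|_] //.
  by have [? [? vs]] := uv j; do 2 split => //; apply: le_trans st.
- move=> i j; rewrite /u' /v'.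
  case: unliftP => [i' ->|->]; case: unliftP => [j' ->|->].
  + by rewrite (inj_eq lift_inj); exact: no.
  + by move=> _; left; have [? []] := uv i'.
  + by move=> _; right; have [? []] := uv j'.
  + by rewrite eqxx.
- rewrite big_ord_recr /= u'm v'm.
  under eq_bigr do rewrite u'w v'w.
  have -> : U `&` `]a, t]%classic = (U `&` `]a, s]%classic) `|` `]s, t]%classic.
    apply/seteqP; split=> x /=; rewrite !in_itv /=.
    - move=> [Ux /andP[ax xt]]; have [xs|sx] := leP x s; [left|right].
        by split => //; rewrite ax.
      by rewrite xt.
    - move=> [[Ux /andP[ax xs]]|/andP[sx xt]].
        by split => //; rewrite ax (le_trans xs).
      split; last by rewrite (le_lt_trans as_ sx).
      by apply: stU; rewrite /= in_itv /= sx xt.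
  rewrite measureU//.
  + rewrite EFinD leeD//.
    rewrite [leRHS](_ : _ = mu `]s, t]%classic)// lebesgue_measure_itv /= lte_fin.
    by case: ltP => // ts; rewrite lee_fin; lra.
  + exact: measurableI.
  + apply/seteqP; split => x //=; rewrite !in_itv/= => -[[_ /andP[_ xs]] /andP[sx _]].
    by move: (le_lt_trans xs sx); rewrite ltxx.
- rewrite big_ord_recr /= u'm v'm.
  under eq_bigr do rewrite u'w v'w.
  have -> : f t - f a = (f s - f a) + (f t - f s) by ring.
  apply: (le_trans (ler_normD _ _)).
  have : e * (s - a) <= e * (t - a) by rewrite ler_pM2l// lerB.
  by move: fle; lra.
Qed.

(** The exceptional null set is enclosed in an open [U] of measure below the absolute-continuity
    threshold. Real induction then covers [[a, b]]: at points outside [U] the vanishing derivative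
    gives increments of slope at most [e], and the intervals inside [U] contribute less than
    [e0 / 2] together. *)
Lemma abs_continuous_derive0 (a b : R) (f : R -> R) : a <= b ->
  abs_continuous a b f ->
  {ae mu, forall y, a < y -> y < b -> is_derive y 1 f 0} -> f b = f a.
Proof.
move=> ab acf /= df0; apply/eqP; rewrite -subr_eq0 -normr_le0.
apply/ler_addgt0Pr => e0 e0_gt0; rewrite add0r.
pose e := e0 / (2 * (b - a + 1)).
have ba1 : 0 < b - a + 1 by lra.
have e_gt0 : 0 < e by rewrite divr_gt0// mulr_gt0.
have e02 : 0 < e0 / 2 by rewrite divr_gt0.
have [d d0 Hd] := acf _ e02.
have [E [mE E0 subE]] := df0.
(* The derivative is controlled only inside []a, b[], so the endpoints join the exceptional set,
   which stays null. *)
pose E' := E `|` [set a] `|` [set b].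
have mE' : measurable E' by apply: measurableU => //; apply: measurableU.
have E'0 : mu E' = 0%E.
  apply/eqP; rewrite eq_le measure_ge0 andbT.
  apply: (le_trans (measureU2 _ _ _)) => //; first by apply: measurableU.
  rewrite [X in (_ + X)%E](_ : _ = 0%E) ?adde0; last exact: lebesgue_measure_set1.
  apply: (le_trans (measureU2 _ _ _)) => //.
  by rewrite [X in (X + _)%E]E0 add0e [leLHS](_ : _ = 0%E)//; exact: lebesgue_measure_set1.
have [U [oU E'U muU]] : exists U : set R, [/\ open U , E' `<=` U & (mu (U `\` E') < d%:E)%E].
  by apply: lebesgue_regularity_outer => //; rewrite [X in (X < _)%E]E'0.
have mU : measurable U by exact: open_measurable.
have muUd : (mu U < d%:E)%E.
  apply: le_lt_trans muU.
  rewrite -[X in (mu X <= _)%E](@setDUK _ E' U)//.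
  apply: (le_trans (measureU2 _ _ _)) => //; first exact: measurableD.
  by rewrite [X in (X + _)%E]E'0 add0e.
(* Each point gets a radius within which every [t], on either side, is joined to [x] by a piece that
   [covers_extend] accepts. *)
have gauge x : a <= x <= b -> exists2 r, 0 < r &
    forall t, `|t - x| < r -> `|f t - f x| <= e * `|t - x| \/ (forall z, `|z - x| <= `|t - x| -> U z).
  move=> /andP[ax xb].
  have [xU|xU] := pselect (U x).
    have /nbhs_ballP[r /= r0 Hr] : nbhs x U by apply: open_nbhs_nbhs.
    exists r => // t tr; right => z zt; apply: Hr; rewrite /ball /= distrC.
    exact: le_lt_trans tr.
  have xa : a < x.
    by rewrite lt_neqAle ax andbT; apply/eqP => axE; apply: xU; apply: E'U; left; right.
  have xb' : x < b.
    by rewrite lt_neqAle xb andbT; apply/eqP => axE; apply: xU; apply: E'U; right.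
  have dx : is_derive x 1 f 0.
    have /contrapT H : ~ ~ (a < x -> x < b -> is_derive x 1 f 0).
      by move=> /subE Ex; apply: xU; apply: E'U; left; left.
    exact: H.
  have [r r0 Hr] := is_derive0_small_increment e_gt0 dx.
  by exists r => // t /Hr; left.
have cov : covers f U e a b.
  apply: (@real_induction _ a b (covers f U e a)); last by rewrite ab lexx.
  - exists 0%N, (fun _ => a), (fun _ => a); split.
    + by case.
    + by case.
    + by rewrite big_ord0 measure_ge0.
    + by rewrite big_ord0 !subrr normr0 mulr0 addr0.
  - move=> x ax xb Px.
    have [|r r0 Hr] := gauge x; first by rewrite ax ltW.
    exists (x + r / 2); first by rewrite ltrDl divr_gt0.
    move=> t /andP[xt tr] tb.
    apply: (@covers_extend f U e a x t) => //; first exact: ltW.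
      by apply: Px; rewrite ax lexx.
    have txE : `|t - x| = t - x by rewrite ger0_norm// subr_ge0 ltW.
    have [|H|H] := Hr t; first by rewrite txE; lra.
      by left; rewrite -txE.
    right => z; rewrite /= in_itv /= => /andP[xz zt]; apply: H.
    by rewrite txE ger0_norm; lra.
  - move=> x ax xb Px.
    have [|r r0 Hr] := gauge x; first by rewrite xb ltW.
    pose t := Num.max a (x - r / 2).
    have tx : t < x by rewrite gt_max ax ltrBlDr ltrDl divr_gt0.
    have at_ : a <= t by rewrite le_max lexx.
    have rt : x - r / 2 <= t by rewrite le_max lexx orbT.
    apply: (@covers_extend f U e a t x) => //; first exact: ltW.
      exact: Px.
    have txE : `|t - x| = x - t by rewrite distrC ger0_norm// subr_ge0 ltW.
    have [|H|H] := Hr t; first by rewrite txE; lra.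
      by left; rewrite -txE distrC.
    right => z; rewrite /= in_itv /= => /andP[tz zx]; apply: H.
    by rewrite txE distrC ger0_norm; lra.
have [n [u [v [uv no mle fle]]]] := cov.
have : \sum_i `|f (v i) - f (u i)| < e0 / 2.
  apply: Hd => //; rewrite -lte_fin; apply: le_lt_trans muUd.
  apply: le_trans mle _; apply: le_measure; rewrite ?inE//.
  exact: measurableI.
have : e * (b - a) <= e0 / 2.
  have -> : e0 / 2 = e * (b - a + 1) by rewrite /e; field; rewrite lt0r_neq0.
  by rewrite ler_pM2l//; lra.
by move: fle; lra.
Qed.

End absolute_continuity.

(** * Affine change of variable for Lebesgue measure *)

Section change_of_variable.
Context {R : realType}.
Notation mu := (@lebesgue_measure R).

Let affine (c d : R) : measurableTypeR R -> measurableTypeR R :=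
  fun y => c * y + d.

Lemma measurable_affine (c d : R) : measurable_fun setT (affine c d).
Proof.
have : measurable_fun [set: R] (fun y : R => c * y + d) by apply: measurable_funD => //; exact: measurable_funM.
by [].
Qed.

(** The scaled push-forward agrees with Lebesgue measure on half-open intervals, hence everywhere by
    uniqueness. *)
Lemma lebesgue_measure_affine (c d : R) (A : set R) : 0 < c -> measurable A ->
  (c%:E * mu ((fun y => c * y + d)%R @^-1` A) = mu A)%E.
Proof.
move=> c0 mA.
pose nu := mscale (NngNum (ltW c0)) (pushforward mu (affine c d)).
apply/esym; apply: (@lebesgue_measure_unique _ (nu (measurable_affine c d))) => //.
move=> X [[x1 x2] _ <-] /=.
rewrite /nu /= /mscale /= /pushforward.
have -> : (fun y : R => c * y + d) @^-1` `]x1, x2]%classic = `]((x1 - d) / c), ((x2 - d) / c)]%classic.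
  apply/seteqP; split => y /=; rewrite !in_itv/= ltr_pdivrMr// ler_pdivlMr//;
  by move=> /andP[]; rewrite -(mulrC c) => ? ?; lra.
rewrite !lebesgue_measure_itv /= !lte_fin ltr_pM2r ?invr_gt0// ltrD2r.
case: ifPn => _; last by rewrite mule0.
by rewrite -!EFinB -EFinM; congr EFin; field; rewrite lt0r_neq0.
Qed.

Lemma ge0_integral_affine (c d : R) (f : R -> \bar R) : 0 < c ->
  measurable_fun setT f -> (forall x, 0 <= f x)%E ->
  (c%:E * \int[mu]_x f (c * x + d)%R = \int[mu]_x f x)%E.
Proof.
move=> c0 mf f0.
have H := @ge0_integral_pushforward _ _ _ _ R _ (measurable_affine c d) mu setT f measurableT mf (fun x _ => f0 x).
rewrite preimage_setT in H; rewrite -[X in (_ * X)%E]/(integral mu setT (f \o (affine c d))) -H.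
rewrite -(@ge0_integral_mscale _ _ _ (pushforward mu (affine c d)) _ measurableT (NngNum (ltW c0)))//.
  exact: measurable_affine.
move=> maff; apply: eq_measure_integral => A mA _.
exact: lebesgue_measure_affine.
Qed.

Lemma ge0_integral_shift (d : R) (f : R -> \bar R) :
  measurable_fun setT f -> (forall x, 0 <= f x)%E ->
  (\int[mu]_x f (x + d)%R = \int[mu]_x f x)%E.
Proof.
move=> mf f0; rewrite -(ge0_integral_affine d ltr01 mf f0) mul1e.
by under [in RHS]eq_integral do rewrite mul1r.
Qed.

End change_of_variable.

(** * Densities and convolutions *)

Section expectation.
Context {R : realType}.
Notation mu := (@lebesgue_measure R).
Local Notation conv := Defs.conv.
Implicit Types f g psi a b : R -> R.

Definition weight f : Prop := measurable_fun setT f /\ forall x, 0 <= f x.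

(** Extended-valued, so that Tonelli and monotonicity apply to nonnegative test functions before any
    moment is known to be finite. *)
Definition expect f psi : \bar R := (\int[mu]_x (f x * psi x)%:E)%E.

(** Boundedness makes convolutions finite at every point and not just almost everywhere, so that the
    real-valued integral in [conv] agrees with the extended one; it also makes distribution
    functions Lipschitz. Mass is only required to be finite, because truncations of [eta] have
    unknown mass. *)
Record density f : Prop := Density {
  density_meas : measurable_fun setT f;
  density_ge0 : forall x, 0 <= f x;
  density_ub : exists M, forall x, f x <= M;
  density_supp : forall x, x < 1 -> f x = 0;
  density_fin : (expect f (cst 1%R) < +oo)%E }.

Lemma weight_cst (c : R) : 0 <= c -> weight (cst c).
Proof. by move=> c0; split. Qed.

Lemma density_weight f : density f -> weight f.
Proof. by case. Qed.

Lemma weightM f g : weight f -> weight g -> weight (fun x => f x * g x).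
Proof.
move=> [mf f0] [mg g0]; split; first exact: measurable_funM.
by move=> x; rewrite mulr_ge0.
Qed.

Lemma weightD f g : weight f -> weight g -> weight (fun x => f x + g x).
Proof.
move=> [mf f0] [mg g0]; split; first exact: measurable_funD.
by move=> x; rewrite addr_ge0.
Qed.

Lemma weight_shift f (c : R) : weight f -> weight (fun x => f (x + c)).
Proof.
move=> [mf f0]; split => //.
apply: measurableT_comp => //.
exact: measurable_funD.
Qed.

Lemma weight_emeas f : weight f -> measurable_fun setT (fun x => (f x)%:E).
Proof. by move=> [mf _]; exact/measurable_EFinP. Qed.

Lemma expect_ge0 f psi : weight f -> weight psi -> (0 <= expect f psi)%E.
Proof.
by move=> [_ f0] [_ p0]; apply: integral_ge0 => x _; rewrite lee_fin mulr_ge0.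
Qed.

Lemma le_expect f psi1 psi2 : density f -> weight psi1 -> weight psi2 ->
  (forall x, 1 <= x -> psi1 x <= psi2 x) -> (expect f psi1 <= expect f psi2)%E.
Proof.
move=> df w1 w2 le12; have wf := density_weight df.
apply: ge0_le_integral => //.
- by move=> x _; rewrite lee_fin; exact: (weightM wf w1).2.
- exact: weight_emeas (weightM wf w1).
- exact: weight_emeas (weightM wf w2).
- move=> x _; rewrite lee_fin; have [x1|x1] := ltP x 1.
    by rewrite (density_supp df x1) !mul0r.
  by rewrite ler_wpM2l ?le12// wf.2.
Qed.

Lemma eq_expect f psi1 psi2 : density f ->
  (forall x, 1 <= x -> psi1 x = psi2 x) -> (expect f psi1 = expect f psi2)%E.
Proof.
move=> df e12; apply: eq_integral => x _.
have [x1|x1] := ltP x 1; first by rewrite (density_supp df x1) !mul0r.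
by rewrite e12.
Qed.

Lemma expectD f psi1 psi2 : weight f -> weight psi1 -> weight psi2 ->
  (expect f (fun x => (psi1 x + psi2 x)%R) = expect f psi1 + expect f psi2)%E.
Proof.
move=> wf w1 w2; rewrite /expect -ge0_integralD//=.
- by apply: eq_integral => x _; rewrite mulrDr EFinD.
- by move=> x _; rewrite lee_fin; exact: (weightM wf w1).2.
- exact: weight_emeas (weightM wf w1).
- by move=> x _; rewrite lee_fin; exact: (weightM wf w2).2.
- exact: weight_emeas (weightM wf w2).
Qed.

Lemma expectZ f psi (c : R) : 0 <= c -> weight f -> weight psi ->
  (expect f (fun x => (c * psi x)%R) = c%:E * expect f psi)%E.
Proof.
move=> c0 wf w; rewrite /expect -ge0_integralZl//=.
- by apply: eq_integral => x _; rewrite mulrCA EFinM.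
- exact: weight_emeas (weightM wf w).
- by move=> x _; rewrite lee_fin; exact: (weightM wf w).2.
Qed.

Lemma expect_bounded_fin f psi (M : R) : density f -> weight psi ->
  (forall x, 1 <= x -> psi x <= M) -> (expect f psi < +oo)%E.
Proof.
move=> df w le; have wf := density_weight df.
have M0 : 0 <= M by apply: le_trans (le 1 (lexx _)); exact: w.2.
apply: (@le_lt_trans _ _ (M%:E * expect f (cst 1%R))%E); last first.
  by rewrite lte_mul_pinfty// (density_fin df).
rewrite -expectZ//. 
apply: le_expect => // [|x x1 /=]; last by rewrite mulr1 le.
by apply: weightM; exact: weight_cst.
Qed.

Lemma measurable_conv_kernel f g : measurable_fun setT f -> measurable_fun setT g ->
  measurable_fun setT (fun z : R * R => (f z.1 * g (z.2 - z.1))%:E).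
Proof.
move=> mf mg; apply/measurable_EFinP; apply: measurable_funM.
  by apply: measurableT_comp => //; exact: measurable_fst.
apply: (measurableT_comp mg); apply: measurable_funB.
  exact: measurable_snd.
exact: measurable_fst.
Qed.

Lemma density_conv_fin f g y : density f -> density g ->
  (\int[mu]_x (f x * g (y - x))%:E < +oo)%E.
Proof.
move=> df dg; have [M gM] := density_ub dg.
apply: le_lt_trans (@expect_bounded_fin f (cst M) M df _ _) => //.
- apply: ge0_le_integral => //.
  + by move=> x _; rewrite lee_fin mulr_ge0 ?density_ge0.
  + apply/measurable_EFinP/measurable_funM; first exact: density_meas.
    apply: measurableT_comp; first exact: (density_meas dg).
    exact: measurable_funB.
  + by apply/measurable_EFinP/measurable_funM => //; exact: density_meas.
  + by move=> x _; rewrite lee_fin ler_wpM2l ?density_ge0.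
- apply: weight_cst; apply: le_trans (gM 0); exact: density_ge0.
Qed.

Lemma convE f g y : density f -> density g ->
  ((conv f g y)%:E = \int[mu]_x (f x * g (y - x))%:E)%E.
Proof.
move=> df dg; rewrite /conv /Rintegral fineK// ge0_fin_numE.
  exact: density_conv_fin.
by apply: integral_ge0 => x _; rewrite lee_fin mulr_ge0 ?density_ge0.
Qed.

Lemma conv_meas f g : density f -> density g -> measurable_fun setT (conv f g).
Proof.
move=> df dg.
have mfg := measurable_conv_kernel (density_meas df) (density_meas dg).
apply/measurable_EFinP.
rewrite [X in measurable_fun _ X](_ : _ = fun y => (\int[mu]_x (f x * g (y - x))%:E)%E); last first.
  by apply/funext => y; rewrite /comp /= convE.
apply: (@measurable_fun_fubini_tonelli_G _ _ _ _ R mu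
  (fun z : R * R => (f z.1 * g (z.2 - z.1))%:E)) => //.
by move=> z; rewrite lee_fin mulr_ge0 ?density_ge0.
Qed.

Lemma conv_ge0 f g y : density f -> density g -> 0 <= conv f g y.
Proof.
move=> df dg; apply: Rintegral_ge0 => x _.
by rewrite mulr_ge0 ?density_ge0.
Qed.

(** Tonelli and a translation: for independent [X] and [Z] with densities [f] and [g], this is
    [E psi(X + Z)] computed by conditioning on [X]. *)
Lemma expect_conv f g psi : density f -> density g -> weight psi ->
  (expect (conv f g) psi =
   \int[mu]_x ((f x)%:E * expect g (fun z => psi (z + x)%R)))%E.
Proof.
move=> df dg w.
have wf := density_weight df; have wg := density_weight dg.
pose K (z : R * R) := (f z.1 * g (z.2 - z.1) * psi z.2)%:E.
have mK : measurable_fun setT K.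
  apply/measurable_EFinP; apply: measurable_funM.
    by apply/measurable_EFinP; exact: (measurable_conv_kernel (density_meas df) (density_meas dg)).
  by apply: measurableT_comp; [exact: w.1|exact: measurable_snd].
have K0 z : (0 <= K z)%E by rewrite lee_fin !mulr_ge0 ?wf.2 ?wg.2 ?w.2.
transitivity (\int[mu]_y \int[mu]_x K (x, y))%E.
  apply: eq_integral => y _; rewrite EFinM convE// muleC -ge0_integralZl//=.
  - by apply: eq_integral => x _; rewrite /K /= muleC -EFinM.
  - apply/measurable_EFinP/measurable_funM => //; first exact: wf.1.
    by apply: measurableT_comp; [exact: wg.1|exact: measurable_funB].
  - by move=> x _; rewrite lee_fin mulr_ge0 ?wf.2 ?wg.2.
  - by rewrite lee_fin w.2.
rewrite -(@fubini_tonelli _ _ _ _ R mu mu K)//.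
apply: eq_integral => x _; rewrite /expect -ge0_integralZl//=; last first.
- by rewrite lee_fin wf.2.
- by move=> z _; rewrite lee_fin mulr_ge0 ?wg.2 ?w.2.
- exact: weight_emeas (weightM wg (weight_shift x w)).
rewrite -[LHS](@ge0_integral_shift _ x)//.
- apply: eq_integral => z _; rewrite /K /= -EFinM -mulrA; congr (_ * (g _ * _))%:E.
  by rewrite addrK.
- exact: measurableT_comp.
Qed.

(* The products [a_i(x) b_i(z)] cover sub-multiplicative as well as
   almost-additive test functions. *)
Lemma expect_conv_le f g psi a1 b1 a2 b2 a3 b3 : density f -> density g ->
  weight psi -> weight a1 -> weight b1 -> weight a2 -> weight b2 ->
  weight a3 -> weight b3 ->
  (forall x z, 1 <= x -> 1 <= z ->
     psi (x + z) <= a1 x * b1 z + a2 x * b2 z + a3 x * b3 z) ->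
  (expect (conv f g) psi <= expect f a1 * expect g b1 + expect f a2 * expect g b2
     + expect f a3 * expect g b3)%E.
Proof.
move=> df dg w wa1 wb1 wa2 wb2 wa3 wb3 le.
have wf := density_weight df; have wg := density_weight dg.
have mE a b : weight a -> weight b -> measurable_fun setT (fun x => (f x * a x)%:E * expect g b)%E.
  move=> wa wb; apply: emeasurable_funM => //.
  exact: weight_emeas (weightM wf wa).
have E0 a b x : weight a -> weight b -> (0 <= (f x * a x)%:E * expect g b)%E.
  move=> wa wb; rewrite mule_ge0// ?lee_fin ?expect_ge0//.
  by rewrite mulr_ge0 ?wf.2 ?wa.2.
have EE a b : weight a -> weight b ->
   (\int[mu]_x ((f x * a x)%:E * expect g b) = expect f a * expect g b)%E.
  move=> wa wb; rewrite ge0_integralZr//.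
  - exact: weight_emeas (weightM wf wa).
  - by move=> x _; rewrite lee_fin mulr_ge0 ?wf.2 ?wa.2.
  - exact: expect_ge0.
have E12 := @ge0_integralD _ _ _ mu _ measurableT _ _ (fun x _ => E0 a1 b1 x wa1 wb1) (mE a1 b1 wa1 wb1)
  (fun x _ => E0 a2 b2 x wa2 wb2) (mE a2 b2 wa2 wb2).
have E123 := @ge0_integralD _ _ _ mu _ measurableT _ _ (fun x _ => adde_ge0 (E0 a1 b1 x wa1 wb1) (E0 a2 b2 x wa2 wb2))
  (emeasurable_funD (mE a1 b1 wa1 wb1) (mE a2 b2 wa2 wb2))
  (fun x _ => E0 a3 b3 x wa3 wb3) (mE a3 b3 wa3 wb3).
rewrite expect_conv// -!EE// -E12 -E123.
apply: ge0_le_integral => //.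
- move=> x _; rewrite mule_ge0 ?lee_fin ?wf.2// expect_ge0//.
  exact: weight_shift.
- apply: emeasurable_funM; first exact: weight_emeas.
  apply: (@measurable_fun_fubini_tonelli_F _ _ _ _ R mu
    (fun z : R * R => (g z.2 * psi (z.2 + z.1))%:E)) => //.
  + apply/measurable_EFinP/measurable_funM.
      by apply: measurableT_comp; [exact: wg.1|exact: measurable_snd].
    apply: measurableT_comp; first exact: w.1.
    by apply: measurable_funD; [exact: measurable_snd|exact: measurable_fst].
  + by move=> z; rewrite lee_fin mulr_ge0 ?wg.2 ?w.2.
- by apply: emeasurable_funD; [apply: emeasurable_funD; exact: mE|exact: mE].
move=> x _; have [x1|x1] := ltP x 1.
  by rewrite (density_supp df x1) !mul0r !mul0e !adde0.
rewrite !EFinM -!muleA -!ge0_muleDr; last first.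
- by rewrite mule_ge0 ?lee_fin ?wa2.2// expect_ge0.
- by rewrite mule_ge0 ?lee_fin ?wa1.2// expect_ge0.
- by rewrite mule_ge0 ?lee_fin ?wa3.2// expect_ge0.
- by rewrite adde_ge0// mule_ge0 ?lee_fin ?wa1.2 ?wa2.2// expect_ge0.
rewrite lee_wpmul2l ?lee_fin ?wf.2//.
have wc (c : R) b : 0 <= c -> weight b -> weight (fun z => c * b z).
  by move=> c0 wb; apply: weightM => //; exact: weight_cst.
have W1 := wc _ _ (wa1.2 x) wb1; have W2 := wc _ _ (wa2.2 x) wb2.
have W3 := wc _ _ (wa3.2 x) wb3; have W12 := weightD W1 W2.
rewrite -!expectZ ?wa1.2 ?wa2.2 ?wa3.2// -(expectD wg W1 W2) -(expectD wg W12 W3).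
apply: le_expect => //; first exact: weight_shift.
  exact: (weightD W12 W3).
by move=> z z1; rewrite addrC le.
Qed.

(** A single product suffices here: the lower bounds concern tail events, where large summands force
    a large sum. Together with [expect_conv_le] it gives multiplicativity on exponentials. *)
Lemma expect_conv_ge f g psi a b : density f -> density g ->
  weight psi -> weight a -> weight b ->
  (forall x z, 1 <= x -> 1 <= z -> a x * b z <= psi (x + z)) ->
  (expect f a * expect g b <= expect (conv f g) psi)%E.
Proof.
move=> df dg w wa wb le.
have wf := density_weight df; have wg := density_weight dg.
rewrite expect_conv// -ge0_integralZr//; last first.
- exact: expect_ge0.
- by move=> x _; rewrite lee_fin mulr_ge0 ?wf.2 ?wa.2.
- exact: weight_emeas (weightM wf wa).
apply: ge0_le_integral => //.
- move=> x _; rewrite mule_ge0 ?expect_ge0// lee_fin mulr_ge0 ?wf.2 ?wa.2//.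
- apply: emeasurable_funM => //; exact: weight_emeas (weightM wf wa).
- apply: emeasurable_funM; first exact: weight_emeas.
  apply: (@measurable_fun_fubini_tonelli_F _ _ _ _ R mu
    (fun z : R * R => (g z.2 * psi (z.2 + z.1))%:E)) => //.
  + apply/measurable_EFinP/measurable_funM.
      by apply: measurableT_comp; [exact: wg.1|exact: measurable_snd].
    apply: measurableT_comp; first exact: w.1.
    by apply: measurable_funD; [exact: measurable_snd|exact: measurable_fst].
  + by move=> z; rewrite lee_fin mulr_ge0 ?wg.2 ?w.2.
move=> x _; have [x1|x1] := ltP x 1.
  by rewrite (density_supp df x1) !mul0r !mul0e.
rewrite EFinM -muleA lee_wpmul2l ?lee_fin ?wf.2// -expectZ ?wa.2//.
apply: le_expect => //.
- by apply: weightM => //; apply: weight_cst; exact: wa.2.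
- exact: weight_shift.
- by move=> z z1; rewrite addrC le.
Qed.

Lemma expect_conv_mul f g psi : density f -> density g -> weight psi ->
  (forall x z, psi (x + z) = psi x * psi z) ->
  (expect (conv f g) psi = expect f psi * expect g psi)%E.
Proof.
move=> df dg w mulE; apply/eqP; rewrite eq_le; apply/andP; split; last first.
  by apply: expect_conv_ge => // x z _ _; rewrite mulE.
have w0 : weight (cst (0 : R)) by apply: weight_cst.
have z0 h : expect h (cst 0) = 0%E.
  by rewrite /expect; under eq_integral do rewrite mulr0; rewrite integral0.
have := @expect_conv_le f g psi psi psi (cst 0) (cst 0) (cst 0) (cst 0) df dg w w w w0 w0 w0 w0.
rewrite !z0 !mul0e !adde0; apply => x z _ _.
by rewrite mulE /= !mulr0 !addr0.
Qed.

Lemma expect_fin_num f psi : weight f -> weight psi ->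
  (expect f psi < +oo)%E -> expect f psi \is a fin_num.
Proof. by move=> wf w fin; rewrite ge0_fin_numE// expect_ge0. Qed.

Lemma conv_density f g : density f -> density g -> density (conv f g).
Proof.
move=> df dg; have [M gM] := density_ub dg.
have M0 : 0 <= M by apply: le_trans (gM 0); exact: density_ge0.
split.
- exact: conv_meas.
- by move=> y; exact: conv_ge0.
- exists (fine (expect f (cst M))) => y.
  have fin : (expect f (cst M) < +oo)%E.
    by apply: expect_bounded_fin df (weight_cst M0) (fun x _ => lexx M).
  rewrite -lee_fin convE// fineK; last first.
    exact: expect_fin_num (density_weight df) (weight_cst M0) fin.
  apply: ge0_le_integral => //.
  + by move=> x _; rewrite lee_fin mulr_ge0 ?density_ge0.
  + apply/measurable_EFinP/measurable_funM; first exact: density_meas.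
    apply: measurableT_comp; first exact: (density_meas dg).
    exact: measurable_funB.
  + by apply/measurable_EFinP/measurable_funM => //; exact: density_meas.
  + by move=> x _; rewrite lee_fin ler_wpM2l ?density_ge0.
- move=> y y1; rewrite /Defs.conv /Rintegral integral0_eq// => x _.
  have [x1|x1] := ltP x 1; first by rewrite (density_supp df x1) mul0r.
  by rewrite (density_supp dg) ?mulr0//; lra.
- rewrite expect_conv_mul//; last by move=> x z /=; rewrite mulr1.
  have h k : density k -> expect k (cst 1) \is a fin_num.
      by move=> dk; exact: expect_fin_num (density_weight dk) (weight_cst ler01) (density_fin dk).
  by have := fin_numM (h _ df) (h _ dg); rewrite fin_numE => /andP[_]; rewrite ltey.
Qed.

Lemma convpow_density f j : density f -> density (convpow f j).
Proof. by move=> df; elim: j => //= j IH; exact: conv_density. Qed.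

(** [Qconv N p eta] unfolds to [qmix N p (ext0 eta)]; without the built-in extension by zero the
    mixture also applies to truncations. It plays the role of the density of [S]. *)
Definition qmix (N : nat) (p : nat -> R) f (y : R) : R :=
  \sum_(1 <= j < N.+1) p j * convpow f j.-1 y.

Definition supp1 f : Prop := forall x, x < 1 -> f x = 0.

Lemma conv_supp1 f g : supp1 f -> supp1 g -> supp1 (conv f g).
Proof.
move=> sf sg y y1; rewrite /Defs.conv /Rintegral integral0_eq// => x _.
have [x1|x1] := ltP x 1; first by rewrite sf// mul0r.
by rewrite sg ?mulr0//; lra.
Qed.

Lemma convpow_supp1 f j : supp1 f -> supp1 (convpow f j).
Proof. by move=> sf; elim: j => // j IH; exact: conv_supp1. Qed.

(** Both factors vanish for arguments below 1, so for a sum of at most [Y + 1] each argument that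
    counts is at most [Y]. This causality is what lets [eta] be replaced by a truncation. *)
Lemma conv_eq_below f f' g g' (Y : R) : supp1 f -> supp1 f' -> supp1 g -> supp1 g' ->
  (forall x, x <= Y -> f x = f' x) -> (forall x, x <= Y -> g x = g' x) ->
  forall x, x <= Y + 1 -> conv f g x = conv f' g' x.
Proof.
move=> df df' dg dg' ef eg y yY; apply: eq_Rintegral => x _.
have [x1|x1] := ltP x 1; first by rewrite (df _ x1) (df' _ x1) !mul0r.
have [z1|z1] := ltP (y - x) 1; first by rewrite (dg _ z1) (dg' _ z1) !mulr0.
by rewrite ef ?eg//; lra.
Qed.

Lemma convpow_eq_below f f' (Y : R) j : supp1 f -> supp1 f' ->
  (forall x, x <= Y -> f x = f' x) ->
  forall x, x <= Y -> convpow f j x = convpow f' j x.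
Proof.
move=> df df' ef; elim: j => [|j IH] x xY; first exact: ef.
apply: (@conv_eq_below f f' _ _ Y) => //; try exact: convpow_supp1.
by rewrite (le_trans xY)// lerDl.
Qed.

Context (N : nat) (p : nat -> R).
Context (p0 : forall j : nat, (1 <= j <= N)%N -> 0 <= p j).

Lemma qmix_eq_below f f' (Y : R) : supp1 f -> supp1 f' ->
  (forall x, x <= Y -> f x = f' x) ->
  forall x, x <= Y -> qmix N p f x = qmix N p f' x.
Proof.
move=> df df' ef x xY; apply: eq_bigr => j _.
by rewrite (@convpow_eq_below f f' Y).
Qed.

Lemma qmix_weight f : density f -> weight (qmix N p f).
Proof.
move=> df; split.
  by apply: measurable_sum => j; apply: measurable_funM => //; exact: density_meas (convpow_density _ df).
move=> x; rewrite /qmix big_nat_cond sumr_ge0// => j /andP[jN _].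
rewrite mulr_ge0//; first by rewrite p0// -ltnS.
exact: density_ge0 (convpow_density _ df) _.
Qed.

Lemma expect_qmix f psi : density f -> weight psi ->
  (expect (qmix N p f) psi =
   \sum_(1 <= j < N.+1) (p j)%:E * expect (convpow f j.-1) psi)%E.
Proof.
move=> df w; have wc j := density_weight (convpow_density j df).
(* The test on [j] makes every summand nonnegative, since [p j] has a known sign only for
   [1 <= j <= N]. *)
transitivity (\int[mu]_x (\sum_(1 <= j < N.+1) (if (1 <= j <= N)%N then (p j * (convpow f j.-1 x * psi x)) else 0)%:E))%E.
  apply: eq_integral => x _; rewrite /qmix mulr_suml sumEFin; congr EFin.
  by apply: eq_big_nat => j; rewrite ltnS => ->; rewrite mulrA.
rewrite ge0_integral_sum//.
- apply: eq_big_nat => j; rewrite ltnS => jN; rewrite jN /expect -ge0_integralZl//.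
  + exact: weight_emeas (weightM (wc _) w).
  + by move=> x _; rewrite lee_fin; exact: (weightM (wc _) w).2.
  + by rewrite lee_fin p0.
- move=> j; case: (0 < j <= N)%N => //; apply/measurable_EFinP/measurable_funM => //.
  exact: (weightM (wc _) w).1.
- move=> j x _; case: ifP => // jN; rewrite lee_fin mulr_ge0 ?p0//.
  exact: (weightM (wc _) w).2.
Qed.

Lemma qmix_density f : density f -> density (qmix N p f).
Proof.
move=> df; have w := qmix_weight df; split; [exact: w.1|exact: w.2| | |].
- pose M j := sval (cid (density_ub (convpow_density j df))).
  exists (\sum_(1 <= j < N.+1) p j * M j.-1) => x.
  apply: ler_sum_nat => j; rewrite ltnS => jN; rewrite ler_wpM2l ?p0//.
  by rewrite /M; case: cid => /= ? ->.
- move=> x x1; rewrite /qmix big1// => j _.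
  by rewrite (density_supp (convpow_density _ df) x1) mulr0.
- rewrite expect_qmix//.
  rewrite big_nat_cond; apply: lte_sum_pinfty => j /andP[jN _].
  rewrite lte_mul_pinfty ?lee_fin//; first by rewrite p0// -ltnS.
  exact: density_fin (convpow_density _ df).
Qed.

End expectation.

(** * The integrated equation *)

Section cdf.
Context {R : realType}.
Notation mu := (@lebesgue_measure R).
Implicit Types f g psi : R -> R.

Lemma weight_le (y : R) : weight (fun x => ((x <= y)%R)%:R : R).
Proof.
split; last by move=> x; rewrite ler0n.
have -> : (fun x => ((x <= y)%R)%:R : R) = \1_(`]-oo, y]%classic).
  by apply/funext => x; rewrite indicE mem_setE in_itv.
exact: measurable_indic.
Qed.

Lemma weight_gt (y : R) : weight (fun x => ((y < x)%R)%:R : R).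
Proof.
split; last by move=> x; rewrite ler0n.
have -> : (fun x => ((y < x)%R)%:R : R) = \1_(`]y, +oo[%classic).
  by apply/funext => x; rewrite indicE mem_setE in_itv /= andbT.
exact: measurable_indic.
Qed.

Definition cdf f (y : R) : R := fine (expect f (fun x => ((x <= y)%R)%:R)).
Definition tail f (y : R) : R := fine (expect f (fun x => ((y < x)%R)%:R)).

Lemma cdf_fin f y : density f -> (expect f (fun x => ((x <= y)%R)%:R%R) < +oo)%E.
Proof.
move=> df; apply: (@expect_bounded_fin _ _ _ 1) => //; first exact: weight_le.
by move=> x _; case: (x <= y); rewrite ?ler01.
Qed.

Lemma tail_fin f y : density f -> (expect f (fun x => ((y < x)%R)%:R%R) < +oo)%E.
Proof.
move=> df; apply: (@expect_bounded_fin _ _ _ 1) => //; first exact: weight_gt.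
by move=> x _; case: (y < x); rewrite ?ler01.
Qed.

Lemma cdfK f y : density f -> (cdf f y)%:E = expect f (fun x => ((x <= y)%R)%:R).
Proof.
move=> df; rewrite /cdf fineK//; apply: expect_fin_num (cdf_fin _ df).
- exact: density_weight.
- exact: weight_le.
Qed.

Lemma tailK f y : density f -> (tail f y)%:E = expect f (fun x => ((y < x)%R)%:R).
Proof.
move=> df; rewrite /tail fineK//; apply: expect_fin_num (tail_fin _ df).
- exact: density_weight.
- exact: weight_gt.
Qed.

Lemma cdf_tail f y : density f ->
  ((cdf f y)%:E + (tail f y)%:E = expect f (cst 1%R))%E.
Proof.
move=> df; rewrite cdfK// tailK// -expectD//.
- by apply: eq_expect => // x _; case: leP; rewrite ?addr0 ?add0r.
- exact: density_weight.
- exact: weight_le.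
- exact: weight_gt.
Qed.

Lemma cdf_ge0 f y : density f -> 0 <= cdf f y.
Proof. by move=> df; rewrite fine_ge0// expect_ge0//; [exact: density_weight|exact: weight_le]. Qed.

Lemma tail_ge0 f y : density f -> 0 <= tail f y.
Proof. by move=> df; rewrite fine_ge0// expect_ge0//; [exact: density_weight|exact: weight_gt]. Qed.

Lemma le_cdf f x y : density f -> x <= y -> cdf f x <= cdf f y.
Proof.
move=> df xy; rewrite -lee_fin !cdfK//; apply: le_expect => //; do ?exact: weight_le.
move=> z _; rewrite ler_nat; case: (leP z x) => //= zx.
by rewrite (le_trans zx xy).
Qed.

Lemma le_tail f x y : density f -> x <= y -> tail f y <= tail f x.
Proof.
move=> df xy; rewrite -lee_fin !tailK//; apply: le_expect => //; do ?exact: weight_gt.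
move=> z _; rewrite ler_nat; case: (ltP y z) => //= zx.
by rewrite (le_lt_trans xy zx).
Qed.

Lemma cdf_lt1 f y : density f -> y < 1 -> cdf f y = 0.
Proof.
move=> df y1; rewrite /cdf (@eq_expect _ _ _ (cst 0) df); last first.
  by move=> x x1; rewrite leNgt (lt_le_trans y1 x1).
by rewrite /expect; under eq_integral do rewrite mulr0; rewrite integral0.
Qed.

Lemma cdfE f y : density f -> cdf f y = \int[mu]_(x in `]-oo, y]) f x.
Proof.
move=> df; rewrite /cdf /Rintegral integral_mkcond; congr fine.
apply: eq_integral => x _; rewrite patchE mem_setE in_itv /=.
by case: (x <= y); rewrite ?mulr1 ?mulr0.
Qed.

Lemma density_integrable f (D : set R) : density f -> measurable D ->
  mu.-integrable D (EFin \o f).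
Proof.
move=> df mD; apply: (integrableS measurableT) => //.
apply/integrableP; split; first by apply/measurable_EFinP; exact: density_meas.
apply: le_lt_trans (density_fin df); rewrite /expect le_eqVlt; apply/orP; left; apply/eqP.
by apply: eq_integral => x _ /=; rewrite mulr1 ger0_norm ?density_ge0.
Qed.

(** A density bounded by [M] gives an interval at most [M] times its length. This is the source of
    absolute continuity when the equation is integrated, and of openness when positivity is
    propagated. *)
Lemma cdf_lipschitz f : density f -> exists2 L, 0 <= L &
  forall x y, x <= y -> 0 <= cdf f y - cdf f x <= L * (y - x).
Proof.
move=> df; have [M fM] := density_ub df.
have M0 : 0 <= M by apply: le_trans (fM 0); exact: density_ge0.
exists M => // x y xy; rewrite subr_ge0 le_cdf//=.
rewrite lerBlDl -lee_fin EFinD !cdfK//.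
have wind : weight (fun t : R => ((x < t <= y)%R)%:R : R).
  have := weightM (weight_gt x) (weight_le y); congr weight.
  by apply/funext => t; case: (x < t); rewrite ?mul1r ?mul0r.
apply: (@le_trans _ _ (expect f (fun t => ((t <= x)%R)%:R%R) +
    expect f (fun t => ((x < t <= y)%R)%:R%R))%E).
  rewrite -expectD//; [|exact: density_weight|exact: weight_le].
  apply: le_expect => //; first exact: weight_le.
    by apply: weightD => //; exact: weight_le.
  by move=> t _; case: (leP t x) => //= tx; rewrite ?add0r ?lerDl// -natrD ler_nat; case: (t <= y).
apply: leeD => //.
apply: (@le_trans _ _ (\int[mu]_(t in `]x, y]) M%:E)%E).
  rewrite [leRHS]integral_mkcond; apply: ge0_le_integral => //.
  - by move=> t _; rewrite lee_fin mulr_ge0 ?ler0n// (density_ge0 df).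
  - exact: weight_emeas (weightM (density_weight df) wind).
  - apply/(measurable_restrictT _ _).1 => //.
  - move=> t _; rewrite patchE mem_setE in_itv /=.
    by case: (x < t <= y) => /=; rewrite lee_fin ?mulr1 ?mulr0.
rewrite integral_cst//= lebesgue_measure_itv /= lte_fin.
case: ltP => _; first by rewrite -EFinB -EFinM.
by rewrite mule0 lee_fin mulr_ge0// subr_ge0.
Qed.

Lemma ae_mono2 (P1 P2 Q : R -> Prop) : (forall x, P1 x -> P2 x -> Q x) ->
  {ae mu, forall x, P1 x} -> {ae mu, forall x, P2 x} -> {ae mu, forall x, Q x}.
Proof.
move=> PQ [A [mA A0 PA]] [B [mB B0 PB]]; exists (A `|` B); split.
- exact: measurableU.
- apply/eqP; rewrite eq_le measure_ge0 andbT.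
  apply: (le_trans (measureU2 _ mA mB)).
  by rewrite [X in (X + _)%E]A0 add0e [leLHS]B0.
- move=> x nQ; have [Ax|nA] := pselect (A x); [by left|right].
  apply: PB => P2x; apply: nQ; apply: PQ => //.
  by apply: contrapT => nP1; apply: nA; exact: PA.
Qed.

Lemma cdf_derive_ae f : density f ->
  {ae mu, forall x : R, is_derive x 1 (cdf f) (f x)}.
Proof.
move=> df.
have lf : locally_integrable [set: R] f.
  by apply: open_integrable_locally => //; [exact: openT|exact: density_integrable].
have -> : cdf f = fun y => \int[mu]_(x in `]-oo, y]) f x.
  by apply/funext => y; rewrite cdfE.
have L := lebesgue_differentiation lf; apply: (ae_mono2 _ L L) => x xf _.
have xx1 : x < x + 1 by rewrite ltrDl.
have [d1 d2] := @FTC1_lebesgue_pt R f -oo%O x (x + 1) xx1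
  (density_integrable df (measurable_itv _)) (ltNyr x) xf.
by apply: DeriveDef; [exact: d1|rewrite -derive1E; exact: d2].
Qed.

Lemma negligible_shift (P : R -> Prop) (d : R) :
  {ae mu, forall x, P x} -> {ae mu, forall x, P (x + d)}.
Proof.
move=> [A [mA A0 PA]].
exists ((fun x : R => 1 * x + d) @^-1` A); split.
- have := measurable_affine 1 d measurableT mA; rewrite setTI; exact.
- by have := lebesgue_measure_affine d ltr01 mA; rewrite mul1e => ->.
- by move=> x /= nP; apply: PA; rewrite mul1r.
Qed.

End cdf.

(** * Continuity and transfer of absolute continuity *)

Section continuity.
Context {R : realType}.
Notation mu := (@lebesgue_measure R).

Lemma within_continuousP (a b : R) (f : R -> R) :
  {within `[a, b], continuous f} <->
  forall x, a <= x <= b -> forall e, 0 < e -> exists2 d, 0 < d &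
    forall t, a <= t <= b -> `|t - x| < d -> `|f t - f x| < e.
Proof.
split.
- move=> /subspace_continuousP cf x xab e e0.
  have /cvgrPdist_lt/(_ _ e0)[d /= d0 H] := cf x xab.
  exists d => // t tab td; rewrite distrC; apply: H => //.
  by rewrite /= distrC.
- move=> H; apply/subspace_continuousP => x xab; apply/cvgrPdist_lt => e e0.
  have [d d0 Hd] := H x xab e e0; exists d => //= t td tab.
  by rewrite distrC Hd// distrC.
Qed.

Lemma abs_continuous_continuous (a b : R) (f : R -> R) : a <= b ->
  abs_continuous a b f -> {within `[a, b], continuous f}.
Proof.
move=> ab acf; apply/within_continuousP => x /andP[ax xb] e e0.
have [d d0 H] := acf e e0; exists d => // t /andP[at_ tb] tx.
have := H 1%N (fun _ => Num.min x t) (fun _ => Num.max x t).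
rewrite !big_ord1.
have -> : Num.max x t - Num.min x t = `|t - x|.
  by case: (ltP x t) => xt; [rewrite ger0_norm//|rewrite ler0_norm ?opprB//]; lra.
have -> : `|f (Num.max x t) - f (Num.min x t)| = `|f t - f x|.
  by case: (ltP x t) => // xt; rewrite distrC.
apply => //.
- move=> i; rewrite le_min ax at_ ge_max xb tb; split => //; split => //.
  by rewrite ge_min le_max lexx.
- by move=> i j; rewrite (ord1 i) (ord1 j) eqxx.
Qed.

(** Meant for [z * eta z] plus a Lipschitz term on a bounded interval, whose increments are
    controlled by those of [eta] and by length. *)
Lemma abs_continuous_dominated (a b K L : R) (f g : R -> R) : 0 <= K -> 0 <= L ->
  abs_continuous a b f ->
  (forall u v, a <= u -> u <= v -> v <= b ->
     `|g v - g u| <= K * `|f v - f u| + L * (v - u)) ->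
  abs_continuous a b g.
Proof.
move=> K0 L0 acf gf e e0.
have K1 : 0 < K + 1 by rewrite ltr_wpDl.
have L1 : 0 < L + 1 by rewrite ltr_wpDl.
have [d d0 H] := acf (e / 2 / (K + 1)) (divr_gt0 (divr_gt0 e0 (ltr0n _ 2)) K1).
exists (Num.min d (e / 2 / (L + 1))).
  by rewrite lt_min d0 !divr_gt0.
move=> n u v uv no; rewrite lt_min => /andP[sd sL].
have Hf := H n u v uv no sd.
apply: (@le_lt_trans _ _ (K * (\sum_i `|f (v i) - f (u i)|) + L * \sum_i (v i - u i))).
  rewrite !mulr_sumr -big_split /=; apply: ler_sum => i _.
  by have [? [? ?]] := uv i; exact: gf.
have s0 : 0 <= \sum_i (v i - u i).
  by apply: sumr_ge0 => i _; rewrite subr_ge0; have [? []] := uv i.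
have : K * (\sum_i `|f (v i) - f (u i)|) <= e / 2.
  apply: (@le_trans _ _ ((K + 1) * (\sum_i `|f (v i) - f (u i)|))).
    by rewrite ler_wpM2r ?lerDl// sumr_ge0.
  by rewrite mulrC -ler_pdivlMr// ltW.
have : L * (\sum_i (v i - u i)) < e / 2.
  apply: (@le_lt_trans _ _ ((L + 1) * (\sum_i (v i - u i)))).
    by rewrite ler_wpM2r ?lerDl.
  by rewrite mulrC -ltr_pdivlMr.
lra.
Qed.

End continuity.

Section equation.
Context {R : realType}.
Notation mu := (@lebesgue_measure R).
Context (N : nat) (p : nat -> R).
Context (p0 : forall j : nat, (1 <= j <= N)%N -> 0 <= p j).
Context (beta : R) (eta : R -> R) (sol : is_solution N p beta eta).

(** Nothing is known about [eta] at infinity at this stage; on [[1, Y]] it is continuous, hence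
    bounded, so the truncation is a density as soon as [eta] is nonnegative there. *)
Definition trunc (Y x : R) : R := if (1 <= x <= Y)%R then eta x else 0.

Lemma solution_continuous (b : R) : 1 <= b -> {within `[1, b], continuous eta}.
Proof. by have [ac _ _] := sol; move=> b1; exact: abs_continuous_continuous (ac b b1). Qed.

Lemma truncE (Y : R) : trunc Y = eta \_ `[1, Y].
Proof. by apply/funext => x; rewrite patchE mem_setE in_itv. Qed.

Lemma trunc_supp1 (Y : R) : supp1 (trunc Y).
Proof. by move=> x x1; rewrite /trunc leNgt x1. Qed.

Lemma ext0_supp1 : supp1 (ext0 eta).
Proof. by move=> x x1; rewrite /ext0 leNgt x1. Qed.

Lemma trunc_ext0 (Y x : R) : x <= Y -> ext0 eta x = trunc Y x.
Proof. by move=> xY; rewrite /trunc /ext0 xY andbT. Qed.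

Lemma trunc_density (Y : R) : 1 <= Y -> (forall x, 1 <= x <= Y -> 0 <= eta x) ->
  density (trunc Y).
Proof.
move=> Y1 eta0; have ce := solution_continuous Y1.
have [c _ cmax] := EVT_max Y1 ce.
have M0 : 0 <= Num.max (eta c) 0 by rewrite le_max lexx orbT.
have ub x : trunc Y x <= Num.max (eta c) 0.
  rewrite /trunc; case: ifPn => // xY; rewrite le_max cmax//.
have mt : measurable_fun setT (trunc Y).
  rewrite truncE; apply/(measurable_restrictT _ _).1 => //.
  exact: subspace_continuous_measurable_fun.
have t0 x : 0 <= trunc Y x by rewrite /trunc; case: ifPn => // /eta0.
split => //; first by exists (Num.max (eta c) 0).
  exact: trunc_supp1.
apply: (@le_lt_trans _ _ (\int[mu]_(t in `[1%R, Y]) (Num.max (eta c) 0)%:E)%E).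
  rewrite [leRHS]integral_mkcond; apply: ge0_le_integral => //.
  - by move=> t _; rewrite lee_fin mulr1.
  - by apply/measurable_EFinP/measurable_funM.
  - by apply/(measurable_restrictT _ _).1.
  - move=> t _; rewrite patchE mem_setE in_itv /= mulr1.
    have := ub t; rewrite /trunc; case: (1 <= t <= Y) => //.
rewrite integral_cst//= lebesgue_measure_itv /= lte_fin.
by case: ifP => _; rewrite -?EFinD -?EFinM ?mule0 ?ltry.
Qed.

(** [z * eta z + beta * cdf nu (z - 1)] is absolutely continuous with derivative zero almost
    everywhere, hence equal to its value [beta] at 1. The unit delay is why nonnegativity up to [Y]
    gives the identity up to [Y + 1]. *)
Lemma solution_integrated (Y y : R) : 1 <= Y -> (forall x, 1 <= x <= Y -> 0 <= eta x) ->
  1 <= y -> y <= Y + 1 ->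
  y * eta y = beta * (1 - cdf (qmix N p (trunc Y)) (y - 1)).
Proof.
move=> Y1 eta0 y1 yY; have [ac dae eta1] := sol.
have df := trunc_density Y1 eta0.
set nu := qmix N p (trunc Y).
have dnu : density nu by exact: qmix_density.
pose G z := z * eta z + beta * cdf nu (z - 1).
suff : G y = G 1.
  rewrite /G mul1r subrr (cdf_lt1 dnu ltr01) mulr0 addr0 eta1 => H.
  lra.
have [L L0 nuL] := cdf_lipschitz dnu.
have ce := solution_continuous y1.
have [c _ cmax] := EVT_max y1 ce.
have [c' _ cmin] := EVT_min y1 ce.
pose M : R := `|eta c| + `|eta c'|.
have etaM x : 1 <= x <= y -> `|eta x| <= M.
  move=> xy; rewrite /M ler_norml.
  have := cmax x xy; have := cmin x xy; have := ler_norm (eta c).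
  have := ler_norm (- eta c'); have := normr_ge0 (eta c); have := normr_ge0 (eta c').
  by rewrite normrN => *; apply/andP; split; lra.
apply: abs_continuous_derive0 => //.
- apply: (@abs_continuous_dominated _ _ _ y (M + `|beta| * L) eta).
  + by rewrite (le_trans ler01).
  + by rewrite addr_ge0 ?mulr_ge0// /M addr_ge0.
  + exact: ac.
  + move=> u v u1 uv vy.
    have -> : G v - G u = v * (eta v - eta u) + (v - u) * eta u
        + beta * (cdf nu (v - 1) - cdf nu (u - 1)) by rewrite /G; ring.
    have uv1 : u - 1 <= v - 1 by rewrite lerB.
    have /andP[c0 cL] := nuL _ _ uv1.
    have -> : y * `|eta v - eta u| + (M + `|beta| * L) * (v - u) =
      (y * `|eta v - eta u| + M * (v - u)) + `|beta| * L * (v - u) by ring.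
    apply: (le_trans (ler_normD _ _)); apply: lerD.
      apply: (le_trans (ler_normD _ _)); apply: lerD; rewrite !normrM.
        by rewrite ler_wpM2r// ger0_norm// (le_trans ler01)// (le_trans u1).
      rewrite mulrC (ger0_norm (_ : 0 <= v - u)) ?subr_ge0// ler_wpM2r ?subr_ge0//.
      by apply: etaM; rewrite u1 (le_trans uv).
    rewrite normrM -mulrA ler_wpM2l// ger0_norm//.
    by apply: (le_trans cL); rewrite le_eqVlt; apply/orP; left; apply/eqP; ring.
- have dnu' := negligible_shift (-1) (cdf_derive_ae dnu).
  apply: (ae_mono2 _ dae dnu') => z dz dn z1 zy.
  have zY : z - 1 <= Y by lra.
  have T1E : T1 (Qconv N p eta) z = nu (z - 1).
    (* Below 2 the left side is 0 by the definition of [T1], and the right side because [nu]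
       vanishes below 1. *)
    rewrite /T1; case: leP => z2.
      rewrite -[LHS]/(qmix N p (ext0 eta) (z - 1)).
      apply: (@qmix_eq_below _ _ _ _ _ Y) => //.
      + exact: ext0_supp1.
      + exact: trunc_supp1.
      + by move=> x xY; exact: trunc_ext0.
    by rewrite (density_supp dnu)//; lra.
  have dz' := dz z1; rewrite T1E in dz'.
  have dsh : is_derive z 1 (fun t : R => t - 1) 1.
    by apply: is_derive_eq; rewrite subr0.
  have dcomp : is_derive z 1 (fun t => cdf nu (t - 1)) (nu (z - 1)).
    have := @is_derive1_comp R (cdf nu) (fun t : R => t - 1) z (nu (z - 1)) 1 dn dsh.
    by rewrite mulr1.
  have := is_deriveD dz' (is_deriveZ beta dcomp).
  by rewrite -[beta *: nu _]/(beta * nu (z - 1)) addNr.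
Qed.

End equation.

(** * The mixture of convolution powers and the tested equation *)

Section frame.
Context {R : realType}.
Notation mu := (@lebesgue_measure R).
Context (N : nat) (p : nat -> R).
Context (p0 : forall j : nat, (1 <= j <= N)%N -> 0 <= p j).
Context (p1 : \sum_(1 <= j < N.+1) p j = 1).
Implicit Types f psi w W : R -> R.
Local Notation qmix := (qmix N p).

Lemma cdf_eq_below f g (Y y : R) : (forall x, x <= Y -> f x = g x) -> y <= Y ->
  cdf f y = cdf g y.
Proof.
move=> fg yY; congr fine; apply: eq_integral => x _.
by case: leP => xy; [rewrite fg// (le_trans xy)|rewrite !mulr0].
Qed.

Lemma cdf_increment_ge f (k x y : R) : density f -> 0 <= k -> x <= y ->
  (forall t, x < t <= y -> k <= f t) -> cdf f x + k * (y - x) <= cdf f y.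
Proof.
move=> df k0 xy kf; rewrite -lee_fin EFinD !cdfK//.
have wind : weight (fun t : R => ((x < t <= y)%R)%:R : R).
  have := weightM (weight_gt x) (weight_le y); congr weight.
  by apply/funext => t; case: (x < t); rewrite ?mul1r ?mul0r.
have wf := density_weight df.
apply: (@le_trans _ _ (expect f (fun t => ((t <= x)%R)%:R%R) +
    expect f (fun t => ((x < t <= y)%R)%:R%R))%E); last first.
  rewrite -expectD//; last exact: weight_le.
  apply: le_expect => //; [by apply: weightD => //; exact: weight_le|exact: weight_le|].
  move=> t _; rewrite -natrD ler_nat.
  by case: (leP t x) => //= tx; rewrite ?addn0 ?(le_trans tx xy).
apply: leeD => //.
apply: (@le_trans _ _ (\int[mu]_(t in `]x, y]) k%:E)%E).
  rewrite integral_cst//= lebesgue_measure_itv /= lte_fin.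
  case: ltP => [_|yx]; first by rewrite -EFinB -EFinM.
  have -> : y = x by apply/eqP; rewrite eq_le xy yx.
  by rewrite subrr mulr0 mule0.
rewrite [leLHS]integral_mkcond; apply: ge0_le_integral => //.
- by move=> t _; rewrite patchE; case: ifP.
- by apply/(measurable_restrictT _ _).1 => //.
- exact: weight_emeas (weightM wf wind).
- move=> t _; rewrite patchE mem_setE in_itv /=.
  case: ifP => xty; rewrite lee_fin ?mulr1 ?mulr0//.
  exact: kf.
Qed.

Lemma expect_qmix_le f psi (c : \bar R) : density f -> weight psi -> (0 <= c)%E ->
  (forall j, (expect (convpow f j) psi <= c)%E) -> (expect (qmix f) psi <= c)%E.
Proof.
move=> df w c0 le; rewrite expect_qmix//.
apply: (@le_trans _ _ (\sum_(1 <= j < N.+1) ((p j)%:E * c))%E).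
  rewrite big_nat_cond [leRHS]big_nat_cond; apply: lee_sum => j /andP[jN _].
  by rewrite lee_wpmul2l// lee_fin p0// -ltnS.
rewrite big_nat_cond -ge0_sume_distrl.
  by rewrite -big_nat_cond sumEFin p1 mul1e.
by move=> j /andP[jN _]; rewrite lee_fin p0// -ltnS.
Qed.

(** By submultiplicativity the expectation for a sum is at most the product over its summands, and
    further factors of at most 1 do not increase it. Used for the indicator of [x <= a], which is
    submultiplicative on positive summands, and for the constant 1. *)
Lemma expect_qmix_submul f psi : density f -> weight psi ->
  (forall x z, 1 <= x -> 1 <= z -> psi (x + z) <= psi x * psi z) ->
  (expect f psi <= 1)%E -> (expect (qmix f) psi <= expect f psi)%E.
Proof.
move=> df w sub le1; have wf := density_weight df.
apply: expect_qmix_le => //; first exact: expect_ge0.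
elim=> // j IH; have w0 : weight (cst (0 : R)) by apply: weight_cst.
have dc := convpow_density j df.
have z0 h : expect h (cst 0) = 0%E.
  by rewrite /expect; under eq_integral do rewrite mulr0; rewrite integral0.
have := @expect_conv_le _ f (convpow f j) psi psi psi (cst 0) (cst 0) (cst 0) (cst 0) df dc w w w w0 w0 w0 w0.
rewrite !z0 !mul0e !adde0 => H.
have {}H := H (fun x z x1 z1 => le_trans (sub x z x1 z1) _).
apply: le_trans (H _) _; first by move=> x z; rewrite /= !mulr0 !addr0.
rewrite -[leRHS]mule1; apply: lee_wpmul2l; first exact: expect_ge0.
exact: le_trans IH _.
Qed.

Lemma convpow_mass f j : density f -> expect f (cst 1) = 1%E ->
  expect (convpow f j) (cst 1) = 1%E.
Proof.
move=> df m1; elim: j => // j IH; rewrite -[convpow f j.+1]/(Defs.conv f (convpow f j)).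
rewrite expect_conv_mul//; last by move=> x z /=; rewrite mulr1.
- by rewrite m1 IH mule1.
- exact: convpow_density.
Qed.

Lemma qmix_mass f : density f -> expect f (cst 1) = 1%E ->
  expect (qmix f) (cst 1) = 1%E.
Proof.
move=> df m1; rewrite expect_qmix//.
under eq_bigr do rewrite convpow_mass// mule1.
by rewrite sumEFin p1.
Qed.

Lemma tailE f y : density f -> expect f (cst 1) = 1%E -> tail f y = 1 - cdf f y.
Proof.
move=> df m1; have := cdf_tail y df; rewrite m1 -EFinD => -[] <-.
by rewrite addrC addKr.
Qed.

(** The outer maximum makes the function a weight on the whole line; for [0 <= a] it is [min(x, a)]
    wherever densities live. *)
Definition clip (a x : R) : R := Num.max 0 (Num.min x a).

Lemma weight_clip (a : R) : weight (clip a).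
Proof.
split; last by move=> x; rewrite /clip le_max lexx.
by apply: measurable_maxr => //; exact: measurable_minr.
Qed.

Lemma clipE (a x : R) : 0 <= a -> 0 <= x -> clip a x = Num.min x a.
Proof. by move=> a0 x0; rewrite /clip; apply: max_r; rewrite le_min x0. Qed.

(** [min(x + z, a) <= min(x, a) + min(z, a)], and mass one turns each of the two terms into an
    expectation over a single factor. *)
Lemma expect_convpow_clip f j (a : R) : 0 <= a -> density f ->
  expect f (cst 1) = 1%E ->
  (expect (convpow f j) (clip a) <= (j.+1%:R)%:E * expect f (clip a))%E.
Proof.
move=> a0 df m1; have wf := density_weight df; have wc := weight_clip a.
elim: j => [|j IH]; first by rewrite mul1e.
have w1 : weight (cst (1 : R)) by apply: weight_cst.
have w0 : weight (cst (0 : R)) by apply: weight_cst.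
have dc := convpow_density j df.
have z0 h : expect h (cst 0) = 0%E.
  by rewrite /expect; under eq_integral do rewrite mulr0; rewrite integral0.
have := @expect_conv_le _ f (convpow f j) (clip a) (clip a) (cst 1) (cst 1) (clip a) (cst 0) (cst 0) df dc wc wc w1 w1 wc w0 w0.
rewrite !z0 !mul0e !adde0 convpow_mass// m1 mule1 mul1e => H.
apply: le_trans (H _) _.
  move=> x z x1 z1; rewrite /= mulr1 mul1r mulr0 addr0.
  rewrite !clipE//; [|lra|lra|lra].
  by case: (leP x a) => ?; case: (leP z a) => ?; case: (leP (x + z) a) => ?; lra.
rewrite -natr1 EFinD ge0_muleDl ?lee_fin// mul1e addeC.
exact: leeD.
Qed.

Lemma expect_qmix_clip f (a : R) : 0 <= a -> density f -> expect f (cst 1) = 1%E ->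
  (expect (qmix f) (clip a) <=
    (\sum_(1 <= j < N.+1) p j * j%:R)%:E * expect f (clip a))%E.
Proof.
move=> a0 df m1; have wf := density_weight df; have wc := weight_clip a.
rewrite expect_qmix// -sumEFin big_nat_cond [X in (_ <= X * _)%E]big_nat_cond.
rewrite ge0_sume_distrl; last first.
  by move=> j /andP[jN _]; rewrite lee_fin mulr_ge0// p0// -ltnS.
apply: lee_sum => j /andP[/andP[j1 jN] _]; rewrite EFinM -muleA lee_wpmul2l//.
  by rewrite lee_fin p0// j1 -ltnS.
by have := expect_convpow_clip j.-1 a0 df m1; rewrite prednK.
Qed.

(** Multiplying [y f(y) = beta P(S > y - 1)] by [w(y)], integrating and exchanging the order leaves,
    for each value [s] of [S], the integral of [w] over [1 <= y < s + 1]. The equation is asked for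
    only where [w] is nonzero, so that it can serve a truncated solution; [|y|] stands for [y] to
    have a weight on the whole line. *)
Lemma expect_tested f w W (beta : R) : density f -> expect f (cst 1) = 1%E ->
  0 <= beta -> weight w -> weight W ->
  (forall s, 1 <= s -> (W s)%:E = (\int[mu]_(y in `[1%R, (s + 1)%R]) (w y)%:E)%E) ->
  (forall y, 1 <= y -> w y != 0 -> y * f y = beta * tail (qmix f) (y - 1)) ->
  (expect f (fun y => `|y| * w y)%R = beta%:E * expect (qmix f) W)%E.
Proof.
move=> df m1 b0 ww wW WE eqn; set nu := qmix f.
have dnu : density nu by exact: qmix_density.
have wnu := density_weight dnu.
pose K (z : R * R) := (((1 <= z.1)%R%:R * w z.1) * (nu z.2 * (0 < z.2 - z.1 + 1)%R%:R))%:E.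
have w1 : weight (fun y => ((1 <= y)%R%:R * w y)).
  apply: weightM => //; split; last by move=> x; rewrite ler0n.
  have -> : (fun x : R => ((1 <= x)%R)%:R : R) = \1_(`[1, +oo[%classic).
    by apply/funext => x; rewrite indicE mem_setE in_itv /= andbT.
  exact: measurable_indic.
have mK : measurable_fun setT K.
  apply/measurable_EFinP; apply: measurable_funM.
    by apply: (measurableT_comp w1.1); exact: measurable_fst.
  apply: measurable_funM; first by apply: (measurableT_comp wnu.1); exact: measurable_snd.
  apply: (measurableT_comp (weight_gt 0).1).
  by apply: measurable_funD => //; apply: measurable_funB; [exact: measurable_snd|exact: measurable_fst].
have K0 z : (0 <= K z)%E.
  by rewrite lee_fin mulr_ge0//; [exact: w1.2|rewrite mulr_ge0 ?ler0n ?wnu.2].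
transitivity (beta%:E * \int[mu]_y \int[mu]_s K (y, s))%E.
  rewrite -ge0_integralZl//; last first.
  - by move=> y _; apply: integral_ge0.
  - exact: (@measurable_fun_fubini_tonelli_F _ _ _ _ R mu K mK K0).
  apply: eq_integral => y _.
  transitivity (beta%:E * (((1 <= y)%R%:R * w y)%:E * (tail nu (y - 1))%:E))%E; last first.
    congr (_ * _)%E; rewrite tailK// -ge0_integralZl//.
    - apply: eq_integral => s _; rewrite /K /= -EFinM; congr (_ * (_ * _%:R))%:E.
      by congr nat_of_bool; rewrite -subr_gt0; congr (0 < _); ring.
    - by apply: weight_emeas; apply: weightM => //; exact: weight_gt.
    - by move=> s _; rewrite lee_fin mulr_ge0 ?ler0n ?wnu.2.
    - by rewrite lee_fin; exact: w1.2.
  rewrite -!EFinM; congr EFin; case: (leP 1 y) => y1; last first.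
    by rewrite (density_supp df y1) !mul0r mulr0.
  rewrite mul1r ger0_norm ?(le_trans ler01)//.
  have [->|wy] := eqVneq (w y) 0; first by rewrite !(mulr0, mul0r).
  have e := eqn y y1 wy; transitivity (w y * (y * f y)); first by ring.
  by rewrite e; ring.
congr (_ * _)%E; rewrite (@fubini_tonelli _ _ _ _ R mu mu K)//.
apply: eq_integral => s _; have [s1|s1] := ltP s 1.
  rewrite (density_supp dnu s1) mul0r integral0_eq// => y _.
  by rewrite /K /= (density_supp dnu s1) mul0r mulr0.
(* [tail] uses a strict inequality, so the integral runs over [[1, s + 1[]; the closed endpoint in
   the hypothesis on [W] is a null set. *)
rewrite EFinM WE// -integral_itv_bndo_bndc; last first.
  by apply: measurable_funTS; exact: weight_emeas.
rewrite [X in _ = (_ * X)%E]integral_mkcond -ge0_integralZl//.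
- apply: eq_integral => y _; rewrite /K /= patchE mem_setE in_itv /=.
  have -> : (0 < s - y + 1) = (y < s + 1) by rewrite -[RHS]subr_gt0; congr (0 < _); ring.
  case: (1 <= y); case: (y < s + 1); rewrite /= ?mul0r ?mulr0 ?mul1r ?mulr1 ?mule0//.
  by rewrite mulrC EFinM.
- by apply/(measurable_restrictT _ _).1 => //; apply: measurable_funTS; exact: weight_emeas.
- by move=> y _; rewrite patchE; case: ifP => // _; rewrite lee_fin ww.2.
- by rewrite lee_fin wnu.2.
Qed.

(** Testing with the indicator of [y <= a] gives [E X = (theta / q) E min(S, a - 1) <= theta E
    min(X, a - 1)], which is at most [E min(X, a - 1)]. But [X] exceeds [a - 1] with positive
    probability, so [E X] is strictly larger. *)
Lemma no_compact_support f (a theta : R) : density f ->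
  expect f (cst 1) = 1%E -> 1 < a ->
  (forall y, a < y -> f y = 0) -> (forall y, 1 <= y -> y < a -> 0 < f y) ->
  theta <= 1 -> 0 < theta ->
  (forall y, 1 <= y -> y <= a -> y * f y =
     theta / (\sum_(1 <= j < N.+1) p j * j%:R) * tail (qmix f) (y - 1)) -> False.
Proof.
move=> df m1 a1 fa fpos th1 th0 eqn.
set q := \sum_(1 <= j < N.+1) p j * j%:R in eqn *.
have q1 : 1 <= q.
  rewrite -[leLHS]p1 /q big_nat_cond [leRHS]big_nat_cond.
  apply: ler_sum => j /andP[/andP[j1 jN] _].
  by rewrite ler_peMr ?ler1n// p0// j1 -ltnS.
have q0 : 0 < q by rewrite (lt_le_trans ltr01).
have a10 : 0 <= a - 1 by lra.
have wf := density_weight df.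
have b0 : 0 <= theta / q by rewrite divr_ge0// ltW.
have w01 : weight (fun y : R => ((y <= a)%R)%:R : R) by exact: weight_le.
have H := @expect_tested f (fun y => ((y <= a)%R)%:R) (clip (a - 1)) (theta / q) df m1 b0 w01 (weight_clip _).
have {}H : (expect f (fun y => `|y| * ((y <= a)%R)%:R)%R = (theta / q)%:E * expect (qmix f) (clip (a - 1)))%E.
  apply: H => [s s1|y y1]; last first.
    by case: (leP y a) => ya; [move=> _; exact: eqn|rewrite eqxx].
  rewrite clipE//; last by lra.
  transitivity (\int[mu]_(y in `[1%R, (Num.min (s + 1) a)%R]) (cst 1%E) y)%E.
    rewrite integral_cst//= lebesgue_measure_itv /= lte_fin mul1e.
    rewrite ifT; last by rewrite lt_min a1 andbT; lra.
    by rewrite -EFinB; congr EFin; case: (leP s (a - 1)) => h; case: (leP (s + 1) a) => h'; lra.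
  rewrite integral_mkcond [RHS]integral_mkcond; apply: eq_integral => y _.
  rewrite !patchE !mem_setE !in_itv /= le_min andbA.
  by case: (1 <= y <= s + 1); case: (y <= a).
have le1 : (expect f (fun y => `|y| * ((y <= a)%R)%:R)%R <= expect f (clip (a - 1)))%E.
  rewrite H; apply: (@le_trans _ _ ((theta / q)%:E * (q%:E * expect f (clip (a - 1))))%E).
    by rewrite lee_wpmul2l ?lee_fin// expect_qmix_clip.
  rewrite muleA -EFinM divfK ?lt0r_neq0// -[leRHS]mul1e lee_wpmul2r ?lee_fin//.
  by apply: expect_ge0 => //; exact: weight_clip.
(* On []d, a]] the gain [y - (a - 1)] is at least one half. Between [d] and the midpoint [e] the
   density is at least [f e > 0], because [y * f y] is nonincreasing there, so this range carries
   mass. *)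
pose d := Num.max 1 (a - 2^-1); pose e := (d + a) / 2.
have da : d < a by rewrite /d gt_max a1; lra.
have d1 : 1 <= d by rewrite /d le_max lexx.
have da2 : a - 2^-1 <= d by rewrite /d le_max lexx orbT.
have de : d < e by rewrite /e; lra.
have ea : e < a by rewrite /e; lra.
have fe0 : 0 < f e by apply: fpos => //; lra.
have wge : weight (fun y : R => ((d < y)%R)%:R : R) by exact: weight_gt.
have le2 : (expect f (clip (a - 1)) + (2^-1)%:E * expect f (fun y => ((d < y)%R)%:R)%R <=
   expect f (fun y => `|y| * ((y <= a)%R)%:R)%R)%E.
  rewrite -expectZ ?invr_ge0// -expectD//; [|exact: weight_clip|by apply: weightM => //; apply: weight_cst; rewrite invr_ge0].
  apply: ge0_le_integral => //.
  - move=> y _; rewrite lee_fin mulr_ge0 ?wf.2// addr_ge0 ?mulr_ge0 ?invr_ge0 ?ler0n//.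
    exact: (weight_clip _).2.
  - apply: weight_emeas; apply: weightM => //; apply: weightD; first exact: weight_clip.
    by apply: weightM => //; apply: weight_cst; rewrite invr_ge0.
  - apply: weight_emeas; apply: weightM => //; apply: weightM => //.
  - move=> y _; rewrite lee_fin; have [ya|ya] := ltP a y; first by rewrite fa// !mul0r.
    have [y1|y1] := ltP y 1; first by rewrite (density_supp df y1) !mul0r.
    rewrite ler_wpM2l ?wf.2// mulr1 ger0_norm; last by lra.
    rewrite clipE//; last by lra.
    by case: (leP y (a - 1)) => h1; case: (ltP d y) => h2 /=; lra.
have clipfin : expect f (clip (a - 1)) \is a fin_num.
  apply: expect_fin_num => //; first exact: weight_clip.
  apply: (@expect_bounded_fin _ _ _ (a - 1)) => //; first exact: weight_clip.
  by move=> y y1; rewrite clipE//; [rewrite ge_min lexx orbT|lra].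
have : (expect f (fun y => ((d < y)%R)%:R)%R <= 0)%E.
  have := le_trans le2 le1; rewrite -[leRHS]adde0 leeD2lE// => h.
  rewrite leNgt; apply/negP => pos; move: h; rewrite leNgt => /negP; apply.
  by rewrite mule_gt0// lte_fin invr_gt0.
rewrite -tailK// lee_fin tailE// leNgt => /negP; apply; rewrite subr_gt0.
have mono t : d <= t -> t <= e -> f e <= f t.
  move=> dt te; have t1 : 1 <= t by lra.
  have t0 : 0 < t by lra.
  rewrite -(ler_pM2l t0); apply: (@le_trans _ _ (e * f e)).
    by rewrite ler_pM2r.
  rewrite !eqn//; [|lra|lra|lra].
  by rewrite ler_wpM2l// le_tail ?lerB//; exact: qmix_density.
have mono' t : d < t <= e -> f e <= f t.
  by move=> /andP[dt te]; apply: mono => //; exact: ltW.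
have inc := cdf_increment_ge df (ltW fe0) (ltW de) mono'.
have cdfe1 : cdf f e <= 1 by have := tailE e df m1; have := tail_ge0 e df; lra.
apply: lt_le_trans cdfe1; apply: lt_le_trans inc.
by rewrite ltrDl mulr_gt0// subr_gt0.
Qed.

End frame.

(** * Positivity and total mass *)

Section positivity.
Context {R : realType}.
Notation mu := (@lebesgue_measure R).
Context (N : nat) (p : nat -> R).
Context (p0 : forall j : nat, (1 <= j <= N)%N -> 0 <= p j).
Context (p1 : \sum_(1 <= j < N.+1) p j = 1).
Local Notation qmix := (qmix N p).

(** The interface to the later analysis, which works from the integrated equation and mass one and
    does not return to the differential equation. *)
Record prob_sol (beta : R) (f : R -> R) : Prop := ProbSol {
  sol_density : density f;
  sol_mass : expect f (cst 1) = 1%E;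
  sol_eq : forall y, 1 <= y -> y * f y = beta * tail (qmix f) (y - 1) }.

Context (theta : R) (theta0 : 0 < theta).
Let q := \sum_(1 <= j < N.+1) p j * j%:R.
Let beta := theta / q.
Context (eta : R -> R) (sol : is_solution N p beta eta).

Lemma mean_degree_ge1 : 1 <= q.
Proof.
rewrite -[leLHS]p1 /q big_nat_cond [leRHS]big_nat_cond.
apply: ler_sum => j /andP[/andP[j1 jN] _].
by rewrite ler_peMr ?ler1n// p0// j1 -ltnS.
Qed.

Let beta_gt0 : 0 < beta.
Proof. by rewrite divr_gt0// (lt_le_trans ltr01)// mean_degree_ge1. Qed.

Let eta1 : eta 1 = beta. Proof. by have [] := sol. Qed.

(** As summands are positive, [S <= a] forces each of them to be at most [a]; the bound
    [cdf f a <= 1] disposes of all factors but one. *)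
Lemma cdf_qmix_le (f : R -> R) (a : R) : density f -> cdf f a <= 1 ->
  cdf (qmix f) a <= cdf f a.
Proof.
move=> df le1; have dq := qmix_density p0 df.
rewrite -lee_fin !cdfK//; apply: expect_qmix_submul => //.
- exact: weight_le.
- move=> x z x1 z1; rewrite -natrM ler_nat.
  case: (leP x a) => xa; case: (leP z a) => za; case: (leP (x + z) a) => xza //=; lra.
- by rewrite -cdfK// lee_fin.
Qed.

Lemma qmix_mass_le (f : R -> R) : density f -> (expect f (cst 1%R) <= 1)%E ->
  (expect (qmix f) (cst 1%R) <= expect f (cst 1%R))%E.
Proof.
move=> df le1; apply: expect_qmix_submul => //.
by move=> x z _ _ /=; rewrite mulr1.
Qed.

(** The two halves feed each other. Positivity of [eta x] follows from a distribution function below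
    1 at [x - 1]; the distribution function stays below 1 at [x] because [no_compact_support]
    forbids a solution that is positive on [[1, x[] from exhausting its mass at [x]. *)
Let pos (t : R) : Prop := 0 < eta t /\ cdf (trunc eta t) t < 1.

Lemma cdf_trunc_below (s t x : R) : x <= s -> s <= t ->
  cdf (trunc eta s) x = cdf (trunc eta t) x.
Proof.
move=> xs st; apply: (@cdf_eq_below _ _ _ s) => // y ys.
by rewrite -!trunc_ext0// (le_trans ys).
Qed.

(** Both conditions are open: [eta] is continuous and distribution functions are Lipschitz. *)
Lemma solution_pos_right (x : R) : 1 <= x -> (forall t, 1 <= t <= x -> pos t) ->
  exists2 y, x < y & forall t, x < t <= y -> pos t.
Proof.
move=> x1 px; have xx : 1 <= x <= x by rewrite x1 lexx.
have [ex cx] := px x xx.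
have [d d0 Hd] : exists2 d, 0 < d & forall t, x <= t -> t < x + d -> 0 < eta t.
  have x11 : 1 <= x + 1 by lra.
  have /within_continuousP/(_ x) := solution_continuous sol x11.
  have xin : 1 <= x <= x + 1 by apply/andP; split; lra.
  move=> /(_ xin _ ex)[d d0 Hd]; exists (Num.min d 1).
    by rewrite lt_min d0 ltr01.
  move=> t xt; rewrite -ltrBlDl lt_min => /andP[td t1].
  have tin : 1 <= t <= x + 1 by apply/andP; split; lra.
  have txd : `|t - x| < d by rewrite ger0_norm ?subr_ge0.
  by have := Hd t tin txd; rewrite ltr_norml => /andP[]; lra.
pose Y := x + d / 2.
have xY : x < Y by rewrite /Y ltrDl divr_gt0.
have Y1 : 1 <= Y by lra.
have eY t : 1 <= t <= Y -> 0 <= eta t.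
  move=> /andP[t1 tY]; have [tx|xt] := leP t x.
    have tx' : 1 <= t <= x by rewrite t1 tx.
    by have [/ltW] := px t tx'.
  by apply/ltW/Hd; rewrite ?ltW//; move: tY; rewrite /Y; lra.
have dY := trunc_density sol Y1 eY.
have [L L0 lip] := cdf_lipschitz dY.
pose e := (1 - cdf (trunc eta Y) x) / (L + 1) / 2.
have cx' : cdf (trunc eta Y) x < 1 by rewrite -(@cdf_trunc_below x) // ltW.
have L1 : 0 < L + 1 by lra.
have e0 : 0 < e by rewrite !divr_gt0// subr_gt0.
exists (Num.min Y (x + e)); first by rewrite lt_min xY ltrDl.
move=> t /andP[xt]; rewrite le_min => /andP[tY te]; split.
  by apply: Hd; [exact: ltW|move: tY; rewrite /Y; lra].
rewrite (@cdf_trunc_below t Y)//.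
have /andP[_ lt] := lip x t (ltW xt).
have : L * (t - x) <= (L + 1) * e.
  by apply: ler_pM => //; lra.
have -> : (L + 1) * e = (1 - cdf (trunc eta Y) x) / 2 by rewrite /e; field; rewrite lt0r_neq0.
lra.
Qed.

Lemma solution_pos_left (x : R) : theta <= 1 -> 1 < x ->
  (forall t, 1 <= t -> t < x -> pos t) -> pos x.
Proof.
move=> th1 x1 px; have x1' := ltW x1.
have ex0 : 0 <= eta x.
  rewrite leNgt; apply/negP => ex.
  have /within_continuousP/(_ x) := solution_continuous sol x1'.
  have xin : 1 <= x <= x by rewrite x1' lexx.
  have nex : 0 < - eta x by lra.
  move=> /(_ xin _ nex)[d d0 Hd].
  pose t := Num.max 1 (x - d / 2).
  have t1 : 1 <= t by rewrite le_max lexx.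
  have tx : t < x by rewrite gt_max x1; lra.
  have dt : x - d / 2 <= t by rewrite le_max lexx orbT.
  have [et _] := px t t1 tx.
  have tin : 1 <= t <= x by rewrite t1 ltW.
  have : `|t - x| < d by rewrite ltr0_norm; lra.
  by move=> /(Hd t tin); rewrite ltr_norml => /andP[]; lra.
have eX t : 1 <= t <= x -> 0 <= eta t.
  move=> /andP[t1]; rewrite le_eqVlt => /orP[/eqP->//|tx].
  by have [/ltW] := px t t1 tx.
have dX := trunc_density sol x1' eX.
have cle1 t : t < x -> cdf (trunc eta x) t < 1.
  move=> tx; have [t1|t1] := ltP t 1; first by rewrite cdf_lt1.
  by have [_] := px t t1 tx; rewrite (@cdf_trunc_below t x)// ltW.
have x1x : x - 1 < x by lra.
have lt1 := cle1 _ x1x.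
have eqx t : 1 <= t <= x -> t * eta t = beta * (1 - cdf (qmix (trunc eta x)) (t - 1)).
  by move=> /andP[t1 tx]; apply: (solution_integrated p0 sol) => //; lra.
split.
  have xx : 1 <= x <= x by rewrite x1' lexx.
  have := eqx x xx; have := cdf_qmix_le dX (ltW lt1) => h1 h2.
  have : 0 < x * eta x by rewrite h2 mulr_gt0// subr_gt0 (le_lt_trans h1).
  by rewrite pmulr_rgt0// (lt_trans ltr01).
have cx : cdf (trunc eta x) x <= 1.
  have [L L0 lip] := cdf_lipschitz dX.
  apply/ler_addgt0Pr => e e0; have L1 : 0 < L + 1 by lra.
  pose t := x - e / (L + 1).
  have tx : t < x by rewrite /t; have := divr_gt0 e0 L1; lra.
  have /andP[_ h] := lip t x (ltW tx); have := cle1 t tx.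
  have : L * (x - t) <= e.
    have -> : x - t = e / (L + 1) by rewrite /t; ring.
    by rewrite mulrA ler_pdivrMr// mulrC ler_pM2l//; lra.
  lra.
rewrite lt_neqAle cx andbT; apply/eqP => c1.
have ax y : x < y -> trunc eta x y = 0.
  by move=> xy; rewrite /trunc [y <= x]leNgt xy andbF.
(* The truncation has no mass beyond [x], so a distribution function equal to 1 at [x] means total
   mass one, and the integrated equation takes the tail form that [no_compact_support] expects. *)
have mass1 : expect (trunc eta x) (cst 1) = 1%E.
  rewrite -(cdf_tail x dX) c1 tailK// -[RHS]adde0; congr (_ + _)%E.
  rewrite /expect; under eq_integral.
    move=> y _; have -> : trunc eta x y * (x < y)%R%:R = 0.
      by case: (ltP x y) => [/ax ->|_]; rewrite ?mul0r ?mulr0.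
    over.
  by rewrite integral0.
apply: (@no_compact_support R N p p0 p1 (trunc eta x) x theta) => //.
- by move=> y y1 yx; rewrite /trunc y1 ltW//; have [] := px y y1 yx.
- move=> y y1 yx; rewrite {1}/trunc y1 yx tailE.
  + by rewrite eqx ?y1.
  + exact: qmix_density.
  + exact: qmix_mass.
Qed.

Lemma solution_pos (t : R) : theta <= 1 -> 1 <= t -> pos t.
Proof.
move=> th1 t1.
apply: (@real_induction R 1 t pos); last by rewrite t1 lexx.
- have e1 x : 1 <= x <= 1 -> 0 <= eta x.
    move=> /andP[? ?]; have -> : x = 1 by lra.
    by rewrite eta1; exact: ltW beta_gt0.
  have d1 := trunc_density sol (lexx 1) e1.
  split; first by rewrite eta1.
  have [L L0 lip] := cdf_lipschitz d1.
  have L1 : 0 < L + 1 by lra.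
  (* The truncation at 1 lives on a single point. Its mass is not computed: the Lipschitz bound over
     a step of length [1 / (2 (L + 1))], starting where the distribution function is 0, already
     keeps it below 1. *)
  pose s := 1 - (2 * (L + 1))^-1.
  have e0 : 0 < (2 * (L + 1))^-1 by rewrite invr_gt0 mulr_gt0.
  have tl1 : s < 1 by rewrite /s; lra.
  have /andP[_] := lip s 1 (ltW tl1); rewrite (cdf_lt1 d1 tl1) subr0 => h.
  apply: le_lt_trans h _; have -> : 1 - s = (2 * (L + 1))^-1 by rewrite /s; ring.
  by rewrite ltr_pdivrMr ?mulr_gt0//; lra.
- move=> x x1 _ px; have [y xy H] := solution_pos_right x1 px.
  by exists y => // s /H.
- by move=> x x1 _ px; exact: solution_pos_left.
Qed.

Lemma ext0_measurable : measurable_fun setT (ext0 eta).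
Proof.
have -> : ext0 eta = eta \_ `[1, +oo[.
  by apply/funext => x; rewrite patchE mem_setE in_itv /= andbT.
apply/(measurable_restrictT _ _).1 => //.
apply: subspace_continuous_measurable_fun => //.
apply/subspace_continuousP => x /=; rewrite in_itv /= andbT => x1.
apply/cvgrPdist_lt => e e0.
have x11 : 1 <= x + 1 by lra.
have /within_continuousP/(_ x) := solution_continuous sol x11.
have xin : 1 <= x <= x + 1 by apply/andP; split; lra.
move=> /(_ xin _ e0)[d d0 Hd].
exists (Num.min d 1) => /=; first by rewrite lt_min d0 ltr01.
move=> t /=; rewrite lt_min => /andP[td t1]; rewrite in_itv /= andbT => t1'.
rewrite distrC; apply: Hd; last by rewrite distrC.
by rewrite t1' /=; move: t1; rewrite ltr_norml => /andP[]; lra.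
Qed.

Section nonnegative.
Context (eta_ge0 : forall y, 1 <= y -> 0 <= eta y).

Let dT (Y : R) : 1 <= Y -> density (trunc eta Y).
Proof. by move=> Y1; apply: (trunc_density sol) => // x /andP[/eta_ge0]. Qed.

Lemma ext0_le (y : R) : ext0 eta y <= beta.
Proof.
rewrite /ext0; case: ifPn => [y1|_]; last exact: ltW beta_gt0.
have dq := qmix_density p0 (dT y1).
have H : y * eta y = beta * (1 - cdf (qmix (trunc eta y)) (y - 1)).
  by apply: (solution_integrated p0 sol) => //; [move=> x /andP[/eta_ge0]|lra].
apply: (@le_trans _ _ (y * eta y)); first by rewrite ler_peMl// eta_ge0.
by rewrite H ler_piMr ?(ltW beta_gt0)// gerBl cdf_ge0.
Qed.

Lemma ext0_density : (expect (ext0 eta) (cst 1%R) < +oo)%E -> density (ext0 eta).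
Proof.
move=> fin; split => //; first exact: ext0_measurable.
- by move=> x; rewrite /ext0; case: ifPn => // /eta_ge0.
- by exists beta; exact: ext0_le.
- exact: ext0_supp1.
Qed.

Lemma ext0_integrated (y : R) : density (ext0 eta) -> 1 <= y ->
  y * eta y = beta * (1 - cdf (qmix (ext0 eta)) (y - 1)).
Proof.
move=> de y1.
have -> : y * eta y = beta * (1 - cdf (qmix (trunc eta y)) (y - 1)).
  by apply: (solution_integrated p0 sol) => //; [move=> x /andP[/eta_ge0]|lra].
suff -> : cdf (qmix (trunc eta y)) (y - 1) = cdf (qmix (ext0 eta)) (y - 1) by [].
apply: (@cdf_eq_below _ _ _ y); last by rewrite gerBl.
apply: qmix_eq_below => //; [exact: trunc_supp1|exact: ext0_supp1|].
by move=> x xy; rewrite (@trunc_ext0 _ _ y).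
Qed.

Lemma ext0_prob_sol : expect (ext0 eta) (cst 1) = 1%E -> prob_sol beta (ext0 eta).
Proof.
move=> m1; have de : density (ext0 eta) by apply: ext0_density; rewrite m1 ltry.
split => // y y1; rewrite {1}/ext0 y1 ext0_integrated// tailE//.
- exact: qmix_density.
- exact: qmix_mass.
Qed.

End nonnegative.

(** The mass is at most 1 as a monotone limit of truncated masses below 1. If it were some [m < 1],
    then [y * eta y >= beta * (1 - m)] throughout, and the integral of [1 / y] diverges. *)
Lemma solution_prob_sol : theta <= 1 -> prob_sol beta (ext0 eta).
Proof.
move=> th1; have epos y : 1 <= y -> 0 < eta y.
  by move=> y1; have [] := solution_pos th1 y1.
have e0 y : 1 <= y -> 0 <= eta y by move=> /epos/ltW.
have le1 : (expect (ext0 eta) (cst 1%R) <= 1)%E.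
  pose g n x : \bar R := (trunc eta n.+1%:R x)%:E.
  have g0 n x : (0 <= g n x)%E.
    by rewrite lee_fin /trunc; case: ifPn => // /andP[/e0].
  have n1 n : 1 <= n.+1%:R :> R by rewrite ler1n.
  have dT n : density (trunc eta n.+1%:R).
    by apply: (trunc_density sol) => // x /andP[/e0].
  have mg n : measurable_fun setT (g n).
    by apply/measurable_EFinP; exact: density_meas (dT n).
  have ndg x : {homo g^~ x : n m / (n <= m)%N >-> (n <= m)%E}.
    move=> n m nm; rewrite lee_fin /trunc; case: ifPn => [/andP[x1 xn]|_].
      by rewrite x1 (le_trans xn)// ler_nat.
    by case: ifPn => // /andP[/e0].
  have -> : expect (ext0 eta) (cst 1) = limn (fun n => (\int[mu]_x g n x)%E).
    rewrite -monotone_convergence//; apply: eq_integral => x _; rewrite mulr1.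
    apply/esym/cvg_lim => //; apply: cvg_near_cst.
    near=> n; rewrite /g (@trunc_ext0 _ _ n.+1%:R)//.
    by rewrite (@le_trans _ _ n%:R) ?ler_nat//; near: n; exact: nbhs_infty_ger.
  apply: lime_le.
    apply: ereal_nondecreasing_is_cvgn => n m nm; apply: ge0_le_integral => //; [exact: mg|exact: mg|by move=> x _; exact: ndg].
  apply: nearW => n; have [_ c1] := solution_pos th1 (n1 n).
  rewrite (_ : (\int[mu]_x g n x)%E = (cdf (trunc eta n.+1%:R) n.+1%:R)%:E) ?lee_fin ?ltW//.
  rewrite cdfK//; apply: eq_integral => x _; rewrite /g; congr EFin.
  by rewrite /trunc; case: (leP x n.+1%:R); rewrite ?mulr1// andbF mul0r.
have de : density (ext0 eta) by apply: ext0_density => //; rewrite (le_lt_trans le1)// ltry.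
apply: ext0_prob_sol => //; apply/eqP; rewrite eq_le le1 /= leNgt; apply/negP => lt1.
pose m := fine (expect (ext0 eta) (cst 1)).
have mE : m%:E = expect (ext0 eta) (cst 1).
  by rewrite /m fineK//; apply: expect_fin_num (density_fin de) => //; exact: density_weight.
have m1 : m < 1 by rewrite -lte_fin mE.
have cle y : cdf (ext0 eta) y <= 1.
  rewrite -lee_fin; apply: le_trans le1; rewrite -(cdf_tail y de).
  by rewrite leeDl// lee_fin tail_ge0.
have nule y : cdf (qmix (ext0 eta)) y <= m.
  have dq := qmix_density p0 de.
  rewrite -lee_fin mE; apply: le_trans (qmix_mass_le de le1).
  by rewrite -(cdf_tail y dq) leeDl// lee_fin tail_ge0.
pose c := beta * (1 - m).
have c0 : 0 < c by rewrite mulr_gt0// subr_gt0.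
have fc y : 1 <= y -> c / y <= ext0 eta y.
  move=> y1; have y0 : 0 < y by lra.
  rewrite /ext0 y1 ler_pdivrMr// mulrC ext0_integrated//.
  by rewrite ler_pM2l// lerD2l lerN2.
(* Divergence in dyadic form: on [[y, 2 * y]] the density is at least [c / (2 * y)], so this
   interval adds at least [c / 2]. *)
have step y : 1 <= y -> cdf (ext0 eta) y + c / 2 <= cdf (ext0 eta) (2 * y).
  move=> y1; have y0 : 0 < y by lra.
  have k0 : 0 <= c / (2 * y) by rewrite ltW// divr_gt0// mulr_gt0.
  have y2 : y <= 2 * y by lra.
  have H := @cdf_increment_ge _ _ (c / (2 * y)) y (2 * y) de k0 y2.
  have E : c / (2 * y) * (2 * y - y) = c / 2 by field; rewrite lt0r_neq0.
  rewrite E in H; apply: H => t /andP[yt ty]; have t1 : 1 <= t by lra.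
  apply: le_trans (fc t t1); rewrite ler_pM2l// lef_pV2 ?posrE//; lra.
have grow n : n%:R * (c / 2) <= cdf (ext0 eta) (2 ^+ n).
  elim: n => [|n IH]; first by rewrite mul0r cdf_ge0.
  have := step (2 ^+ n) (exprn_ege1 _ (ler1n _ 2)); rewrite -exprS.
  have -> : n.+1%:R * (c / 2) = n%:R * (c / 2) + c / 2 by rewrite -natr1; ring.
  by move=> h; apply: le_trans h; rewrite lerD2r.
have c20 : 0 < c / 2 by rewrite divr_gt0.
have := archi_boundP (ltW (divr_gt0 ltr01 c20)).
rewrite ltr_pdivrMr// ltNge => /negP; apply.
exact: le_trans (grow _) (cle _).
Unshelve. all: by end_near.
Qed.

Lemma measurable_solution (D : set R) : measurable D -> D `<=` `[1, +oo[%classic ->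
  measurable_fun D eta.
Proof.
move=> mD sD; apply: (@eq_measurable_fun _ _ _ _ _ (ext0 eta)).
  by move=> x /set_mem/sD; rewrite /= in_itv /= andbT /ext0 => ->.
exact: measurable_funTS ext0_measurable.
Qed.

Lemma expect_ext0 (psi : R -> R) : measurable_fun setT psi ->
  expect (ext0 eta) psi = (\int[mu]_(y in `]1%R, +oo[) (eta y * psi y)%:E)%E.
Proof.
move=> mpsi; rewrite integral_itv_obnd_cbnd.
  rewrite [RHS]integral_mkcond; apply: eq_integral => x _.
  by rewrite patchE mem_setE in_itv /= andbT /ext0; case: (1 <= x); rewrite ?mul0r.
apply/measurable_EFinP/measurable_funM; last exact: measurable_funTS.
apply: measurable_solution => // x /=; rewrite !in_itv /= !andbT; exact: ltW.
Qed.

Lemma prob_sol_in_P : prob_sol beta (ext0 eta) -> in_P eta.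
Proof.
move=> [df m1 _]; split.
- have := density_integrable df (measurable_itv `]1, +oo[); apply: eq_integrable => //.
  by move=> x /set_mem /=; rewrite in_itv /= andbT /ext0 => /ltW ->.
- by apply: aeW => y /ltW y1; have := density_ge0 df y; rewrite /ext0 y1.
- have := expect_ext0 (@measurable_cst _ _ R R setT 1); rewrite m1 => ->.
  by apply: eq_integral => x _; rewrite mulr1.
Qed.

(** Membership in [in_P] gives the sign only almost everywhere; a negative value at [y] would by
    continuity persist on an interval to the right of [y], which is not null. *)
Lemma in_P_prob_sol : in_P eta -> prob_sol beta (ext0 eta).
Proof.
move=> [_ [A [mA A0 PA]] m1]; apply: ext0_prob_sol; last first.
  by rewrite expect_ext0//; under eq_integral do rewrite mulr1.
move=> y y1; rewrite leNgt; apply/negP => ey.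
have y11 : 1 <= y + 1 by lra.
have /within_continuousP/(_ y) := solution_continuous sol y11.
have yin : 1 <= y <= y + 1 by apply/andP; split; lra.
have ney : 0 < - eta y by lra.
move=> /(_ yin _ ney)[d d0 Hd].
pose e : R := Num.min d 1.
have e0 : 0 < e by rewrite lt_min d0 ltr01.
have : (mu `]y, (y + e)%R[%classic <= mu A)%E.
  apply: le_measure; rewrite ?inE// => t /=; rewrite in_itv /= => /andP[yt].
  rewrite -ltrBlDl lt_min => /andP[td t1].
  apply: PA => /(_ (le_lt_trans y1 yt)) et.
  have tin : 1 <= t <= y + 1 by apply/andP; split; lra.
  have ted : `|t - y| < d by rewrite gtr0_norm ?subr_gt0.
  by have := Hd t tin ted; rewrite ltr_norml => /andP[_]; lra.
rewrite [X in (_ <= X)%E]A0 lebesgue_measure_itv /= lte_fin ltrDl e0 -EFinB lee_fin.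
lra.
Qed.

End positivity.

(** * The Laplace transform *)

Section real_expectation.
Context {R : realType}.
Notation mu := (@lebesgue_measure R).
Implicit Types f psi : R -> R.

Definition Rexpect f psi : R := \int[mu]_y (f y * psi y).

Lemma Rexpect_fine f psi : Rexpect f psi = fine (expect f psi).
Proof. by []. Qed.

Lemma RexpectK f psi : weight f -> weight psi -> (expect f psi < +oo)%E ->
  (Rexpect f psi)%:E = expect f psi.
Proof. by move=> wf w fin; rewrite Rexpect_fine fineK// expect_fin_num. Qed.

Lemma expect_bounded_integrable f psi (M : R) : density f -> measurable_fun setT psi ->
  (forall y, 1 <= y -> `|psi y| <= M) ->
  mu.-integrable setT (EFin \o (fun y => f y * psi y)).
Proof.
move=> df mpsi le; apply/integrableP; split.
  apply/measurable_EFinP/measurable_funM => //; exact: density_meas.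
have wn : weight (fun y => `|psi y|) by split => //; exact: measurableT_comp.
apply: le_lt_trans (@expect_bounded_fin _ f (fun y => `|psi y|) M df wn le).
rewrite le_eqVlt; apply/orP; left; apply/eqP; apply: eq_integral => y _ /=.
by rewrite normrM (ger0_norm (density_ge0 df _)).
Qed.

(** Dominated differentiation: a constant majorant suffices because the density has finite mass, and
    it is asked for on [[1, +oo[] alone, where the density lives. *)
Lemma expect_derive f (psi dpsi : R -> R -> R) (u v a M : R) : density f ->
  u < a -> a < v ->
  (forall x, u < x -> x < v -> measurable_fun setT (psi x)) ->
  (forall x y, u < x -> x < v -> 1 <= y -> `|psi x y| <= M) ->
  (forall x y, u < x -> x < v -> 1 <= y -> is_derive x 1 (psi^~ y) (dpsi x y)) ->
  (forall x y, u < x -> x < v -> 1 <= y -> `|dpsi x y| <= M) ->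
  is_derive a 1 (fun x => Rexpect f (psi x)) (Rexpect f (dpsi a)).
Proof.
move=> df ua av mpsi psiM dpsiE dpsiM.
pose k x y := f y * psi x y.
have Ia : `]u, v[%classic a by rewrite /= in_itv /= ua.
have inI x : `]u, v[%classic x -> u < x /\ x < v by rewrite /= in_itv /= => /andP.
have ki x : `]u, v[%classic x -> mu.-integrable setT (EFin \o k x).
  move=> /inI[ux xv]; apply: (@expect_bounded_integrable _ _ M) => //; first exact: mpsi.
  by move=> y y1; exact: psiM.
have dk x y : u < x -> x < v -> is_derive x 1 (k^~ y) (f y * dpsi x y).
  move=> ux xv; rewrite /k; have [y1|y1] := ltP y 1.
    have -> : (fun x => f y * psi x y) = cst 0.
      by apply/funext => z; rewrite (density_supp df y1) mul0r.
    rewrite (density_supp df y1) mul0r; exact: is_derive_cst.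
  have := dpsiE x y ux xv y1 => h.
  exact: (is_deriveZ (f y) h).
have dk' x y : `]u, v[%classic x -> [set: R] y -> derivable (k^~ y) x 1.
  by move=> /inI[ux xv] _; have [] := dk x y ux xv.
have M0 : 0 <= M by apply: le_trans (dpsiM a 1 ua av (lexx 1)).
have iG : mu.-integrable setT (EFin \o (fun y => f y * M)).
  apply: (@expect_bounded_integrable _ (cst M) M) => // y _.
  by rewrite ger0_norm.
have G0 y : 0 <= f y * M by rewrite mulr_ge0// (density_ge0 df).
have Gub x y : `]u, v[%classic x -> [set: R] y -> `|partial1of2 k x y| <= f y * M.
  move=> /inI[ux xv] _; have [_ dv] := dk x y ux xv; rewrite partial1of2E dv.
  rewrite normrM (ger0_norm (density_ge0 df _)).
  have [y1|y1] := ltP y 1; first by rewrite (density_supp df y1) !mul0r.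
  by rewrite ler_wpM2l ?(density_ge0 df)// dpsiM.
apply: DeriveDef.
  exact: (derivable_under_integral measurableT Ia ki dk' G0 iG Gub).
rewrite -derive1E (differentiation_under_integral measurableT Ia ki dk' G0 iG Gub).
by apply: eq_Rintegral => y _; have [_ dv] := dk a y ua av; rewrite partial1of2E dv.
Qed.

Lemma tail_small f (e : R) : density f -> 0 < e ->
  exists2 A, 1 <= A & forall y, A <= y -> tail f y < e.
Proof.
move=> df e0.
have H : (fun n : nat => (tail f n.+1%:R)%:E) @ \oo --> (0%R)%:E.
  rewrite (_ : (fun n => _) = fun n : nat => (\int[mu]_x (f x * (n.+1%:R < x)%R%:R)%:E)%E); last first.
    by apply/funext => n; rewrite tailK.
  rewrite -[X in _ --> X](@integral0 _ _ _ mu setT).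
  have mf := density_meas df.
  have [] := @dominated_convergence _ _ _ mu setT measurableT
    (fun (n : nat) x => (f x * (n.+1%:R < x)%R%:R)%:E) (cst 0%E) (EFin \o f) => //.
  - move=> n; apply/measurable_EFinP/measurable_funM => //.
    exact: (weight_gt _).1.
  - apply: aeW => x _ /=; apply: cvg_near_cst; near=> n.
    rewrite ltNge (_ : x <= n.+1%:R) /= ?mulr0//.
    by rewrite (@le_trans _ _ n%:R) ?ler_nat//; near: n; exact: nbhs_infty_ger.
  - exact: density_integrable.
  - apply: aeW => x n _ /=; rewrite lee_fin normrM (ger0_norm (density_ge0 df _)).
    by rewrite ler_piMr ?(density_ge0 df)//; case: (_ < x); rewrite ?normr1 ?normr0.
have /fine_cvgP[_ /cvgrPdist_lt/(_ _ e0)[n _ /(_ n (leqnn _))]] := H.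
rewrite /= sub0r normrN ger0_norm ?tail_ge0// => te.
exists n.+1%:R; first by rewrite ler1n.
by move=> y ny; apply: le_lt_trans te; exact: le_tail.
Unshelve. all: by end_near. Qed.

End real_expectation.

Lemma is_derive_scale (R : realType) (c z : R) : is_derive z 1 (fun t : R => c * t) c.
Proof.
have h := is_deriveZ c (is_derive_id z (1 : R)).
by move: h; rewrite -[c *: (1 : R)]/(c * 1) mulr1.
Qed.

Lemma is_derive_expN (R : realType) (c z : R) :
  is_derive z 1 (fun t : R => expR (- (c * t))) (- (c * expR (- (c * z)))).
Proof.
have d1 := is_deriveN (is_derive_scale c z).
have := @is_derive1_comp R expR (fun z : R => - (c * z)) z (expR (- (c * z))) (- c) (is_derive_expR _) d1.
by rewrite mulrN mulrC.
Qed.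

Lemma is_derive_continuous (R : realType) (f : R -> R) (x l : R) :
  is_derive x 1 f l -> {for x, continuous f}.
Proof. by move=> [df _]; apply: differentiable_continuous; apply/derivable1_diffP. Qed.

Section laplace.
Context {R : realType}.
Notation mu := (@lebesgue_measure R).
Implicit Types f psi : R -> R.

Definition laplace f (x : R) : R := Rexpect f (fun y => expR (- (x * y))).
(** This is [- F'(x)]; [|y|] replaces [y] to have a weight on the whole line. *)
Definition laplace1 f (x : R) : R := Rexpect f (fun y => `|y| * expR (- (x * y))).

Lemma weight_exp (x : R) : weight (fun y => expR (- (x * y))).
Proof.
split; last by move=> y; exact: expR_ge0.
by apply: measurableT_comp => //; apply: measurableT_comp.
Qed.

Lemma weight_norm : weight (fun y : R => `|y|).
Proof. by split. Qed.

Lemma weight_exp1 (x : R) : weight (fun y => `|y| * expR (- (x * y))).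
Proof. by apply: weightM; [exact: weight_norm|exact: weight_exp]. Qed.

Lemma exp_le1 (x y : R) : 0 <= x -> 1 <= y -> expR (- (x * y)) <= 1.
Proof. by move=> x0 y1; rewrite expR_le1 oppr_le0 mulr_ge0// (le_trans ler01). Qed.

Lemma exp1_le (x y : R) : 0 < x -> 1 <= y -> `|y| * expR (- (x * y)) <= x^-1.
Proof.
move=> x0 y1; rewrite ger0_norm; last by lra.
rewrite expRN ler_pdivrMr ?expR_gt0//.
apply: (@le_trans _ _ (x^-1 * (1 + x * y))).
  by rewrite mulrDr mulr1 mulKf ?lt0r_neq0// lerDr invr_ge0 ltW.
by rewrite ler_pM2l ?invr_gt0// expR_ge1Dx.
Qed.

Lemma laplaceK f x : density f -> 0 <= x ->
  (laplace f x)%:E = expect f (fun y => expR (- (x * y))).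
Proof.
move=> df x0; apply: RexpectK; [exact: density_weight|exact: weight_exp|].
apply: (@expect_bounded_fin _ _ _ 1) => //; first exact: weight_exp.
by move=> y; exact: exp_le1.
Qed.

Lemma laplace1K f x : density f -> 0 < x ->
  (laplace1 f x)%:E = expect f (fun y => `|y| * expR (- (x * y))).
Proof.
move=> df x0; apply: RexpectK; [exact: density_weight|exact: weight_exp1|].
apply: (@expect_bounded_fin _ _ _ x^-1) => //; first exact: weight_exp1.
by move=> y; exact: exp1_le.
Qed.

Lemma laplace_derive f (x : R) : density f -> 0 < x ->
  is_derive x 1 (laplace f) (- laplace1 f x).
Proof.
move=> df x0.
have x20 : 0 < x / 2 by rewrite divr_gt0.
have -> : - laplace1 f x = Rexpect f (fun y => - (`|y| * expR (- (x * y)))).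
  rewrite /laplace1 /Rexpect -mulN1r -RintegralZl//.
    by apply: eq_Rintegral => y _; ring.
  apply: (@expect_bounded_integrable _ _ _ x^-1) => //; first exact: (weight_exp1 x).1.
  by move=> y y1; rewrite ger0_norm ?exp1_le//; exact: (weight_exp1 x).2.
(* For [z] in []x / 2, 2 * x[] the exponential is at most 1 and [y exp(- z y)] is at most
   [(x / 2)^-1]; the sum serves as common bound. *)
apply: (@expect_derive _ f (fun x y => expR (- (x * y))) (fun x y => - (`|y| * expR (- (x * y))))
  (x / 2) (2 * x) x (1 + (x / 2)^-1)) => //.
- lra.
- lra.
- by move=> z _ _; exact: (weight_exp z).1.
- move=> z y xz _ y1; rewrite ger0_norm ?expR_ge0//.
  apply: le_trans (exp_le1 _ y1) _; first by lra.
  by rewrite lerDl invr_ge0 ltW.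
- move=> z y xz _ y1; rewrite ger0_norm; last by lra.
  rewrite (_ : (fun z => _) = fun z => expR (- (y * z))); last first.
    by apply/funext => t; rewrite mulrC.
  by rewrite (mulrC z); exact: is_derive_expN.
- move=> z y xz _ y1; rewrite normrN ger0_norm; last exact: (weight_exp1 z).2.
  apply: le_trans (_ : (x / 2)^-1 <= _); last by rewrite lerDr.
  apply: le_trans (exp1_le _ y1) _; first by lra.
  by rewrite lef_pV2 ?posrE//; lra.
Qed.

Lemma laplace_gt0 f x : density f -> expect f (cst 1) = 1%E -> 0 <= x -> 0 < laplace f x.
Proof.
move=> df m1 x0.
have [A A1 HA] := tail_small df (ltr01 : 0 < 1 :> R).
have cA : 0 < cdf f A by have := HA A (lexx _); rewrite tailE//; lra.
apply: (@lt_le_trans _ _ (expR (- (x * A)) * cdf f A)).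
  by rewrite mulr_gt0// expR_gt0.
rewrite -lee_fin EFinM laplaceK// cdfK// -expectZ ?expR_ge0//.
- apply: le_expect => //.
  + by apply: weightM; [apply: weight_cst; exact: expR_ge0|exact: weight_le].
  + exact: weight_exp.
  + move=> y y1; case: (leP y A) => yA; rewrite ?mulr1 ?mulr0 ?expR_ge0//.
    by rewrite ler_expR lerN2 ler_wpM2l.
- exact: density_weight.
- exact: weight_le.
Qed.

Lemma laplace_le f x : density f -> expect f (cst 1) = 1%E -> 0 <= x ->
  laplace f x <= expR (- x).
Proof.
move=> df m1 x0; rewrite -lee_fin laplaceK// -[leRHS]mule1 -m1 -expectZ ?expR_ge0//.
- apply: le_expect => //; first exact: weight_exp.
    by apply: weightM; apply: weight_cst => //; exact: expR_ge0.
  by move=> y y1 /=; rewrite mulr1 ler_expR lerN2 ler_peMr.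
- exact: density_weight.
Qed.

Lemma laplace_lt1 f x : density f -> expect f (cst 1) = 1%E -> 0 < x -> laplace f x < 1.
Proof.
move=> df m1 x0; apply: le_lt_trans (laplace_le df m1 (ltW x0)) _.
by rewrite expR_lt1 oppr_lt0.
Qed.

Lemma laplace_cvg1 f : density f -> expect f (cst 1) = 1%E ->
  laplace f x @[x --> 0^'+] --> (1 : R).
Proof.
move=> df m1; apply/cvgrPdist_le => e e0.
have e20 : 0 < e / 2 by rewrite divr_gt0.
have [A A1 HA] := tail_small df e20.
have A0 : 0 < A by lra.
near=> x.
have x0 : 0 < x by near: x; exact: nbhs_right_gt.
have xA : x < e / 2 / A by near: x; apply: nbhs_right_lt; rewrite divr_gt0.
have := laplace_lt1 df m1 x0 => F1.
rewrite ger0_norm; last by rewrite subr_ge0 ltW.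
(* From [exp(- x y) >= 1 - x A] for [y <= A]; the cutoff [A] is fixed by the tail before [x] tends
   to 0. *)
have : cdf f A * (1 - x * A) <= laplace f x.
  have [neg|pos] := leP (1 - x * A) 0.
    apply: (@le_trans _ _ 0); last exact: ltW (laplace_gt0 df m1 (ltW x0)).
    by rewrite mulr_ge0_le0// cdf_ge0.
  rewrite -lee_fin mulrC EFinM laplaceK ?(ltW x0)// cdfK// -expectZ ?(ltW pos)//.
  - apply: le_expect => //.
    + by apply: weightM; [apply: weight_cst; exact: ltW|exact: weight_le].
    + exact: weight_exp.
    + move=> y y1; case: (leP y A) => yA; rewrite ?mulr1 ?mulr0 ?expR_ge0//.
      apply: le_trans (expR_ge1Dx _); rewrite lerD2l lerN2 ler_pM2l//.
  - exact: density_weight.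
  - exact: weight_le.
have := HA A (lexx A); rewrite tailE// => h1 h2.
have : x * A < e / 2 by rewrite -ltr_pdivlMr.
have := cdf_ge0 A df; have : cdf f A <= 1 by have := tail_ge0 A df; rewrite tailE//; lra.
have xA0 : 0 < x * A by rewrite mulr_gt0.
nra.
Unshelve. all: by end_near. Qed.

Context (N : nat) (p : nat -> R).
Context (p0 : forall j : nat, (1 <= j <= N)%N -> 0 <= p j).
Context (p1 : \sum_(1 <= j < N.+1) p j = 1).

Lemma expect_convpow_exp f j x : density f -> 0 <= x ->
  expect (convpow f j) (fun y => expR (- (x * y))) = (laplace f x ^+ j.+1)%:E.
Proof.
move=> df x0; elim: j => [|j IH]; first by rewrite expr1 laplaceK.
rewrite -[convpow f j.+1]/(Defs.conv f (convpow f j)).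
rewrite expect_conv_mul//; last by move=> y z; rewrite -expRD; congr expR; ring.
- by rewrite IH -laplaceK// -EFinM -exprS.
- exact: convpow_density.
- exact: weight_exp.
Qed.

Lemma expect_qmix_exp f x : density f -> 0 <= x ->
  expect (qmix N p f) (fun y => expR (- (x * y))) = ((Qpoly N p).[laplace f x])%:E.
Proof.
move=> df x0; rewrite expect_qmix//; last exact: weight_exp.
rewrite /Qpoly horner_sum -sumEFin; apply: eq_big_nat => j /andP[j1 _].
by rewrite expect_convpow_exp// prednK// -EFinM hornerZ hornerXn.
Qed.

(** The integrated equation tested with [w(y) = x exp(- x y)], for which
    [W(s) = exp(- x) - exp(- x (s + 1))]; independence turns [E exp(- x S)] into [Q(F(x))]. *)
Lemma laplace_equation (beta : R) f x : 0 <= beta -> prob_sol N p beta f -> 0 < x ->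
  x * laplace1 f x = beta * expR (- x) * (1 - (Qpoly N p).[laplace f x]).
Proof.
move=> b0 [df m1 eqn] x0; have x0' := ltW x0.
have dq := qmix_density p0 df; have wq := density_weight dq.
have wf := density_weight df.
pose w y := x * expR (- (x * y)).
(* The maximum changes nothing for [s >= 1]; it makes [W] nonnegative on the whole line. *)
pose W s := Num.max 0 (expR (- x) - expR (- (x * (s + 1)))).
have ww : weight w by apply: weightM; [exact: weight_cst|exact: weight_exp].
have wW : weight W.
  split; last by move=> s; rewrite le_max lexx.
  apply: measurable_maxr => //; apply: measurable_funB => //.
  apply: measurableT_comp => //; apply: measurableT_comp => //.
  by apply: measurable_funM => //; exact: measurable_funD.
have WE s : 1 <= s -> W s = expR (- x) - expR (- (x * (s + 1))).
  move=> s1; apply: max_r; rewrite subr_ge0 ler_expR lerN2 ler_peMr//; lra.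
have H := expect_tested p0 df m1 b0 ww wW.
have {}H : expect f (fun y => `|y| * w y) = (beta%:E * expect (qmix N p f) W)%E.
  apply: H => [s s1|y y1 _]; last exact: eqn.
  have s11 : 1 < s + 1 by lra.
  have dE (z : R) : is_derive z 1 (fun y : R => - expR (- (x * y))) (w z).
    by have := is_deriveN (is_derive_expN x z); rewrite opprK.
  have dcont : continuous (fun y : R => - expR (- (x * y))).
    by move=> z; exact: is_derive_continuous (dE z).
  rewrite WE// (@continuous_FTC2 _ w (fun y => - expR (- (x * y))))//.
  - by rewrite -EFinB; congr EFin; rewrite mulr1; ring.
  - apply: continuous_subspaceT => z; rewrite /w; apply: cvgM; first exact: cvg_cst.
    exact: is_derive_continuous (is_derive_expN x z).
  - split.
    + by move=> z _; have [] := dE z.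
    + exact/cvg_at_right_filter/dcont.
    + exact/cvg_at_left_filter/dcont.
  - by move=> z _; rewrite derive1E; have [_ ->] := dE z.
have E1 : expect f (fun y => `|y| * w y) = (x * laplace1 f x)%:E.
  rewrite EFinM laplace1K// -expectZ//; last exact: weight_exp1.
  by apply: eq_expect => // y _; rewrite /w; ring.
have E2 : (expect (qmix N p f) W + (expR (- x) * (Qpoly N p).[laplace f x])%:E = (expR (- x))%:E)%E.
  rewrite EFinM -expect_qmix_exp// -expectZ ?expR_ge0//; last exact: weight_exp.
  rewrite -expectD//; last by apply: weightM; [apply: weight_cst; exact: expR_ge0|exact: weight_exp].
  rewrite -[RHS]mule1 -(qmix_mass p0 p1 df m1) -expectZ ?expR_ge0//.
  apply: eq_expect => // y y1; rewrite WE//= mulr1 -expRD.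
  have -> : - x - x * y = - (x * (y + 1)) by ring.
  by rewrite subrK.
have E3 : expect (qmix N p f) W = (expR (- x) * (1 - (Qpoly N p).[laplace f x]))%:E.
  rewrite mulrBr mulr1 EFinB -E2; apply/esym/eqP.
  by rewrite eq_sym; apply/eqP; rewrite addeK.
by move: H; rewrite E1 E3 -EFinM => -[] ->; ring.
Qed.

End laplace.

(** * The Gamma function and the exponential integral *)

Section gamma.
Context {R : realType}.
Notation mu := (@lebesgue_measure R).

(** Exhausting []0, +oo[] by the intervals [[1 / (n + 1), n + 2]] keeps the fundamental theorem away
    from 0, where the integrand may blow up. *)
Lemma ge0_integral_primitive_le (f F : R -> R) (M : R) :
  (forall t : R, 0 < t -> is_derive t 1 F (f t)) ->
  (forall t : R, 0 < t -> {for t, continuous f}) ->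
  (forall t, 0 < t -> 0 <= f t) -> (forall t, 0 < t -> 0 <= F t <= M) ->
  (\int[mu]_(t in `]0%R, +oo[) (f t)%:E <= M%:E)%E.
Proof.
move=> dF cf f0 F0.
pose I (n : nat) : set R := `[n.+1%:R^-1, n.+2%:R]%classic.
have n0 n : 0 < n.+1%:R^-1 :> R by rewrite invr_gt0.
have I0 n t : I n t -> 0 < t.
  by rewrite /I /= in_itv /= => /andP[+ _]; apply: lt_le_trans.
have IU : \bigcup_n I n = `]0, +oo[%classic.
  apply/seteqP; split => [t [n _ /I0]|t]; rewrite /= in_itv /= andbT// => t0.
  pose n := (Num.bound t^-1 + Num.bound t)%N.
  exists n => //; rewrite /I /= in_itv /=; apply/andP; split.
    rewrite invf_ple ?posrE//; apply: (le_trans (ltW (archi_boundP _))).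
      by rewrite invr_ge0 ltW.
    by rewrite ler_nat /n; apply: leqW; exact: leq_addr.
  apply: (le_trans (ltW (archi_boundP (ltW t0)))).
  by rewrite ler_nat /n; do 2 apply: leqW; exact: leq_addl.
rewrite -IU.
have mI n : measurable (I n) by exact: measurable_itv.
have ndI : {homo I : n m / (n <= m)%N >-> (n <= m)%O}.
  move=> n m nm; apply/subsetPset => t; rewrite /I /= !in_itv /= => /andP[nt tn].
  apply/andP; split; last by rewrite (le_trans tn)// ler_nat.
  by apply: le_trans nt; rewrite lef_pV2 ?posrE// ler_nat.
have cI n : {within I n, continuous f}.
  apply: continuous_in_subspaceT => t /set_mem /I0; exact: cf.
have mf n : measurable_fun (I n) (EFin \o f).
  by apply/measurable_EFinP; apply: subspace_continuous_measurable_fun => //; exact: cI.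
have := @ge0_nondecreasing_set_cvg_integral _ (measurableTypeR R) R I (EFin \o f) mu ndI mI mf
  (fun n x Ix => f0 x (I0 n x Ix)).
move=> /cvg_lim <-//.
have ival n : (\int[mu]_(x in I n) (f x)%:E <= M%:E)%E.
  have ab : n.+1%:R^-1 < n.+2%:R :> R.
    by apply: (@le_lt_trans _ _ 1); rewrite ?invf_le1 ?ler1n ?ltr1n.
  rewrite (@continuous_FTC2 _ f F)//.
  - have /andP[a0 _] := F0 _ (n0 n).
    have /andP[_ bM] := F0 n.+2%:R (ltr0Sn _ _).
    rewrite -EFinB lee_fin; lra.
  - exact: cI.
  - split.
    + by move=> x; rewrite in_itv /= => /andP[/(lt_trans (n0 n)) /dF[]].
    + exact/cvg_at_right_filter/(is_derive_continuous (dF _ (n0 n))).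
    + exact/cvg_at_left_filter/(is_derive_continuous (dF n.+2%:R (ltr0Sn _ _))).
  - move=> x; rewrite in_itv /= => /andP[/(lt_trans (n0 n)) x0 _].
    by rewrite derive1E; have [_ ->] := dF x x0.
apply: lime_le; last by apply: nearW => n; exact: ival.
apply: ereal_nondecreasing_is_cvgn => n m nm.
apply: ge0_subset_integral; [exact: mI|exact: mI|exact: mf| |exact/subsetPset/ndI].
by move=> x /I0/f0; rewrite lee_fin.
Qed.

Definition gamma_kernel (a t : R) : R := t `^ (a - 1) * expR (- t).

Lemma measurable_gamma_kernel (a : R) : measurable_fun setT (gamma_kernel a).
Proof.
apply: measurable_funM; first exact: measurable_powR.
by apply: measurableT_comp.
Qed.

Lemma gamma_kernel_ge0 (a t : R) : 0 <= gamma_kernel a t.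
Proof. by rewrite mulr_ge0 ?powR_ge0 ?expR_ge0. Qed.

(** The cube of [1 + t / 3 <= exp(t / 3)]; the factor is [3 ^ 3]. *)
Lemma cube_le_exp (t : R) : 0 <= t -> (1 + t) ^+ 3 <= 27 * expR t.
Proof.
move=> t0; have h := expR_ge1Dx (t / 3).
have -> : expR t = expR (t / 3) ^+ 3.
  by rewrite !exprS expr0 mulr1 -!expRD; congr expR; field.
have -> : 27 * expR (t / 3) ^+ 3 = (3 * expR (t / 3)) ^+ 3 by ring.
by apply: lerXn2r; rewrite ?nnegrE; lra.
Qed.

(* The majorant is the derivative of [(t / (1 + t)) `^ a], which is bounded by [1]. *)
Lemma gamma_kernel_le (a t : R) : a <= 2 -> 0 < t ->
  gamma_kernel a t <= 27 * ((1 - (1 + t)^-1) `^ (a - 1) * ((1 + t) ^+ 2)^-1).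
Proof.
move=> a2 t0; have t10 : 0 < 1 + t by lra.
have E : 1 - (1 + t)^-1 = t * (1 + t)^-1 by field; rewrite lt0r_neq0.
rewrite E powRM; [|exact: ltW|by rewrite invr_ge0 ltW].
rewrite /gamma_kernel.
have h1 : (1 + t)^-1 <= (1 + t)^-1 `^ (a - 1).
  rewrite -[leLHS]powRr1; last by rewrite invr_ge0 ltW.
  apply: ger_powR; last by lra.
  by rewrite invr_gt0 t10 invf_le1//; lra.
have h2 : expR (- t) <= 27 * ((1 + t)^-1 * ((1 + t) ^+ 2)^-1).
  rewrite expRN -invfM -exprS -[leRHS]/(27 / (1 + t) ^+ 3).
  rewrite ler_pdivlMr ?exprn_gt0// mulrC ler_pdivrMr ?expR_gt0//.
  exact: cube_le_exp (ltW t0).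
apply: (@le_trans _ _ (t `^ (a - 1) * (27 * ((1 + t)^-1 * ((1 + t) ^+ 2)^-1)))).
  by rewrite ler_wpM2l// powR_ge0.
have -> : 27 * (t `^ (a - 1) * (1 + t)^-1 `^ (a - 1) * ((1 + t) ^+ 2)^-1) =
  t `^ (a - 1) * (27 * ((1 + t)^-1 `^ (a - 1) * ((1 + t) ^+ 2)^-1)) by ring.
rewrite ler_wpM2l ?powR_ge0// ler_pM2l// ler_wpM2r// invr_ge0 exprn_ge0//.
exact: ltW.
Qed.

(** The range [a <= 2] comes from the majorant and admits every exponent that occurs: [1 - theta], a
    neighbourhood of 1, and the pair [1 / 4], [7 / 4]. *)
Lemma gamma_kernel_integrable (a : R) : 0 < a -> a <= 2 ->
  mu.-integrable `]0, +oo[ (EFin \o gamma_kernel a).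
Proof.
move=> a0 a2.
pose u (t : R) : R := 1 - (1 + t)^-1.
have u01 (t : R) : 0 < t -> 0 < u t <= 1.
  move=> t0; have t10 : 0 < 1 + t by lra.
  rewrite /u subr_gt0 invf_lt1//; apply/andP; split; first by lra.
  by rewrite gerBl invr_ge0 ltW.
have du (t : R) : 0 < t -> is_derive t 1 u (((1 + t) ^+ 2)^-1).
  move=> t0; have t10 : 1 + t != 0 by rewrite lt0r_neq0; lra.
  have d1 := is_deriveD (is_derive_cst (1 : R) t 1) (is_derive_id t (1 : R)).
  rewrite add0r in d1.
  have d2 := is_deriveV t10 d1.
  have := is_deriveB (is_derive_cst (1 : R) t 1) d2.
  by rewrite sub0r -[_ *: 1]/(_ * 1) mulr1 opprK.
pose F (t : R) : R := (27 / a) * u t `^ a.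
pose f (t : R) : R := 27 * (u t `^ (a - 1) * ((1 + t) ^+ 2)^-1).
have dF (t : R) : 0 < t -> is_derive t 1 F (f t).
  move=> t0; have /andP[ut _] := u01 t t0.
  have d := @is_derive1_comp R (fun x => x `^ a) u t _ _ (is_derive1_powR a ut) (du t t0).
  have := is_deriveZ (27 / a) d.
  rewrite -[(27 / a) *: _]/((27 / a) * _) => h; apply: is_derive_eq.
  by rewrite /f; field; apply/andP; split; rewrite lt0r_neq0//; lra.
have cf (t : R) : 0 < t -> {for t, continuous f}.
  move=> t0; have /andP[ut _] := u01 t t0; apply: cvgM; first exact: cvg_cst.
  apply: cvgM.
    have := @is_derive1_comp R (fun x => x `^ (a - 1)) u t _ _ (is_derive1_powR (a - 1) ut) (du t t0).
    exact: is_derive_continuous.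
  apply: cvgV; first by rewrite lt0r_neq0// exprn_gt0//; lra.
  apply: (@cvg_comp _ _ _ (fun t : R => 1 + t) (fun x => x ^+ 2)); last exact: exprn_continuous.
  by apply: cvgD; [exact: cvg_cst|exact: cvg_id].
have f0 t : 0 < t -> 0 <= f t.
  by move=> t0; rewrite mulr_ge0// mulr_ge0 ?powR_ge0// invr_ge0 exprn_ge0//; lra.
have F0 t : 0 < t -> 0 <= F t <= 27 / a.
  move=> t0; have /andP[ut ut1] := u01 t t0; rewrite /F.
  have a27 : 0 < 27 / a by rewrite divr_gt0.
  rewrite pmulr_rge0// powR_ge0 ger_pMr//=.
  have : u t `^ a <= 1 `^ a.
    by apply: ge0_ler_powR; rewrite ?nnegrE//; exact: ltW.
  by rewrite powR1.
have fin := ge0_integral_primitive_le dF cf f0 F0.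
apply/integrableP; split.
  by apply/measurable_EFinP; apply: measurable_funTS; exact: measurable_gamma_kernel.
apply: (@le_lt_trans _ _ (27 / a)%:E); last exact: ltry.
apply: le_trans fin; apply: ge0_le_integral => //.
- apply: measurableT_comp => //; apply/measurable_EFinP; apply: measurable_funTS.
  exact: measurable_gamma_kernel.
- apply/measurable_EFinP; apply: open_continuous_measurable_fun => //.
  by move=> t /set_mem; rewrite /= in_itv /= andbT; exact: cf.
- move=> t /=; rewrite in_itv /= andbT => t0.
  by rewrite lee_fin ger0_norm ?gamma_kernel_ge0// gamma_kernel_le.
Qed.

Lemma Gamma_gt0 (a : R) : 0 < a -> a <= 2 -> 0 < Gamma a.
Proof.
move=> a0 a2.
have ik := gamma_kernel_integrable a0 a2.
have GE : (Gamma a)%:E = (\int[mu]_(t in `]0%R, +oo[) (gamma_kernel a t)%:E)%E.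
  by rewrite /Gamma /Rintegral fineK//; exact: integrable_fin_num.
rewrite -lte_fin GE.
pose c : R := Num.min (1 `^ (a - 1)) (2 `^ (a - 1)) * expR (- 2).
have c0 : 0 < c by rewrite mulr_gt0 ?expR_gt0// lt_min !powR_gt0.
apply: (@lt_le_trans _ _ (\int[mu]_(t in `[1%R, 2%R]) c%:E)%E).
  rewrite integral_cst//= lebesgue_measure_itv /= lte_fin ltr1n /=.
  by rewrite -EFinB -EFinM lte_fin mulr_gt0//; lra.
apply: (@le_trans _ _ (\int[mu]_(t in `[1%R, 2%R]) (gamma_kernel a t)%:E)%E).
  apply: ge0_le_integral => //.
  - by move=> t _; rewrite lee_fin ltW.
  - apply/measurable_EFinP; apply: measurable_funTS; exact: measurable_gamma_kernel.
  - move=> t /=; rewrite in_itv /= => /andP[t1 t2]; rewrite lee_fin /c.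
    apply: ler_pM; rewrite ?expR_ge0 ?ler_expR ?lerN2//.
    rewrite ge_min; have [h|h] := leP 0 (a - 1).
      by rewrite ge0_ler_powR// nnegrE; lra.
    apply/orP; right.
    have e (x : R) : x `^ (a - 1) = (x `^ (1 - a))^-1 by rewrite -powRN; congr (_ `^ _); ring.
    rewrite !e lef_pV2 ?posrE ?powR_gt0//; [|lra].
    by rewrite ge0_ler_powR// ?nnegrE; lra.
apply: ge0_subset_integral => //.
- apply/measurable_EFinP; apply: measurable_funTS; exact: measurable_gamma_kernel.
- by move=> t _; rewrite lee_fin gamma_kernel_ge0.
- by move=> t /=; rewrite !in_itv /= => /andP[t1 _]; rewrite andbT; lra.
Qed.

Lemma Gamma_scaled (a s : R) : 0 < a -> a <= 2 -> 0 < s ->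
  (\int[mu]_(t in `]0%R, +oo[) (t `^ (a - 1) * expR (- (s * t)))%:E)%E =
  (Gamma a * s `^ (- a))%:E.
Proof.
move=> a0 a2 s0.
have ik := gamma_kernel_integrable a0 a2.
have GE : (Gamma a)%:E = (\int[mu]_(t in `]0%R, +oo[) (gamma_kernel a t)%:E)%E.
  by rewrite /Gamma /Rintegral fineK//; exact: integrable_fin_num.
pose h := (EFin \o gamma_kernel a) \_ `]0%R, +oo[%classic.
have mh : measurable_fun setT h.
  apply/(measurable_restrictT _ _).1 => //; apply/measurable_EFinP.
  by apply: measurable_funTS; exact: measurable_gamma_kernel.
have h0 t : (0 <= h t)%E.
  by rewrite /h patchE; case: ifP => // _; rewrite lee_fin gamma_kernel_ge0.
have H := ge0_integral_affine 0 s0 mh h0.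
rewrite integral_mkcond.
transitivity ((s `^ (1 - a))%:E * \int[mu]_x h (s * x + 0)%R)%E.
  rewrite -ge0_integralZl//; last first.
  - by rewrite lee_fin powR_ge0.
  - apply: (measurableT_comp mh).
    by apply: measurable_funD => //; exact: measurable_funM.
  apply: eq_integral => t _; rewrite /h !patchE !mem_setE !in_itv /= !andbT addr0.
  rewrite pmulr_rgt0//; case: ltP => t0; last by rewrite mule0.
  rewrite -EFinM; congr EFin; rewrite /gamma_kernel powRM ?(ltW s0) ?(ltW t0)//.
  rewrite mulrA mulrA -powRD; last by rewrite lt0r_neq0// implybT.
  have -> : 1 - a + (a - 1) = 0 by ring.
  by rewrite powRr0 mul1r.
have Hs : (\int[mu]_x h (s * x + 0)%R = (s^-1)%:E * (Gamma a)%:E)%E.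
  have -> : (Gamma a)%:E = (\int[mu]_x h x)%E by rewrite GE integral_mkcond.
  by rewrite -H muleA -EFinM mulVf ?mul1e// lt0r_neq0.
have E : s `^ (1 - a) * s^-1 = s `^ (- a).
  have -> : s^-1 = s `^ (-1) by rewrite powRN powRr1 ?ltW.
  by rewrite -powRD ?lt0r_neq0 ?implybT//; congr (_ `^ _); ring.
by rewrite Hs -!EFinM mulrA E mulrC.
Qed.

Lemma is_derive_expNid (z : R) : is_derive z 1 (fun t : R => expR (- t)) (- expR (- z)).
Proof.
have := is_derive_expN 1 z; rewrite !mul1r (_ : (fun t => _) = fun t => expR (- t))//.
by apply/funext => t; rewrite mul1r.
Qed.

Lemma is_derive_expNhalf (z : R) :
  is_derive z 1 (fun t : R => expR (- (t / 2))) (- (2^-1 * expR (- (z / 2)))).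
Proof.
have := is_derive_expN 2^-1 z; rewrite (mulrC 2^-1 z).
rewrite (_ : (fun t => _) = fun t => expR (- (t / 2)))//.
by apply/funext => t; rewrite mulrC.
Qed.

Definition log_kernel (t : R) : R := ln t * expR (- t).

Lemma measurable_log_kernel : measurable_fun setT log_kernel.
Proof. by apply: measurable_funM; [exact: measurable_ln|apply: measurableT_comp]. Qed.

(** For [t <= 1] the smallest exponent dominates, for [t > 1] the largest. The exponents [- 3 / 4]
    and [3 / 4] are written as those of [gamma_kernel] at [1 / 4] and [7 / 4]. *)
Lemma powR_sandwich (c t : R) : 0 < t -> - (3 / 4) <= c -> c <= 3 / 4 ->
  t `^ c <= t `^ (4^-1 - 1) + t `^ (7 / 4 - 1).
Proof.
move=> t0 c1 c2; have [t1|t1] := leP t 1.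
  apply: (@le_trans _ _ (t `^ (4^-1 - 1))); last by rewrite lerDl powR_ge0.
  by apply: ger_powR; [rewrite t0|lra].
apply: (@le_trans _ _ (t `^ (7 / 4 - 1))); last by rewrite lerDr powR_ge0.
by apply: ler_powR; [exact: ltW|lra].
Qed.

Lemma norm_ln_le (t : R) : 0 < t -> `|ln t| <= 4 * (t `^ 4^-1 + t `^ (- 4^-1)).
Proof.
move=> t0; have h (c : R) : c * ln t <= t `^ c.
  by rewrite -ln_powR; apply/ltW/ln_sublinear; exact: powR_gt0.
have := h 4^-1; have := h (- 4^-1).
have := powR_ge0 t 4^-1; have := powR_ge0 t (- 4^-1).
by rewrite ler_norml => *; apply/andP; split; lra.
Qed.

(** Majorant for the derivative in [x] of the Gamma integrand when [x] is in [[1 / 2, 3 / 2]]: the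
    logarithm costs an exponent [1 / 4] in either direction, which leaves exponents between
    [- 3 / 4] and [3 / 4]. The 8 is the 4 of [norm_ln_le] times its two terms. *)
Let major (t : R) : R := 8 * (gamma_kernel 4^-1 t + gamma_kernel (7 / 4) t).

Lemma log_powR_le (x t : R) : 2^-1 <= x -> x <= 3 / 2 -> 0 < t ->
  `|t `^ (x - 1) * (ln t * expR (- t))| <= major t.
Proof.
move=> x1 x2 t0; rewrite !normrM (ger0_norm (powR_ge0 _ _)) (ger0_norm (expR_ge0 _)).
have P0 := powR_ge0 t (x - 1).
have lnle := norm_ln_le t0.
have tn : t != 0 by rewrite lt0r_neq0.
have E1 : t `^ (x - 1) * t `^ 4^-1 = t `^ (x - 1 + 4^-1) by rewrite -powRD ?tn ?implybT.
have E2 : t `^ (x - 1) * t `^ (- 4^-1) = t `^ (x - 1 - 4^-1) by rewrite -powRD ?tn ?implybT.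
have S1 : t `^ (x - 1 + 4^-1) <= t `^ (4^-1 - 1) + t `^ (7 / 4 - 1) by apply: powR_sandwich => //; lra.
have S2 : t `^ (x - 1 - 4^-1) <= t `^ (4^-1 - 1) + t `^ (7 / 4 - 1) by apply: powR_sandwich => //; lra.
apply: (@le_trans _ _ (t `^ (x - 1) * (4 * (t `^ 4^-1 + t `^ (- 4^-1))) * expR (- t))).
  by rewrite mulrA ler_wpM2r ?expR_ge0// ler_wpM2l.
have -> : t `^ (x - 1) * (4 * (t `^ 4^-1 + t `^ (- 4^-1))) =
  4 * (t `^ (x - 1 + 4^-1) + t `^ (x - 1 - 4^-1)) by rewrite -E1 -E2; ring.
have -> : major t = 8 * (t `^ (4^-1 - 1) + t `^ (7 / 4 - 1)) * expR (- t).
  by rewrite /major /gamma_kernel; ring.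
by rewrite ler_wpM2r ?expR_ge0//; lra.
Qed.

Lemma major_integrable : mu.-integrable `]0, +oo[ (EFin \o major).
Proof.
have i1 : mu.-integrable `]0, +oo[ (EFin \o gamma_kernel 4^-1).
  by apply: gamma_kernel_integrable; lra.
have i2 : mu.-integrable `]0, +oo[ (EFin \o gamma_kernel (7 / 4)).
  by apply: gamma_kernel_integrable; lra.
have mD : (R.-ocitv.-measurable).-sigma.-measurable (`]0%R, +oo[%classic : set R) by exact: measurable_itv.
have := integrableZl mD 8 (integrableD mD i1 i2).
apply: eq_integrable => // t _.
Qed.

Lemma log_kernel_integrable : mu.-integrable `]0, +oo[ (EFin \o log_kernel).
Proof.
apply: le_integrable major_integrable => //.
  apply/measurable_EFinP; apply: measurable_funTS; exact: measurable_log_kernel.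
move=> t /=; rewrite in_itv /= andbT => t0; rewrite lee_fin.
apply: le_trans (ler_norm _).
have := @log_powR_le 1 t; rewrite subrr powRr0 mul1r; apply; lra.
Qed.

(** Differentiation of the Gamma integral under the integral sign at 1, dominated by [major]. *)
Lemma gammaE_log : gammaE R = - \int[mu]_(t in `]0, +oo[) log_kernel t.
Proof.
rewrite /gammaE; congr (- _).
pose k (x t : R) : R := t `^ (x - 1) * expR (- t).
have I1 : `](2^-1 : R), (3 / 2)[%classic 1 by rewrite /= in_itv /=; apply/andP; split; lra.
have ki (x : R) : `](2^-1 : R), (3 / 2)[%classic x -> mu.-integrable `]0, +oo[ (EFin \o k x).
  by rewrite /= in_itv /= => /andP[x1 x2]; apply: gamma_kernel_integrable; lra.
have dk (x t : R) : 0 < t -> is_derive x 1 (k^~ t) (t `^ (x - 1) * (ln t * expR (- t))).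
  move=> t0.
  have kE : k^~ t = fun x => expR (- t) * expR (- (- ln t * (x - 1))).
    apply/funext => y; rewrite /k /powR gt_eqF// mulrC; congr (_ * expR _); ring.
  have d1 := is_deriveB (is_derive_id x (1 : R)) (is_derive_cst (1 : R) x 1).
  rewrite subr0 in d1.
  have d2 := @is_derive1_comp R (fun z => expR (- (- ln t * z))) _ x _ _ (is_derive_expN (- ln t) (x - 1)) d1.
  have := is_deriveZ (expR (- t)) d2.
  rewrite -[expR (- t) *: _]/(expR (- t) * _) => h; rewrite kE.
  apply: is_derive_eq; rewrite /powR gt_eqF//.
  have -> : - (- ln t * (x - 1)) = (x - 1) * ln t by ring.
  ring.
have dk' (x t : R) : `](2^-1 : R), (3 / 2)[%classic x -> `]0, +oo[%classic t -> derivable (k^~ t) x 1.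
  by move=> _; rewrite /= in_itv /= andbT => /(dk x)[].
have G0 (t : R) : 0 <= major t.
  by rewrite mulr_ge0// addr_ge0// gamma_kernel_ge0.
have Gub (x t : R) : `](2^-1 : R), (3 / 2)[%classic x -> `]0, +oo[%classic t ->
    `|partial1of2 k x t| <= major t.
  rewrite /= !in_itv /= andbT => /andP[x1 x2] t0; have [_ dv] := dk x t t0.
  by rewrite partial1of2E dv log_powR_le// ltW.
rewrite -[Gamma (R:=R)]/(fun x => \int[mu]_(t in `]0, +oo[) k x t).
have mD : (R.-ocitv.-measurable).-sigma.-measurable (`]0%R, +oo[%classic : set R) by exact: measurable_itv.
rewrite (differentiation_under_integral mD I1 ki dk' G0 major_integrable Gub).
apply: eq_Rintegral => t; rewrite inE /= in_itv /= andbT => t0.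
by have [_ dv] := dk 1 t t0; rewrite partial1of2E dv subrr powRr0 mul1r.
Qed.

(** The exponential integral [E_1(x)], that is, the integral of [exp(- t) / t] over [[x, +oo[],
    after integration by parts: [- ln x exp(- x)] plus the integral of [ln t exp(- t)] over [[x,
    +oo[], which is [- gammaE] minus the part over [[0, x]]. In this form Euler's constant is
    explicit in the behaviour at 0. *)
Definition expint (x : R) : R :=
  - (ln x * expR (- x)) - gammaE R - \int[mu]_(t in `[0, x]) log_kernel t.

Lemma log_kernel_integrable_cc (b : R) : mu.-integrable `[0, b] (EFin \o log_kernel).
Proof.
have i0 : mu.-integrable `[0, +oo[ (EFin \o log_kernel).
  have := log_kernel_integrable; move=> /integrableP[_ fin]; apply/integrableP; split.
    by apply/measurable_EFinP; apply: measurable_funTS; exact: measurable_log_kernel.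
  rewrite -integral_itv_obnd_cbnd//.
  apply: measurableT_comp => //; apply/measurable_EFinP; apply: measurable_funTS.
  exact: measurable_log_kernel.
apply: integrableS i0 => //.
by move=> t /=; rewrite !in_itv /= andbT => /andP[].
Qed.

Lemma expint_derive (x : R) : 0 < x -> is_derive x 1 expint (- (expR (- x) / x)).
Proof.
move=> x0.
have clk : {for x, continuous log_kernel}.
  apply: cvgM; first exact: continuous_ln.
  exact: is_derive_continuous (is_derive_expNid x).
have x1 : x < x + 1 by rewrite ltrDl.
have [d1 d2] := @continuous_FTC1 R log_kernel (BLeft 0) x (x + 1) x1
  (log_kernel_integrable_cc _) x0 clk.
have dJ : is_derive x 1 (fun y => \int[mu]_(t in `[0, y]) log_kernel t) (log_kernel x).
  by apply: DeriveDef; [exact: d1|rewrite -derive1E; exact: d2].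
have dL := is_deriveM (is_derive1_ln x0) (is_derive_expNid x).
have := is_deriveB (is_deriveB (is_deriveN dL) (is_derive_cst (gammaE R) x 1)) dJ.
move=> h; apply: is_derive_eq.
by rewrite /log_kernel /GRing.scale /=; ring.
Qed.

Lemma expint_cvg0 : expint x + ln x @[x --> 0^'+] --> - gammaE R.
Proof.
have /(continuous_within_itvP _ ltr01)[_ J0 _] :=
  parameterized_integral_continuous ler01 (log_kernel_integrable_cc 1).
rewrite /parameterized_integral set_itv1 Rintegral_set1 in J0.
have L0 : ln x * (1 - expR (- x)) @[x --> 0^'+] --> (0 : R).
  apply/cvgrPdist_le => e e0; near=> x.
  have x0 : 0 < x by near: x; exact: nbhs_right_gt.
  have x1 : x < 1 by near: x; exact: nbhs_right_lt.
  (* The bound [|ln x| * sqrt x <= 2] makes the product at most [2 * sqrt x], whence this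
     threshold. *)
  have xe : x < (e / 4) ^+ 2 by near: x; apply: nbhs_right_lt; rewrite exprn_gt0// divr_gt0.
  rewrite sub0r normrN normrM.
  have s0 : 0 < Num.sqrt x by rewrite sqrtr_gt0.
  have se : Num.sqrt x < e / 4.
    by rewrite -[ltRHS]gtr0_norm ?divr_gt0// -sqrtr_sqr ltr_sqrt// exprn_gt0// divr_gt0.
  have h1 : `|ln x| * Num.sqrt x <= 2.
    rewrite ler0_norm; last exact: ln_le0 (ltW x1).
    have := ln_sublinear (_ : 0 < (Num.sqrt x)^-1); rewrite invr_gt0 => /(_ s0).
    rewrite lnV ?posrE// => h.
    have -> : ln x = 2 * ln (Num.sqrt x).
      by rewrite -{1}(sqr_sqrtr (ltW x0)) lnXn// mulr_natl.
    have : - ln (Num.sqrt x) * Num.sqrt x <= 1.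
      by rewrite -(mulVf (lt0r_neq0 s0)) ler_wpM2r// ltW.
    lra.
  have h2 : `|1 - expR (- x)| <= x.
    rewrite ger0_norm ?subr_ge0 ?expR_le1 ?oppr_le0 ?(ltW x0)//.
    by have := expR_ge1Dx (- x); lra.
  apply: (@le_trans _ _ (`|ln x| * (Num.sqrt x * Num.sqrt x))).
    by rewrite -expr2 sqr_sqrtr ?(ltW x0)// ler_wpM2l.
  rewrite mulrA; apply: (@le_trans _ _ (2 * Num.sqrt x)); last by lra.
  by rewrite ler_wpM2r// ltW.
have -> : (fun x => expint x + ln x) = fun x => ln x * (1 - expR (- x)) - gammaE R
    - \int[mu]_(t in `[0, x]) log_kernel t.
  by apply/funext => x; rewrite /expint; ring.
rewrite -[X in _ --> X]subr0; apply: cvgB; last exact: J0.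
rewrite -[X in _ --> X]add0r; apply: cvgB; [exact: L0|exact: cvg_cst].
Unshelve. all: by end_near. Qed.

(** Decay at infinity is what fixes the constant of integration in [laplace_identity]. It comes from
    [ln t exp(- t) <= 2 exp(- t / 2)], which makes the two terms, of opposite sign, at most 2 and 4
    times [exp(- x / 2)]. *)
Lemma expint_bound (x : R) : 1 <= x -> `|expint x| <= 5 * expR (- (x / 2)).
Proof.
move=> x1; have x0 : 0 < x by lra.
have i0 : mu.-integrable `[0, +oo[ (EFin \o log_kernel).
  have := log_kernel_integrable; move=> /integrableP[_ fin]; apply/integrableP; split.
    by apply/measurable_EFinP; apply: measurable_funTS; exact: measurable_log_kernel.
  rewrite -integral_itv_obnd_cbnd//.
  apply: measurableT_comp => //; apply/measurable_EFinP; apply: measurable_funTS.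
  exact: measurable_log_kernel.
have gE : - gammaE R = \int[mu]_(t in `[0, +oo[) log_kernel t.
  rewrite gammaE_log opprK Rintegral_itv_obnd_cbnd//.
  exact: log_kernel_integrable.
have -> : expint x = - (ln x * expR (- x)) + \int[mu]_(t in `]x, +oo[) log_kernel t.
  rewrite /expint gE -addrA; congr (_ + _).
  by rewrite Rintegral_itvB// bnd_simp; exact: ltW.
have lnx0 : 0 <= ln x by exact: ln_ge0.
have lnle (t : R) : 0 < t -> ln t * expR (- t) <= 2 * expR (- (t / 2)).
  move=> t0; have -> : - t = - (t / 2) + - (t / 2) by field.
  rewrite expRD mulrA ler_wpM2r ?expR_ge0//.
  have h : ln t <= t by exact/ltW/ln_sublinear.
  have := expR_ge1Dx (t / 2) => h2.
  rewrite expRN ler_pdivrMr ?expR_gt0//; lra.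
have Jge0 : 0 <= \int[mu]_(t in `]x, +oo[) log_kernel t.
  apply: Rintegral_ge0 => t /=; rewrite in_itv /= andbT => xt.
  by rewrite mulr_ge0 ?expR_ge0// ln_ge0//; lra.
have Jle : \int[mu]_(t in `]x, +oo[) log_kernel t <= 4 * expR (- (x / 2)).
  rewrite -lee_fin /Rintegral fineK; last first.
    apply: integrable_fin_num => //; apply: integrableS i0 => //.
    by move=> t /=; rewrite !in_itv /= !andbT; lra.
  have -> : (4 * expR (- (x / 2)))%:E = (\int[mu]_(t in `]x, +oo[) (2 * expR (- (t / 2)))%:E)%E.
    have dP (t : R) : is_derive t 1 (fun t => - (4 * expR (- (t / 2)))) (2 * expR (- (t / 2))).
      have h := is_deriveN (is_deriveZ 4 (is_derive_expNhalf t)).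
      apply: is_derive_eq.
      by rewrite /GRing.scale /=; field.
    have cP : continuous (fun t : R => 2 * expR (- (t / 2))).
      move=> t; apply: cvgM; first exact: cvg_cst.
      exact: is_derive_continuous (is_derive_expNhalf t).
    rewrite integral_itv_obnd_cbnd; last first.
      by apply/measurable_EFinP; apply: measurable_funTS; exact: continuous_measurable_fun.
    rewrite (@ge0_continuous_FTC2y _ _ (fun t => - (4 * expR (- (t / 2)))) x 0).
    - by rewrite -EFinB; congr EFin; ring.
    - by move=> t _; rewrite mulr_ge0 ?expR_ge0.
    - exact: continuous_subspaceT.
    - rewrite -[X in _ --> X]oppr0; apply: cvgN.
      rewrite -[X in _ --> X](mulr0 4); apply: cvgM; first exact: cvg_cst.
      apply: (@cvg_comp _ _ _ (fun t : R => t / 2) (fun z => expR (- z)) _ +oo%R); last exact: cvgr_expR.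
      by apply: gt0_cvgMly => //; exact: cvg_id.
    - by move=> t _; have [] := dP t.
    - exact/cvg_at_right_filter/(is_derive_continuous (dP x)).
    - by move=> t _; rewrite derive1E; have [_ ->] := dP t.
  apply: ge0_le_integral => //.
  - move=> t /=; rewrite in_itv /= andbT => xt.
    by rewrite lee_fin mulr_ge0 ?expR_ge0// ln_ge0//; lra.
  - by apply/measurable_EFinP; apply: measurable_funTS; exact: measurable_log_kernel.
  - apply/measurable_EFinP; apply: measurable_funTS; apply: measurable_funM => //.
    by apply: measurableT_comp => //; apply: measurableT_comp => //; exact: measurable_funM.
  - by move=> t /=; rewrite in_itv /= andbT => xt; rewrite lee_fin lnle//; lra.
have h2 : ln x * expR (- x) <= 2 * expR (- (x / 2)) by exact: lnle.
have h3 : 0 <= ln x * expR (- x) by rewrite mulr_ge0 ?expR_ge0.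
have h4 := expR_ge0 (- (x / 2)).
move: Jge0 Jle h2 h3 h4; clear.
move: (\int[mu]_(t in `]x, +oo[) log_kernel t) (ln x * expR (- x)) (expR _) => J a b *.
by rewrite ler_norml; apply/andP; split; lra.
Qed.

End gamma.

(** * Behaviour of the Laplace transform at zero *)

Lemma derive0_cst_pos (R : realType) (B : R -> R) :
  (forall x : R, 0 < x -> is_derive x 1 B 0) -> forall a b : R, 0 < a -> 0 < b -> B a = B b.
Proof.
move=> dB.
have H (a b : R) : 0 < a -> a < b -> B a = B b.
  move=> a0 ab.
  have cB : {within `[a, b], continuous B}.
    apply: derivable_within_continuous => x; rewrite in_itv /= => /andP[ax _].
    by have [] := dB x (lt_le_trans a0 ax).
  have dB' (x : R) : x \in `]a, b[ -> is_derive x 1 B 0.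
    by rewrite in_itv /= => /andP[ax _]; apply: dB; exact: lt_trans ax.
  have [c _] := @MVT R B (fun=> 0) a b ab dB' cB.
  by rewrite mul0r => /eqP; rewrite subr_eq0 => /eqP.
move=> a b a0 b0; have [ab|ba|->//] := ltgtP a b; first exact: H.
by apply/esym/H.
Qed.

Section kappa.
Context {R : realType}.
Notation mu := (@lebesgue_measure R).
Context (N : nat) (p : nat -> R).
Context (p0 : forall j : nat, (1 <= j <= N)%N -> 0 <= p j).
Context (p1 : \sum_(1 <= j < N.+1) p j = 1).
Local Notation Q := (Qpoly N p).
Local Notation q := (\sum_(1 <= j < N.+1) p j * j%:R).

Lemma QpolyE (z : R) : Q.[z] = \sum_(1 <= j < N.+1) p j * z ^+ j.
Proof. by rewrite /Qpoly horner_sum; apply: eq_bigr => j _; rewrite hornerZ hornerXn. Qed.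

Lemma q_ofE : q_of Q = q.
Proof.
rewrite /q_of /Qpoly raddf_sum horner_sum; apply: eq_bigr => j _.
by rewrite /= derivZ hornerZ derivXn hornerMn hornerXn expr1n.
Qed.

Lemma Qpoly1 : Q.[1] = 1.
Proof. by rewrite QpolyE -[RHS]p1; apply: eq_bigr => j _; rewrite expr1n mulr1. Qed.

Lemma Qpoly_le (z : R) : 0 <= z -> z <= 1 -> Q.[z] <= z.
Proof.
move=> z0 z1; rewrite QpolyE -[leRHS]mul1r -[X in X * z]p1 mulr_suml.
rewrite big_nat_cond [leRHS]big_nat_cond; apply: ler_sum => j /andP[/andP[j1 jN] _].
rewrite ler_wpM2l//; first by rewrite p0// j1 -ltnS.
by rewrite -[leRHS]expr1; apply: ler_wiXn2l.
Qed.

Lemma Qpoly_factor : exists Q1 Q2 : {poly R},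
  [/\ forall z, 1 - Q.[z] = Q1.[z] * (1 - z),
      forall z, q - Q1.[z] = Q2.[z] * (1 - z), Q1.[1] = q &
      forall z, 0 <= z <= 1 -> 1 <= Q1.[z]].
Proof.
have r1 : root (1 - Q) 1 by rewrite /root hornerD hornerN hornerC Qpoly1 subrr.
have /factor_theorem[S1 E1] := r1.
have H1 z : 1 - Q.[z] = (- S1).[z] * (1 - z).
  have : (1 - Q).[z] = (S1 * ('X - 1%:P)).[z] by rewrite E1.
  by rewrite hornerM hornerD !hornerN hornerXsubC hornerC => ->; ring.
have Q11 : (- S1).[1] = q.
  have := congr1 (fun P : {poly R} => (deriv P).[1]) E1.
  rewrite /= [in RHS]derivM derivXsubC [in RHS]hornerD !hornerM hornerXsubC subrr mulr0 add0r.
  rewrite hornerC mulr1 derivB -polyC1 derivC sub0r !hornerN => <-.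
  by rewrite opprK; exact: q_ofE.
have r2 : root (q%:P + S1) 1 by rewrite /root hornerD hornerC -Q11 hornerN addNr.
have /factor_theorem[S2 E2] := r2.
exists (- S1), (- S2); split => //.
- move=> z; have : (q%:P + S1).[z] = (S2 * ('X - 1%:P)).[z] by rewrite E2.
  by rewrite hornerM hornerD hornerXsubC hornerC !hornerN opprK => ->; ring.
- move=> z /andP[z0]; rewrite le_eqVlt => /orP[/eqP->|z1].
    by rewrite Q11; exact: mean_degree_ge1.
  have z10 : 0 < 1 - z by lra.
  by rewrite -(ler_pM2r z10) mul1r -H1; have := Qpoly_le z0 (ltW z1); lra.
Qed.

(** [K] integrates the regularised, continuous integrand from 0. The Lipschitz bound reaches both
    endpoints because [K(F(x))] is needed in both limits: [F] tends to 0 at infinity and to 1 at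
    zero. *)
Lemma kappa_primitive : exists K : R -> R,
  [/\ forall w : R, 0 < w -> w < 1 ->
        is_derive w 1 K ((1 - w)^-1 - q / (1 - Q.[w])),
      exists C : R, forall w w' : R, 0 <= w -> w <= w' -> w' <= 1 ->
        `|K w' - K w| <= C * (w' - w),
      K 0 = 0 & expR (K 1) = kappa_of Q].
Proof.
have [Q1 [Q2 [E1 E2 Q11 Q1ge]]] := Qpoly_factor.
pose r (z : R) := - (Q2.[z] / Q1.[z]).
have rE z : 0 <= z -> z < 1 -> r z = (1 - z)^-1 - q / (1 - Q.[z]).
  move=> z0 z1; have z10 : 1 - z != 0 by rewrite subr_eq0 eq_sym lt_eqF.
  have Qz : Q1.[z] != 0.
    by rewrite lt0r_neq0// (lt_le_trans ltr01)// Q1ge// z0 ltW.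
  rewrite E1 /r; have -> : q = Q1.[z] + Q2.[z] * (1 - z) by rewrite -E2; ring.
  by field; rewrite z10 Qz.
have cr z : 0 <= z <= 1 -> {for z, continuous r}.
  move=> z01; have Qz : Q1.[z] != 0 by rewrite lt0r_neq0// (lt_le_trans ltr01)// Q1ge.
  apply: cvgN; apply: cvgM; first exact: continuous_horner.
  by apply: cvgV => //; exact: continuous_horner.
have crw : {within `[0, 1], continuous r}.
  by apply: continuous_in_subspaceT => z /set_mem /=; rewrite in_itv /=; exact: cr.
have ir : mu.-integrable `[0, 1] (EFin \o r).
  by apply: continuous_compact_integrable => //; exact: segment_compact.
pose K (w : R) := \int[mu]_(z in `[0, w]) r z.
have dK (w : R) : 0 < w -> w < 1 -> is_derive w 1 K (r w).
  move=> w0 w1.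
  have w01 : 0 <= w <= 1 by rewrite !ltW.
  have [d1 d2] := @continuous_FTC1 R r (BLeft 0) w 1 w1 ir w0 (cr w w01).
  by apply: DeriveDef; [exact: d1|rewrite -derive1E; exact: d2].
have cK : {within `[0, 1], continuous K} := parameterized_integral_continuous ler01 ir.
exists K; split.
- by move=> w w0 w1; rewrite -rE ?(ltW w0)//; exact: dK.
- have [c1 _ r1] := EVT_max ler01 crw; have [c2 _ r2] := EVT_min ler01 crw.
  exists (`|r c1| + `|r c2|) => w w' w0 ww' w'1.
  have cKw : {within `[w, w'], continuous K}.
    apply: continuous_subspaceW cK => t /=; rewrite !in_itv /= => /andP[? ?].
    by apply/andP; split; lra.
  have dKw (x : R) : x \in `]w, w'[ -> is_derive x 1 K (r x).
    by rewrite in_itv /= => /andP[? ?]; apply: dK; lra.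
  have [c + ->] := MVT_segment ww' dKw cKw.
  rewrite in_itv /= => /andP[wc cw']; rewrite normrM (ger0_norm (_ : 0 <= w' - w)) ?subr_ge0//.
  rewrite ler_wpM2r ?subr_ge0// ler_norml.
  have cin : c \in `[0, 1] by rewrite in_itv /=; apply/andP; split; lra.
  have := r1 c cin; have := r2 c cin; have := ler_norm (r c1); have := ler_norm (- r c2).
  rewrite normrN; have := normr_ge0 (r c1); have := normr_ge0 (r c2).
  by move=> *; apply/andP; split; lra.
- by rewrite /K set_itv1 Rintegral_set1.
- rewrite /kappa_of /K; congr expR.
  (* The two integrands may differ at [z = 1], where one of them divides by zero, so they are
     compared on [[0, 1[]. *)
  have ir' : mu.-integrable `[0, 1[ (EFin \o r).
    by apply: integrableS ir => // z /=; rewrite !in_itv /= => /andP[-> /ltW].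
  have ik : mu.-integrable `[0, 1[ (EFin \o (fun z => (1 - z)^-1 - q_of Q / (1 - Q.[z]))).
    apply: eq_integrable ir' => // z /set_mem /=; rewrite in_itv /= => /andP[z0 z1].
    by rewrite rE// q_ofE.
  rewrite -(Rintegral_itv_bndo_bndc ir') -(Rintegral_itv_bndo_bndc ik).
  apply: eq_Rintegral => z; rewrite inE /= in_itv /= => /andP[z0 z1].
  by rewrite rE// q_ofE.
Qed.

Context (theta : R) (theta0 : 0 < theta) (f : R -> R).
Context (sol : prob_sol N p (theta / q) f).

Let df := sol_density sol.
Let m1 := sol_mass sol.
Let q0 : 0 < q.
Proof. by rewrite (lt_le_trans ltr01)//; exact: mean_degree_ge1. Qed.
Let beta0 : 0 <= theta / q.
Proof. by rewrite divr_ge0// ltW. Qed.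

(** By the Laplace equation and the formula for the derivative of [K], the two sides have the same
    derivative. The constant is found at infinity, where [F], [K(F)] and [expint] tend to 0; at 0
    the logarithm and [expint] diverge. *)
Lemma laplace_identity (K : R -> R) :
  (forall w : R, 0 < w -> w < 1 -> is_derive w 1 K ((1 - w)^-1 - q / (1 - Q.[w]))) ->
  (exists C : R, forall w w' : R, 0 <= w -> w <= w' -> w' <= 1 ->
        `|K w' - K w| <= C * (w' - w)) -> K 0 = 0 ->
  forall x, 0 < x -> - ln (1 - laplace f x) = K (laplace f x) + theta * expint x.
Proof.
move=> dK [C KC] K0.
pose B (x : R) := - ln (1 - laplace f x) - K (laplace f x) - theta * expint x.
have F01 (x : R) : 0 < x -> 0 < laplace f x /\ laplace f x < 1.
  by move=> x0; split; [exact: laplace_gt0 (ltW x0)|exact: laplace_lt1].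
have dB (x : R) : 0 < x -> is_derive x 1 B 0.
  move=> x0; have [w0 w1] := F01 x x0.
  have dF := laplace_derive df x0.
  have w10 : 0 < 1 - laplace f x by lra.
  have d1 := is_deriveB (is_derive_cst (1 : R) x 1) dF.
  rewrite sub0r opprK in d1.
  have d2 := @is_derive1_comp R (@ln R) (fun x => 1 - laplace f x) x _ _ (is_derive1_ln w10) d1.
  have d3 := @is_derive1_comp R K (laplace f) x _ _ (dK _ w0 w1) dF.
  have d4 := is_deriveZ theta (expint_derive x0).
  have h := is_deriveB (is_deriveB (is_deriveN d2) d3) d4.
  apply: is_derive_eq; rewrite /GRing.scale /=.
  have Qw : 1 - Q.[laplace f x] != 0.
    by rewrite lt0r_neq0//; have := Qpoly_le (ltW w0) (ltW w1); lra.
  have eqn := laplace_equation p0 p1 beta0 sol x0.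
  have xn : x != 0 by rewrite lt0r_neq0.
  have qn : q != 0 by rewrite lt0r_neq0.
  have E : laplace1 f x = theta / q * expR (- x) * (1 - Q.[laplace f x]) / x.
    by rewrite -eqn mulrAC mulfV ?mul1r.
  by rewrite E; field; rewrite xn Qw qn lt0r_neq0.
have B0 : B 1 = 0.
  apply/eqP; rewrite -normr_le0; apply/ler_addgt0Pr => e e0; rewrite add0r.
  have C0 : 0 <= C.
    have := KC 0 1 (lexx _) ler01 (lexx _); rewrite subr0 mulr1.
    by apply: le_trans.
  have : (2 + C + theta * 5) * expR (- (x / 2)) @[x --> +oo] --> (0 : R).
    rewrite -[X in _ --> X](mulr0 (2 + C + theta * 5)); apply: cvgM; first exact: cvg_cst.
    apply: (@cvg_comp _ _ _ (fun t : R => t / 2) (fun z => expR (- z)) _ +oo%R); last exact: cvgr_expR.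
    by apply: gt0_cvgMly => //; exact: cvg_id.
  move=> /cvgrPdist_lt/(_ _ e0)[M [_ HM]].
  pose x := Num.max (M + 1) 1.
  have xM : M < x by rewrite lt_max ltrDl ltr01.
  have x1 : 1 <= x by rewrite le_max lexx orbT.
  have x0 : 0 < x by lra.
  have := HM x xM; rewrite sub0r normrN ger0_norm; last first.
    by rewrite mulr_ge0 ?expR_ge0// !addr_ge0// mulr_ge0// ltW.
  rewrite (derive0_cst_pos dB ltr01 x0) => /ltW; apply: le_trans.
  have [w0 w1] := F01 x x0.
  have wle := laplace_le df m1 (ltW x0).
  (* All three terms of [B x] are bounded by multiples of [E]. For [x >= 1] one has [E <= 2 / 3] and
     [F <= E ^ 2 <= 4 / 9], which keeps [- ln(1 - F) <= F / (1 - F)] below [2 * E]. *)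
  set E := expR (- (x / 2)); have E0 : 0 < E by exact: expR_gt0.
  have ee : expR (- x) = E * E by rewrite -expRD; congr expR; field.
  have Ehalf : E <= 2 / 3.
    rewrite /E expRN -[leRHS]invf_div lef_pV2 ?posrE ?expR_gt0//.
    by apply: le_trans (expR_ge1Dx _); lra.
  have wE : laplace f x <= E by apply: le_trans wle _; rewrite ee ger_pMr//; lra.
  have w49 : laplace f x <= 4 / 9 by apply: le_trans wle _; rewrite ee; nra.
  have l1 : `|ln (1 - laplace f x)| <= 2 * E.
    rewrite ler0_norm; last by apply: ln_le0; lra.
    rewrite -lnV ?posrE; last by lra.
    have w10 : 0 < 1 - laplace f x by lra.
    have h1 : 1 < (1 - laplace f x)^-1 by rewrite invf_gt1//; lra.
    have h2 : -1 < (1 - laplace f x)^-1 - 1 by lra.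
    have := le_ln1Dx h2; rewrite addrC subrK.
    move=> h; apply: le_trans h _.
    have -> : (1 - laplace f x)^-1 - 1 = laplace f x / (1 - laplace f x) by field; rewrite lt0r_neq0.
    by rewrite ler_pdivrMr//; nra.
  have l2 : `|K (laplace f x)| <= C * E.
    have := KC 0 (laplace f x) (lexx _) (ltW w0) (ltW w1); rewrite K0 !subr0 => h.
    by apply: le_trans h _; rewrite ler_wpM2l.
  have l3 : `|theta * expint x| <= theta * (5 * E).
    by rewrite normrM (gtr0_norm theta0) ler_pM2l// expint_bound.
  rewrite /B; apply: (le_trans (ler_normB _ _)).
  have := ler_normB (- ln (1 - laplace f x)) (K (laplace f x)); rewrite normrN.
  by move: l1 l2 l3; clear; move=> *; lra.
move=> x x0; have := derive0_cst_pos dB x0 ltr01; rewrite B0 /B; lra.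
Qed.

(** Exponentiating the identity: [(1 - F(x)) x ^ (- theta)] equals
    [exp(- K(F(x)) - theta (expint x + ln x))], and both terms of the exponent converge at 0. *)
Lemma laplace_asymptotics :
  (1 - laplace f x) * x `^ (- theta) @[x --> 0^'+] -->
    expR (theta * gammaE R) / kappa_of Q.
Proof.
have [K [dK [C KC] K0 K1]] := kappa_primitive.
have id := laplace_identity dK (ex_intro _ C KC) K0.
have KF : K (laplace f x) @[x --> 0^'+] --> K 1.
  have C0 : 0 <= C.
    have := KC 0 1 (lexx _) ler01 (lexx _); rewrite subr0 mulr1.
    by apply: le_trans.
  apply/cvgrPdist_lt => e e0.
  have e1 : 0 < e / (C + 1) by rewrite divr_gt0//; lra.
  have := laplace_cvg1 df m1 => /cvgrPdist_lt/(_ _ e1) near1.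
  near=> x.
  have x0 : 0 < x by near: x; exact: nbhs_right_gt.
  have h : `|1 - laplace f x| < e / (C + 1) by near: x; exact: near1.
  have w1 := laplace_lt1 df m1 x0; have w0 := laplace_gt0 df m1 (ltW x0).
  apply: le_lt_trans (KC _ _ (ltW w0) (ltW w1) (lexx _)) _.
  rewrite gtr0_norm ?subr_gt0// in h; rewrite ltr_pdivlMr in h; last by lra.
  by apply: le_lt_trans h; rewrite mulrC ler_wpM2l ?lerDl//; lra.
have lim : expR (- K (laplace f x) - theta * (expint x + ln x)) @[x --> 0^'+] -->
    expR (- K 1 - theta * (- gammaE R)).
  apply: (@cvg_comp _ _ _ (fun x => - K (laplace f x) - theta * (expint x + ln x)) expR); last exact: continuous_expR.
  apply: cvgB; first exact: cvgN.
  by apply: cvgM; [exact: cvg_cst|exact: expint_cvg0].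
have -> : expR (theta * gammaE R) / kappa_of Q = expR (- K 1 - theta * - gammaE R).
  by rewrite -K1 -expRN -expRD; congr expR; ring.
apply: cvg_trans lim; apply: near_eq_cvg; near=> x.
have x0 : 0 < x by near: x; exact: nbhs_right_gt.
have w1 := laplace_lt1 df m1 x0.
have w10 : 0 < 1 - laplace f x by lra.
rewrite -[X in _ = X * _](lnK w10) /powR (gt_eqF x0) -expRD; congr expR.
have := id x x0; lra.
Unshelve. all: by end_near. Qed.

End kappa.

(** * A Tauberian theorem *)

Section approximation.
Context {R : realType}.
Notation mu := (@lebesgue_measure R).
Implicit Types (k psi : R -> R) (t : R).

(* Newton-type iteration: u - p_(n+1) = (u - p_n)(1 - (u + p_n)/2) for u = |z|. *)
Lemma abs_poly_approx (e : R) : 0 < e ->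
  exists P : {poly R}, forall z, `|z| <= 1 -> `| `|z| - P.[z] | <= e.
Proof.
move=> e0.
have H (n : nat) : exists P : {poly R}, forall z, `|z| <= 1 ->
    [/\ 0 <= P.[z], P.[z] <= `|z| & (`|z| - P.[z]) * (n%:R + 2) <= 2].
  elim: n => [|n [P HP]].
    by exists 0 => z z1; rewrite hornerC normr_ge0; split => //; lra.
  exists (P + 2^-1 *: ('X^2 - P ^+ 2)) => z z1.
  rewrite hornerD hornerZ hornerD hornerN hornerXn horner_exp -[z ^+ 2]real_normK ?num_real//.
  have [] := HP z z1; have := normr_ge0 z; have : 0 <= n%:R :> R by [].
  move: (P.[z]) (`|z|) z1 => w u; rewrite -(natr1 n); move: (n%:R : R) => m u1 m0 u0 w0 wu dm.
  have k1 : 0 <= (u - w) * (1 - (u + w) / 2) by apply: mulr_ge0; lra.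
  have k2 : (u - w) * (1 - (u + w) / 2) <= (u - w) * (1 - (u - w) / 2).
    by apply: ler_wpM2l; lra.
  have k3 : 0 <= (u - w) * (u + w) by apply: mulr_ge0; lra.
  have k4 : u ^+ 2 - w ^+ 2 = (u - w) * (u + w) by ring.
  split; [by rewrite k4; lra|by rewrite k4; nra|].
  have -> : (u - (w + 2^-1 * (u ^+ 2 - w ^+ 2))) * (m + 1 + 2) =
    (u - w) * (1 - (u + w) / 2) * (m + 3) by field.
  apply: le_trans (_ : (u - w) * (1 - (u - w) / 2) * (m + 3) <= _).
    by apply: ler_wpM2r => //; lra.
  have -> : (u - w) * (1 - (u - w) / 2) * (m + 3) =
    ((u - w) * (m + 2) + (u - w)) * (1 - (u - w) / 2) by ring.
  apply: le_trans (_ : (2 + (u - w)) * (1 - (u - w) / 2) <= _); last by nra.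
  by apply: ler_wpM2r; lra.
have [P HP] := H (Num.truncn (2 / e)).+1.
exists P => z /HP[w0 wu].
have := truncnS_gt (2 / e); rewrite ltr_pdivrMr// => h1.
have m0 : 0 <= (Num.truncn (2 / e)).+1%:R :> R by [].
have d0 : 0 <= `|z| - P.[z] by rewrite subr_ge0.
rewrite (ger0_norm d0).
move: m0 h1 d0; move: (`|z| - _) ((Num.truncn (2 / e)).+1%:R) => d m m0 h1 d0 h2.
rewrite leNgt; apply/negP => ed.
have : e * m <= d * m by rewrite ler_wpM2r// ltW.
nra.
Qed.

(** For [c < d], a piecewise linear bump on [[c, d]] with peak [d - c] at the midpoint. Written with
    absolute values, it is approximated by polynomials as soon as [|z|] is. *)
Definition tent (c d z : R) : R := `|z - c| - 2 * `|z - (c + d) / 2| + `|z - d|.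

Lemma tent_ge0 (c d z : R) : 0 <= tent c d z.
Proof.
rewrite /tent; have := ler_normD (z - c) (z - d).
have -> : z - c + (z - d) = 2 * (z - (c + d) / 2) by field.
by rewrite normrM ger0_norm//; lra.
Qed.

Lemma tent_out (c d z : R) : c <= d -> z <= c \/ d <= z -> tent c d z = 0.
Proof.
move=> cd; rewrite /tent => -[h|h].
  by rewrite !ler0_norm; [field|lra..].
by rewrite !ger0_norm; [field|lra..].
Qed.

Lemma tent_mid (c d z : R) : (3 * c + d) / 4 <= z -> z <= (c + 3 * d) / 4 ->
  c < d -> (d - c) / 2 <= tent c d z.
Proof.
move=> h1 h2 cd; rewrite /tent (ger0_norm (_ : 0 <= z - c)); last by lra.
rewrite (ler0_norm (_ : z - d <= 0)); last by lra.
by have [h|h] := ger0P (z - (c + d) / 2); lra.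
Qed.

Lemma tent_le (c d z : R) : 0 <= c <= 1 -> 0 <= d <= 1 -> 0 <= z <= 1 -> tent c d z <= 2.
Proof.
move=> /andP[? ?] /andP[? ?] /andP[? ?]; rewrite /tent.
have : `|z - c| <= 1 by rewrite ler_norml; apply/andP; split; lra.
have : `|z - d| <= 1 by rewrite ler_norml; apply/andP; split; lra.
by have := normr_ge0 (z - (c + d) / 2); lra.
Qed.

Lemma measurable_tent (c d : R) : measurable_fun setT (tent c d).
Proof.
apply: measurable_funD; last first.
  by apply: measurableT_comp => //; apply: measurable_funB.
apply: measurable_funB; first by apply: measurableT_comp => //; apply: measurable_funB.
by apply: measurable_funM => //; apply: measurableT_comp => //; apply: measurable_funB.
Qed.

Lemma tent_poly_approx (c d e : R) : 0 <= c <= 1 -> 0 <= d <= 1 -> 0 < e ->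
  exists P : {poly R}, forall z, 0 <= z <= 1 -> `|tent c d z - P.[z]| <= e.
Proof.
(* The coefficients 1, 2 and 1 of the three absolute values add up to 4. *)
move=> /andP[c0 c1] /andP[d0 d1] e0; have e4 : 0 < e / 4 by lra.
have [A HA] := abs_poly_approx e4.
exists ((A \Po ('X - c%:P)) - 2 *: (A \Po ('X - ((c + d) / 2)%:P)) + (A \Po ('X - d%:P))).
move=> z /andP[z0 z1]; rewrite !hornerD hornerN hornerZ !horner_comp !hornerXsubC /tent.
have := HA (z - c) ltac:(rewrite ler_norml; apply/andP; split; lra).
have := HA (z - d) ltac:(rewrite ler_norml; apply/andP; split; lra).
have := HA (z - (c + d) / 2) ltac:(rewrite ler_norml; apply/andP; split; lra).
rewrite !ler_norml => /andP[? ?] /andP[? ?] /andP[? ?]; apply/andP; split; lra.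
Qed.

Record kern (k : R -> R) : Prop := Kern {
  kern_weight : weight k;
  kern_supp : forall t, t < 0 -> k t = 0;
  kern_int : mu.-integrable setT (EFin \o k) }.

Lemma kern_integrable k psi (M : R) : kern k -> measurable_fun setT psi ->
  (forall t, 0 <= t -> `|psi t| <= M) ->
  mu.-integrable setT (EFin \o (fun t => k t * psi t)).
Proof.
move=> [[mk k0] sk ik] mpsi le.
apply: (@le_integrable _ _ _ mu setT measurableT _ (EFin \o (fun t => M * k t))).
- by apply/measurable_EFinP/measurable_funM.
- move=> t _ /=; rewrite lee_fin normrM (ger0_norm (k0 t)) mulrC.
  have [t0|t0] := ltP t 0; first by rewrite sk// !mulr0.
  apply: le_trans (ler_norm _); exact: ler_wpM2r (le t t0).
- have -> : EFin \o (fun t => M * k t) = (fun t => (M%:E * (EFin \o k) t)%E).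
    by apply/funext => t /=; rewrite EFinM.
  exact: integrableZl.
Qed.

Lemma kern_Rexpect_close k (psi1 psi2 : R -> R) (M1 M2 e : R) : kern k ->
  measurable_fun setT psi1 -> measurable_fun setT psi2 ->
  (forall t, 0 <= t -> `|psi1 t| <= M1) -> (forall t, 0 <= t -> `|psi2 t| <= M2) ->
  (forall t, 0 <= t -> `|psi1 t - psi2 t| <= e) ->
  `|Rexpect k psi1 - Rexpect k psi2| <= e * Rexpect k (cst 1).
Proof.
move=> kk m1 m2 b1 b2 le.
have i1 := kern_integrable kk m1 b1; have i2 := kern_integrable kk m2 b2.
have i3 : mu.-integrable setT (EFin \o (fun t => k t * cst 1 t)).
  by apply: (@kern_integrable _ _ 1) => // t _; rewrite normr1.
rewrite /Rexpect -RintegralB//.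
apply: le_trans (le_normr_Rintegral measurableT _) _.
  have := integrableB measurableT i1 i2; apply: eq_integrable => // t _ /=.
rewrite -RintegralZl//; apply: le_Rintegral => //.
- have := integrableB measurableT i1 i2 => /integrable_abse.
  by apply: eq_integrable => // t _ /=.
- have -> : EFin \o (fun t => e * (k t * cst 1 t)) = (fun t => (e%:E * ((k t * cst 1 t)%R)%:E)%E).
    by apply/funext => t /=; rewrite -EFinM.
  exact: integrableZl.
- move=> t _; rewrite /= -mulrBr normrM (ger0_norm ((kern_weight kk).2 t)) mulr1 mulrC.
  have [t0|t0] := ltP t 0; first by rewrite (kern_supp kk t0) !mulr0.
  by rewrite ler_wpM2r ?le// (kern_weight kk).2.
Qed.

Lemma measurable_expN : measurable_fun setT (fun t : R => expR (- t)).
Proof. by apply: measurableT_comp => //; exact: measurable_oppr. Qed.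

Lemma expN01 (t : R) : 0 <= t -> 0 <= expR (- t) <= 1.
Proof. by move=> t0; rewrite expR_ge0 /= -[leRHS]expR0 ler_expR oppr_le0. Qed.

Lemma measurable_horner (P : {poly R}) : measurable_fun setT (fun z : R => P.[z]).
Proof. by apply: continuous_measurable_fun; exact: continuous_horner. Qed.

Lemma horner_bounded (P : {poly R}) (b : R) :
  exists M : R, forall z, 0 <= z <= b -> `|P.[z]| <= M.
Proof.
elim/poly_ind: P => [|P c [M HM]]; first by exists 0 => z _; rewrite hornerC normr0.
exists (M * b + `|c|) => z zb; rewrite hornerMXaddC; have /andP[z0 z1] := zb.
apply: le_trans (ler_normD _ _) _; rewrite lerD2r normrM (ger0_norm z0).
by apply: ler_pM => //; exact: HM.
Qed.

Lemma cvg_kern_poly (k : R -> R -> R) k0 (P : {poly R}) :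
  (forall x, 0 < x -> kern (k x)) -> kern k0 ->
  (forall n : nat, Rexpect (k x) (fun t => expR (- t) ^+ n) @[x --> 0^'+] -->
     Rexpect k0 (fun t => expR (- t) ^+ n)) ->
  Rexpect (k x) (fun t => P.[expR (- t)]) @[x --> 0^'+] -->
     Rexpect k0 (fun t => P.[expR (- t)]).
Proof.
move=> kk kk0 H.
(* Horner's scheme multiplies the polynomial by the variable, so the induction carries an extra
   power of [exp(- t)]. *)
suff G (m : nat) : Rexpect (k x) (fun t => P.[expR (- t)] * expR (- t) ^+ m) @[x --> 0^'+] -->
     Rexpect k0 (fun t => P.[expR (- t)] * expR (- t) ^+ m).
  have := G 0; under [X in _ --> X]eq_Rintegral do rewrite expr0 mulr1.
  apply: cvg_trans; apply: near_eq_cvg; near=> x.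
  by apply: eq_Rintegral => t _; rewrite expr0 mulr1.
elim/poly_ind: P m => [|P c IH] m.
  have E h : Rexpect h (fun t => (0 : {poly R}).[expR (- t)] * expR (- t) ^+ m) = 0.
    rewrite /Rexpect; under eq_Rintegral do rewrite hornerC mul0r mulr0.
    by rewrite Rintegral_cst// mul0r.
  by rewrite E; under eq_fun do rewrite E; exact: cvg_cst.
have E h : kern h -> Rexpect h (fun t => (P * 'X + c%:P).[expR (- t)] * expR (- t) ^+ m) =
   Rexpect h (fun t => P.[expR (- t)] * expR (- t) ^+ m.+1) +
   c * Rexpect h (fun t => expR (- t) ^+ m).
  move=> kh; have [M HM] := horner_bounded P 1.
  have mX j : measurable_fun setT (fun t : R => expR (- t) ^+ j).
    by apply: measurable_funX; exact: measurable_expN.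
  have X1 j (t : R) : 0 <= t -> `|expR (- t) ^+ j| <= 1.
    move=> t0; rewrite normrX ger0_norm ?expR_ge0//; have /andP[? ?] := expN01 t0.
    by rewrite exprn_ile1.
  have i1 : mu.-integrable setT (EFin \o (fun t => h t * (P.[expR (- t)] * expR (- t) ^+ m.+1))).
    apply: (@kern_integrable _ _ M) => //.
      apply: measurable_funM => //; apply: measurableT_comp; last exact: measurable_expN.
      exact: measurable_horner.
    move=> t t0; rewrite normrM.
    by apply: le_trans (HM _ (expN01 t0)); rewrite ler_piMr// X1.
  have i2 : mu.-integrable setT (EFin \o (fun t => h t * expR (- t) ^+ m)).
    by apply: (@kern_integrable _ _ 1) => //; exact: X1.
  rewrite /Rexpect -RintegralZl// -RintegralD//; last first.
    have -> : EFin \o (fun t => c * (h t * expR (- t) ^+ m)) =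
       (fun t => (c%:E * (EFin \o (fun t => h t * expR (- t) ^+ m)%R) t)%E).
      by apply/funext => t /=; rewrite -EFinM.
    exact: integrableZl.
  by apply: eq_Rintegral => t _; rewrite hornerMXaddC exprS; ring.
rewrite E//.
apply: cvg_trans (cvgD (IH m.+1) (cvgM (cvg_cst c) (H m))).
apply: near_eq_cvg; near=> x; rewrite E//.
by apply: kk; near: x; exact: nbhs_right_gt.
Unshelve. all: by end_near. Qed.

Lemma cvg_kern_tent (k : R -> R -> R) k0 (c d : R) : 0 <= c <= 1 -> 0 <= d <= 1 ->
  (forall x, 0 < x -> kern (k x)) -> kern k0 ->
  (forall n : nat, Rexpect (k x) (fun t => expR (- t) ^+ n) @[x --> 0^'+] -->
     Rexpect k0 (fun t => expR (- t) ^+ n)) ->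
  Rexpect (k x) (fun t => tent c d (expR (- t))) @[x --> 0^'+] -->
     Rexpect k0 (fun t => tent c d (expR (- t))).
Proof.
move=> c01 d01 kk kk0 H; apply/cvgrPdist_le => e e0.
have E0 h : Rexpect h (fun t => expR (- t) ^+ 0) = Rexpect h (cst 1).
  by apply: eq_Rintegral => t _; rewrite expr0.
have m0 h : kern h -> 0 <= Rexpect h (cst 1).
  by move=> kh; apply: Rintegral_ge0 => t _; rewrite mulr1 (kern_weight kh).2.
(* The moment of index 0 is the mass: its convergence bounds the masses of [k x] by [M] near 0, so
   one polynomial serves all these kernels with error [e / 3]. *)
pose M := Rexpect k0 (cst 1) + 1.
have M0 : 0 < M by rewrite /M; have := m0 _ kk0; lra.
have e1 : 0 < e / (3 * M) by rewrite divr_gt0//; lra.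
have [P HP] := tent_poly_approx c01 d01 e1.
have [MP HMP] := horner_bounded P 1.
have K h : kern h -> Rexpect h (cst 1) <= M ->
    `|Rexpect h (fun t => tent c d (expR (- t))) - Rexpect h (fun t => P.[expR (- t)])| <= e / 3.
  move=> kh hM; apply: le_trans (_ : e / (3 * M) * Rexpect h (cst 1) <= _).
    apply: (@kern_Rexpect_close _ _ _ 2 MP) => //.
    - by apply: measurableT_comp; [exact: measurable_tent|exact: measurable_expN].
    - by apply: measurableT_comp; [exact: measurable_horner|exact: measurable_expN].
    - by move=> t t0; rewrite ger0_norm ?tent_ge0// tent_le// expN01.
    - by move=> t t0; apply: HMP; exact: expN01.
    - by move=> t t0; apply: HP; exact: expN01.
  have -> : e / 3 = e / (3 * M) * M by field; rewrite lt0r_neq0.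
  by rewrite ler_wpM2l// ltW.
have e3 : 0 < e / 3 by lra.
have := cvg_kern_poly (P := P) kk kk0 H => /cvgrPdist_le/(_ _ e3) near1.
have := H 0; rewrite E0 => /cvgrPdist_le/(_ _ ltr01) near2.
near=> x.
have x0 : 0 < x by near: x; exact: nbhs_right_gt.
have h2 : `|Rexpect k0 (cst 1) - Rexpect (k x) (fun t => expR (- t) ^+ 0)| <= 1.
  by near: x; exact: near2.
have h1 : `|Rexpect k0 (fun t => P.[expR (- t)]) - Rexpect (k x) (fun t => P.[expR (- t)])| <= e / 3.
  by near: x; exact: near1.
have hx : Rexpect (k x) (cst 1) <= M.
  by move: h2; rewrite E0 ler_norml /M => /andP[? ?]; lra.
have := K _ (kk x x0) hx.
have hk : Rexpect k0 (cst 1) <= M by rewrite /M; lra.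
have := K _ kk0 hk.
move: h1; rewrite !ler_norml => /andP[? ?] /andP[? ?] /andP[? ?]; apply/andP; split; lra.
Unshelve. all: by end_near. Qed.

End approximation.

(** * Karamata's theorem for monotone functions *)

Section tauberian.
Context {R : realType}.
Notation mu := (@lebesgue_measure R).

Lemma near_right0E (P : set R) :
  (\forall x \near 0^'+, P x) -> exists2 d : R, 0 < d & forall x, 0 < x -> x < d -> P x.
Proof.
rewrite near_withinE => /nbhs_ballP[d /= d0 H]; exists d => // x x0 xd.
by apply: H => //=; rewrite /ball /= sub0r normrN gtr0_norm.
Qed.

Lemma cvg_right0_scale (h : R -> R) (c l : R) : 0 < c -> h x @[x --> 0^'+] --> l ->
  h (c * x) @[x --> 0^'+] --> l.
Proof.
move=> c0 /cvgrPdist_lt H; apply/cvgrPdist_lt => e e0.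
have [d d0 Hd] := near_right0E (H e e0).
near=> x; apply: Hd; first by rewrite mulr_gt0//; near: x; exact: nbhs_right_gt.
rewrite mulrC -ltr_pdivlMr//; near: x; apply: nbhs_right_lt; exact: divr_gt0.
Unshelve. all: by end_near. Qed.

Lemma powRB1 (x r : R) : 0 < x -> x `^ (r - 1) = x `^ r / x.
Proof. by move=> x0; rewrite -(powR_inv1 (ltW x0)) -powRD// (gt_eqF x0) implybT. Qed.

Lemma ler_powRN (r x y : R) : r <= 0 -> 0 < x -> x <= y -> y `^ r <= x `^ r.
Proof.
move=> r0 x0 xy; have y0 := lt_le_trans x0 xy.
have E z : z `^ r = (z `^ (- r))^-1 by rewrite -powRN opprK.
rewrite !E lef_pV2 ?posrE ?powR_gt0//.
by apply: ge0_ler_powR; rewrite ?oppr_ge0// ?nnegrE ltW.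
Qed.

Definition exp_kernel (t : R) : R := if 0 < t then expR (- t) else 0.

(** The limit of the rescaled kernels, [K t ^ (rho - 1) exp(- t)]; the factor [exp(- t)] makes the
    total mass finite. *)
Definition power_kernel (K rho t : R) : R := if 0 < t then K * gamma_kernel rho t else 0.

Lemma power_kernel_moment (K rho : R) (n : nat) : 0 <= K -> 0 < rho -> rho <= 1 ->
  expect (power_kernel K rho) (fun t => expR (- t) ^+ n) =
    (K * Gamma rho * n.+1%:R `^ (- rho))%:E.
Proof.
move=> K0 r0 r1.
have r2 : rho <= 2 by lra.
rewrite -mulrA EFinM -(Gamma_scaled r0 r2) ?ltr0n//.
rewrite -ge0_integralZl//; last 2 first.
- apply/measurable_EFinP; apply: measurable_funM.
    by apply: measurable_funTS; exact: measurable_powR.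
  apply: measurable_funTS; apply: measurableT_comp => //; apply: measurableT_comp => //.
- by move=> t _; rewrite lee_fin mulr_ge0 ?powR_ge0 ?expR_ge0.
rewrite [RHS]integral_mkcond; apply: eq_integral => t _; rewrite patchE mem_setE in_itv /= andbT.
rewrite /power_kernel; case: ifP => t0; last by rewrite mul0r.
rewrite -EFinM /gamma_kernel -!mulrA; congr (_ * (_ * _))%:E.
by rewrite -exprS -expRM_natl mulrN.
Qed.

Lemma weight_power_kernel (K rho : R) : 0 <= K -> weight (power_kernel K rho).
Proof.
move=> K0; split.
  apply: measurable_fun_if => //; first by apply: measurable_fun_ltr.
    by apply: measurable_funM => //; apply: measurable_funTS; exact: measurable_gamma_kernel.
by move=> t; rewrite /power_kernel; case: ifP => // _; rewrite mulr_ge0// gamma_kernel_ge0.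
Qed.

Lemma kern_of_mass (k : R -> R) : weight k -> (forall t, t < 0 -> k t = 0) ->
  (expect k (cst 1%R) < +oo)%E -> kern k.
Proof.
move=> wk sk fin; split => //; apply/integrableP; split.
  by apply/measurable_EFinP; exact: wk.1.
apply: le_lt_trans fin; rewrite le_eqVlt; apply/orP; left; apply/eqP.
by apply: eq_integral => t _ /=; rewrite mulr1 ger0_norm// wk.2.
Qed.

Lemma kern_power_kernel (K rho : R) : 0 <= K -> 0 < rho -> rho <= 1 ->
  kern (power_kernel K rho).
Proof.
move=> K0 r0 r1; apply: kern_of_mass; first exact: weight_power_kernel.
  by move=> t t0; rewrite /power_kernel ltNge (ltW t0).
have := @power_kernel_moment _ _ 0 K0 r0 r1.
have -> : (fun t : R => expR (- t) ^+ 0) = cst 1 by apply/funext => t; rewrite expr0.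
by move=> ->; rewrite ltry.
Qed.

Lemma kern_exp_kernel : kern exp_kernel.
Proof.
have -> : exp_kernel = power_kernel 1 1; last exact: kern_power_kernel.
apply/funext => t; rewrite /exp_kernel /power_kernel /gamma_kernel.
by case: ifP => // t0; rewrite subrr powRr0 !mul1r.
Qed.

(** Substitution [t = x y]; the factor [exp(- t)] in the kernel shifts the moment index by one. *)
Lemma scaled_moment (g : R -> R) (rho x : R) (n : nat) : weight g -> 0 < x ->
  (forall s, 0 < s -> (expect g (fun y => expR (- (s * y))%R) < +oo)%E) ->
  expect (fun t => x `^ (rho - 1) * (g (x^-1 * t) * expR (- t))) (fun t => expR (- t) ^+ n) =
  (x `^ rho * Rexpect g (fun y => expR (- (n.+1%:R * x * y))))%:E.
Proof.
move=> wg x0 fin; have nx0 : 0 < n.+1%:R * x by rewrite mulr_gt0// ltr0n.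
rewrite EFinM RexpectK//; [|exact: weight_exp|exact: fin].
have wf : weight (fun y => g y * expR (- (n.+1%:R * x * y))) by apply: weightM => //; exact: weight_exp.
have xV0 : 0 < x^-1 by rewrite invr_gt0.
have := @ge0_integral_affine R x^-1 0 (fun y => (g y * expR (- (n.+1%:R * x * y)))%:E) xV0 (weight_emeas wf).
move=> /(_ (fun y => _ : (0 <= (g y * expR (- (n.+1%:R * x * y)))%:E)%E)) H.
rewrite /expect -H; last by move=> y; rewrite lee_fin wf.2.
rewrite muleA -EFinM -powRB1//.
rewrite -ge0_integralZl//; last 3 first.
- have := weight_emeas wf => /measurable_EFinP h; apply/measurable_EFinP.
  apply: (measurableT_comp h) => //; apply: measurable_funD => //.
- by move=> t _; rewrite lee_fin wf.2.
- by rewrite lee_fin powR_ge0.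
apply: eq_integral => t _; rewrite -EFinM addr0 -!mulrA; congr (_ * (_ * _))%:E.
rewrite -exprS -expRM_natl mulrN; congr (expR (- (_ * _))).
by rewrite mulrA mulfV ?mul1r// lt0r_neq0.
Qed.

(** The test function vanishes outside []a, b[], so comparing the kernels there is enough;
    monotonicity of [g] will provide such a comparison on each side of 1. *)
Lemma Rexpect_tent_le (k1 k2 : R -> R) (c1 c2 a b : R) : kern k1 -> kern k2 ->
  0 <= a -> a <= b ->
  (forall t, a < t -> t < b -> c1 * k1 t <= c2 * k2 t) ->
  c1 * Rexpect k1 (fun t => tent (expR (- b)) (expR (- a)) (expR (- t))) <=
  c2 * Rexpect k2 (fun t => tent (expR (- b)) (expR (- a)) (expR (- t))).
Proof.
move=> kk1 kk2 a0 ab le; set T := fun t : R => _.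
have b0 := le_trans a0 ab.
have mT : measurable_fun setT T.
  by apply: measurableT_comp; [exact: measurable_tent|exact: measurable_expN].
have T2 t : 0 <= t -> `|T t| <= 2.
  by move=> t0; rewrite ger0_norm ?tent_ge0// tent_le// expN01.
have i k : kern k -> mu.-integrable setT (EFin \o (fun t => k t * T t)).
  by move=> kk; exact: kern_integrable kk mT T2.
have iZ k c : kern k -> mu.-integrable setT (EFin \o (fun t => c * (k t * T t))).
  move=> kk.
  have -> : EFin \o (fun t => c * (k t * T t)) = (fun t => (c%:E * ((k t * T t)%R)%:E)%E).
    by apply/funext => t /=; rewrite -EFinM.
  apply: integrableZl => //; exact: i.
rewrite /Rexpect -!RintegralZl//; [|exact: i..].
apply: le_Rintegral => //; [exact: iZ..|move=> t _].
rewrite !mulrA.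
have [ta|at_] := leP t a.
  by rewrite /T tent_out ?mulr0// ?ler_expR ?lerN2//; right.
have [bt|tb] := leP b t.
  by rewrite /T tent_out ?mulr0// ?ler_expR ?lerN2//; left.
by rewrite ler_wpM2r ?tent_ge0// le.
Qed.

Lemma Rexpect_exp_tent_gt0 (a b : R) : 0 <= a -> a < b ->
  0 < Rexpect exp_kernel (fun t => tent (expR (- b)) (expR (- a)) (expR (- t))).
Proof.
move=> a0 ab; set c := expR (- b); set d := expR (- a); set T := fun t : R => _.
have c0 : 0 < c by exact: expR_gt0.
have cd : c < d by rewrite ltr_expR ltrN2.
have d1 : d <= 1 by have /andP[] := expN01 a0.
pose u := - ln ((c + 3 * d) / 4); pose v := - ln ((3 * c + d) / 4).
have uE : expR (- u) = (c + 3 * d) / 4 by rewrite opprK lnK// posrE; lra.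
have vE : expR (- v) = (3 * c + d) / 4 by rewrite opprK lnK// posrE; lra.
have uv : u < v by rewrite -ltrN2 -ltr_expR uE vE; lra.
have u0 : 0 < u by rewrite -ltrN2 -ltr_expR uE oppr0 expR0; lra.
have mT : measurable_fun setT T.
  by apply: measurableT_comp; [exact: measurable_tent|exact: measurable_expN].
have wT : weight T by split => // t; exact: tent_ge0.
have wk := kern_weight kern_exp_kernel.
have fin : (expect exp_kernel T < +oo)%E.
  have := @kern_integrable _ exp_kernel T 2 kern_exp_kernel mT => /(_ _)/integrableP[].
    move=> t t0; rewrite ger0_norm ?tent_ge0// tent_le//; last exact: expN01.
      by apply/andP; split; lra.
    by apply/andP; split; lra.
  move=> _; apply: le_lt_trans; apply: ge0_le_integral => //.
  - by move=> t _; rewrite lee_fin mulr_ge0// ?wk.2// tent_ge0.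
  - by apply/measurable_EFinP/measurable_funM => //; exact: wk.1.
  - by apply: measurableT_comp => //; apply/measurable_EFinP/measurable_funM => //; exact: wk.1.
  - by move=> t _; exact: lee_abs.
rewrite -lte_fin RexpectK//.
pose m := expR (- v) * ((d - c) / 2).
have m0 : 0 < m by rewrite mulr_gt0 ?expR_gt0//; lra.
apply: (@lt_le_trans _ _ (m * (v - u))%:E); first by rewrite lte_fin mulr_gt0// subr_gt0.
have -> : (m * (v - u))%:E = (\int[mu]_(t in `[u, v]) (cst m%:E t))%E.
  by rewrite integral_cst//= [X in (_ * X)%E](lebesgue_measure_itv `[u, v]) /= lte_fin uv -EFinD -EFinM.
apply: le_trans (_ : (\int[mu]_(t in `[u, v]) (exp_kernel t * T t)%:E <= _)%E).
  apply: ge0_le_integral => //.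
  - by move=> t _; rewrite lee_fin ltW.
  - by apply: measurable_funTS; apply/measurable_EFinP/measurable_funM => //; exact: wk.1.
  - move=> t /=; rewrite in_itv /= => /andP[ut tv]; rewrite lee_fin /m.
    have t0 : 0 < t by exact: lt_le_trans ut.
    rewrite /exp_kernel t0; apply: ler_pM; rewrite ?expR_ge0//; first by lra.
      by rewrite ler_expR lerN2.
    rewrite /T tent_mid//; first by rewrite -vE ler_expR lerN2.
    by rewrite -uE ler_expR lerN2.
apply: ge0_subset_integral => //.
- by apply/measurable_EFinP/measurable_funM => //; exact: wk.1.
- by move=> t _; rewrite lee_fin mulr_ge0// ?wk.2// tent_ge0.
Qed.

(** The kernels [x ^ (rho - 1) g(t / x) exp(- t)] have moments converging to those of
    [power_kernel], so their integrals against tents in [exp(- t)] converge too. For [t] in []a, 1[]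
    monotonicity gives [g(t / x) >= g(1 / x)], which bounds [x ^ (rho - 1) g(1 / x)] above by nearly
    [K a ^ (rho - 1)]; tents on [[1, b]] bound it below in the same way, and [a], [b] may be taken
    close to 1. *)
Lemma tauberian (g : R -> R) (rho A : R) : weight g -> (forall y, y < 1 -> g y = 0) ->
  (forall y z, 1 <= y -> y <= z -> g z <= g y) ->
  (forall s, 0 < s -> (expect g (fun y => expR (- (s * y))%R) < +oo)%E) ->
  0 < rho -> rho <= 1 -> 0 <= A ->
  x `^ rho * Rexpect g (fun y => expR (- (x * y))) @[x --> 0^'+] --> A ->
  y `^ (1 - rho) * g y @[y --> +oo] --> A / Gamma rho.
Proof.
move=> wg g1 gmon fin r0 r1 A0 lim.
have r2 : rho <= 2 by lra.
have G0 := Gamma_gt0 r0 r2.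
pose K := A / Gamma rho; have K0 : 0 <= K by rewrite divr_ge0// ltW.
pose k x t := x `^ (rho - 1) * (g (x^-1 * t) * expR (- t)).
have mom x n : 0 < x -> expect (k x) (fun t => expR (- t) ^+ n) =
    (x `^ rho * Rexpect g (fun y => expR (- (n.+1%:R * x * y))))%:E.
  by move=> x0; exact: scaled_moment.
have wk x : weight (k x).
  have h1 : weight (fun t => x `^ (rho - 1) * (g (x^-1 * t) * expR (- t))); last exact: h1.
  apply: weightM; first exact: (weight_cst (powR_ge0 _ _)).
  apply: weightM; last by split; [exact: measurable_expN|move=> ?; exact: expR_ge0].
  split; last by move=> t; exact: wg.2.
  by apply: (measurableT_comp wg.1).
have kk x : 0 < x -> kern (k x).
  move=> x0; apply: kern_of_mass => //.
    move=> t t0; rewrite /k g1 ?mul0r ?mulr0//.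
    by rewrite (lt_trans _ ltr01)// pmulr_rlt0// invr_gt0.
  have := mom x 0 x0.
  have -> : (fun t : R => expR (- t) ^+ 0) = cst 1 by apply/funext => t; rewrite expr0.
  by move=> ->; rewrite ltry.
have kk0 := kern_power_kernel K0 r0 r1.
have wexp n : weight (fun t : R => expR (- t) ^+ n).
  split; last by move=> t; rewrite exprn_ge0// expR_ge0.
  by apply: measurable_funX; exact: measurable_expN.
have H n : Rexpect (k x) (fun t => expR (- t) ^+ n) @[x --> 0^'+] -->
     Rexpect (power_kernel K rho) (fun t => expR (- t) ^+ n).
  rewrite Rexpect_fine power_kernel_moment//= divfK ?lt0r_neq0//.
  have n0 : 0 < n.+1%:R :> R by rewrite ltr0n.
  apply: cvg_trans (cvgM (cvg_right0_scale n0 lim) (cvg_cst (n.+1%:R `^ (- rho)))).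
  apply: near_eq_cvg; near=> x.
  have x0 : 0 < x by near: x; exact: nbhs_right_gt.
  rewrite /= [in RHS]Rexpect_fine mom//= powRM ?ltW//.
  have : n.+1%:R `^ (- rho) * n.+1%:R `^ rho = 1.
    by rewrite powRN mulVf// gt_eqF// powR_gt0.
  by move=> h; rewrite mulrC !mulrA h mul1r.
have tentlim a b : 0 <= a -> 0 <= b ->
    Rexpect (k x) (fun t => tent (expR (- b)) (expR (- a)) (expR (- t))) @[x --> 0^'+] -->
    Rexpect (power_kernel K rho) (fun t => tent (expR (- b)) (expR (- a)) (expR (- t))).
  by move=> a0 b0; apply: cvg_kern_tent => //; exact: expN01.
have up a e : 0 < a -> a < 1 -> 0 < e -> \forall x \near 0^'+,
    x `^ (rho - 1) * g x^-1 <= K * a `^ (rho - 1) + e.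
  move=> a0 a1 e0; have I0 := Rexpect_exp_tent_gt0 (ltW a0) a1; set I := Rexpect _ _ in I0.
  have eI : 0 < e * I by rewrite mulr_gt0.
  have := tentlim a 1 (ltW a0) ler01 => /cvgrPdist_le/(_ _ eI) near1.
  near=> x.
  have x0 : 0 < x by near: x; exact: nbhs_right_gt.
  (* With [x < a < t] the argument [t / x] stays beyond 1, where [g] is monotone. *)
  have xa : x < a by near: x; exact: nbhs_right_lt.
  have h : `|Rexpect (power_kernel K rho) (fun t => tent (expR (- 1)) (expR (- a)) (expR (- t))) -
    Rexpect (k x) (fun t => tent (expR (- 1)) (expR (- a)) (expR (- t)))| <= e * I.
    by near: x; exact: near1.
  have h1 := @Rexpect_tent_le exp_kernel (k x) (x `^ (rho - 1) * g x^-1) 1 a 1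
    kern_exp_kernel (kk x x0) (ltW a0) (ltW a1).
  have {}h1 := h1 ltac:(move=> t at_ t1; have t0 := lt_trans a0 at_;
    rewrite /exp_kernel t0 mul1r /k mulrA ler_wpM2r ?expR_ge0// ler_wpM2l ?powR_ge0// gmon//;
    [rewrite mulrC ler_pdivlMr// mul1r; lra|rewrite ger_pMr ?invr_gt0//; exact: ltW]).
  have h2 := @Rexpect_tent_le (power_kernel K rho) exp_kernel 1 (K * a `^ (rho - 1)) a 1
    kk0 kern_exp_kernel (ltW a0) (ltW a1).
  have {}h2 := h2 ltac:(move=> t at_ t1; have t0 := lt_trans a0 at_;
    rewrite /exp_kernel /power_kernel t0 mul1r /gamma_kernel mulrA ler_wpM2r ?expR_ge0// ler_wpM2l//;
    apply: ler_powRN; [lra|exact: a0|exact: ltW]).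
  rewrite -(ler_pM2r I0) mulrDl.
  by move: h1 h2 h; rewrite ler_norml -/I !mul1r => ? ? /andP[? ?]; lra.
have dn b e : 1 < b -> 0 < e -> \forall x \near 0^'+,
    K * b `^ (rho - 1) - e <= x `^ (rho - 1) * g x^-1.
  move=> b1 e0; have I0 := Rexpect_exp_tent_gt0 ler01 b1; set I := Rexpect _ _ in I0.
  have b0 : 0 < b by lra.
  have eI : 0 < e * I by rewrite mulr_gt0.
  have := tentlim 1 b ler01 (ltW b0) => /cvgrPdist_le/(_ _ eI) near1.
  near=> x.
  have x0 : 0 < x by near: x; exact: nbhs_right_gt.
  have x1 : x < 1 by near: x; exact: nbhs_right_lt.
  have h : `|Rexpect (power_kernel K rho) (fun t => tent (expR (- b)) (expR (- 1)) (expR (- t))) -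
    Rexpect (k x) (fun t => tent (expR (- b)) (expR (- 1)) (expR (- t)))| <= e * I.
    by near: x; exact: near1.
  have h1 := @Rexpect_tent_le (k x) exp_kernel 1 (x `^ (rho - 1) * g x^-1) 1 b
    (kk x x0) kern_exp_kernel ler01 (ltW b1).
  have {}h1 := h1 ltac:(move=> t at_ t1; have t0 := lt_trans ltr01 at_;
    rewrite /exp_kernel t0 mul1r /k mulrA ler_wpM2r ?expR_ge0// ler_wpM2l ?powR_ge0// gmon//;
    [rewrite invf_ge1//; exact: ltW|rewrite ler_pMr ?invr_gt0//; exact: ltW]).
  have h2 := @Rexpect_tent_le exp_kernel (power_kernel K rho) (K * b `^ (rho - 1)) 1 1 b
    kern_exp_kernel kk0 ler01 (ltW b1).
  have {}h2 := h2 ltac:(move=> t at_ t1; have t0 := lt_trans ltr01 at_;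
    rewrite /exp_kernel /power_kernel t0 mul1r /gamma_kernel mulrA ler_wpM2r ?expR_ge0// ler_wpM2l//;
    apply: ler_powRN; [lra|exact: t0|exact: ltW]).
  rewrite -(ler_pM2r I0) mulrBl.
  by move: h1 h2 h; rewrite ler_norml -/I !mul1r => ? ? /andP[? ?]; lra.
have cont1 : K * a `^ (rho - 1) @[a --> (1 : R)] --> K.
  have -> : nbhs K = nbhs (K * (1 : R) `^ (rho - 1)) by rewrite powR1 mulr1.
  apply: cvgM; first exact: cvg_cst.
  exact: is_derive_continuous (is_derive1_powR (rho - 1) ltr01).
apply/cvgrPdist_le => e e0.
have e2 : 0 < e / 2 by lra.
have := cont1 => /cvgrPdist_le/(_ _ e2)/nbhs_ballP[r /= r0' Hr].
pose s := Num.min (r / 2) 2^-1.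
have s0 : 0 < s by rewrite lt_min; apply/andP; split; lra.
have sr : s <= r / 2 by rewrite ge_min lexx.
have s2 : s <= 2^-1 by rewrite ge_min lexx orbT.
have Hlo : K * (1 - s) `^ (rho - 1) <= K + e / 2.
  have := Hr (1 - s); rewrite /ball /= opprB addrCA subrr addr0 gtr0_norm// => /(_ ltac:(lra)).
  by rewrite ler_norml => /andP[? ?]; lra.
have Hhi : K - e / 2 <= K * (1 + s) `^ (rho - 1).
  have := Hr (1 + s); rewrite /ball /= opprD addNKr normrN gtr0_norm// => /(_ ltac:(lra)).
  by rewrite ler_norml => /andP[? ?]; lra.
have [d1 d10 Hd1] := near_right0E (up (1 - s) (e / 2) ltac:(lra) ltac:(lra) e2).
have [d2 d20 Hd2] := near_right0E (dn (1 + s) (e / 2) ltac:(lra) e2).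
near=> y.
have y0 : 0 < y by near: y; exact: nbhs_pinfty_gt.
have y1 : y^-1 < d1.
  rewrite invf_plt ?posrE//; near: y; apply: nbhs_pinfty_gt; exact: num_real.
have y2 : y^-1 < d2.
  rewrite invf_plt ?posrE//; near: y; apply: nbhs_pinfty_gt; exact: num_real.
have yV0 : 0 < y^-1 by rewrite invr_gt0.
have := Hd1 _ yV0 y1; have := Hd2 _ yV0 y2; rewrite invrK.
have -> : y^-1 `^ (rho - 1) = y `^ (1 - rho).
  by rewrite -powR_inv1 ?(ltW y0)// -powRrM; congr (_ `^ _); ring.
rewrite -/K ler_norml; move: (y `^ _ * g y) => z h1 h2; apply/andP; split; lra.
Unshelve. all: by end_near. Qed.

End tauberian.

(** * Necessity of [theta <= 1], power decay and the mean *)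

Section consequences.
Context {R : realType}.
Notation mu := (@lebesgue_measure R).
Context (N : nat) (p : nat -> R).
Context (p0 : forall j : nat, (1 <= j <= N)%N -> 0 <= p j).
Context (p1 : \sum_(1 <= j < N.+1) p j = 1).
Local Notation Q := (Qpoly N p).
Local Notation q := (\sum_(1 <= j < N.+1) p j * j%:R).
Local Notation qmix := (qmix N p).
Context (theta : R) (theta0 : 0 < theta) (f : R -> R).
Context (sol : prob_sol N p (theta / q) f).

Let df := sol_density sol.
Let m1 := sol_mass sol.
Let dq := qmix_density p0 df.
Let q0 : 0 < q.
Proof. by rewrite (lt_le_trans ltr01)//; exact: mean_degree_ge1. Qed.
Let beta0 : 0 <= theta / q.
Proof. by rewrite divr_ge0// ltW. Qed.
Local Notation C := (expR (theta * gammaE R) / kappa_of Q).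

Lemma limit_const_gt0 : 0 < C.
Proof. by rewrite divr_gt0 ?expR_gt0. Qed.

Lemma prob_sol_theta_le1 : theta <= 1.
Proof.
rewrite leNgt; apply/negP => t1.
have := laplace_asymptotics p0 p1 theta0 sol; move: C limit_const_gt0 => C C0.
move=> /cvgrPdist_le/(_ _ ltr01) near1.
have t10 : 0 < theta - 1 by lra.
(* Once [x ^ (theta - 1)] is below this value, [(C + 2) * x ^ theta < x / 2], which contradicts
   [x / 2 <= 1 - F(x) <= (C + 1) * x ^ theta]. *)
have e0 : 0 < (2 * (C + 2))^-1 by rewrite invr_gt0; lra.
have := powR_cvg0 t10 => /cvgrPdist_lt/(_ _ e0) near2.
have [d1 d10 H1] := near_right0E near1; have [d2 d20 H2] := near_right0E near2.
pose x := Num.min 1 (Num.min d1 d2) / 2.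
have x0 : 0 < x by rewrite divr_gt0// !lt_min ltr01 d10.
have [xd1 xd2 x1] : [/\ x < d1, x < d2 & x < 1].
  have : Num.min 1 (Num.min d1 d2) <= 1 by rewrite ge_min lexx.
  have : Num.min 1 (Num.min d1 d2) <= d1 by rewrite !ge_min lexx orbT.
  have : Num.min 1 (Num.min d1 d2) <= d2 by rewrite !ge_min lexx !orbT.
  by rewrite /x; move: (Num.min _ _) => m *; split; lra.
have h1 := H1 x x0 xd1; have := H2 x x0 xd2.
rewrite sub0r normrN ger0_norm ?powR_ge0// powRB1// => h2.
have w0 : 0 < x `^ theta by exact: powR_gt0.
have h3 : (C + 2) * x `^ theta < x / 2.
  move: h2; rewrite ltr_pdivrMr// mulrC -ltr_pdivrMr; last by rewrite invr_gt0; lra.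
  by rewrite invrK; lra.
have h4 : 1 - laplace f x <= (C + 1) * x `^ theta.
  by move: h1; rewrite powRN ler_norml => /andP[h _]; rewrite -ler_pdivrMr//; lra.
have h5 : x / 2 <= 1 - laplace f x.
  have le := laplace_le df m1 (ltW x0).
  have e1 : expR (- x) <= (1 + x)^-1.
    by rewrite expRN lef_pV2 ?posrE ?expR_gt0//; [exact: expR_ge1Dx|lra].
  have e2 : (1 + x)^-1 <= 1 - x / 2.
    by rewrite -div1r ler_pdivrMr; [nra|lra].
  by lra.
by lra.
Qed.

(** In the Laplace equation [1 - Q(F)] factors as [Q1(F) (1 - F)], and [Q1(F)] tends to [q], which
    cancels the [q] in [beta]. *)
Lemma laplace1_asymptotics :
  x `^ (1 - theta) * laplace1 f x @[x --> 0^'+] --> theta * C.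
Proof.
have [Q1 [_ [E1 _ Q11 _]]] := Qpoly_factor p0 p1.
have l1 : expR (- x) @[x --> (0 : R)^'+] --> (1 : R).
  apply: cvg_at_right_filter; have -> : (1 : R) = expR (- 0) by rewrite oppr0 expR0.
  by apply: (@cvg_comp _ _ _ (fun x : R => - x) expR); [apply: cvgN; exact: cvg_id|exact: continuous_expR].
have l2 : Q1.[laplace f x] @[x --> 0^'+] --> q.
  rewrite -Q11.
  by apply: (@cvg_comp _ _ _ (laplace f) (horner Q1)); [exact: laplace_cvg1|exact: continuous_horner].
have l3 := laplace_asymptotics p0 p1 theta0 sol.
have l4 : theta / q * expR (- x) * Q1.[laplace f x] * ((1 - laplace f x) * x `^ (- theta))
    @[x --> 0^'+] --> theta / q * 1 * q * C.
  by do 3! [apply: cvgM => //]; exact: cvg_cst.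
have E4 : theta / q * 1 * q * C = theta * C by move: C => c; field; rewrite gt_eqF.
rewrite E4 in l4; apply: cvg_trans l4; apply: near_eq_cvg; near=> x.
have x0 : 0 < x by near: x; exact: nbhs_right_gt.
have E2 : x `^ (- theta) = x `^ (1 - theta) / x.
  by rewrite -powRB1//; congr (_ `^ _); ring.
have := laplace_equation p0 p1 beta0 sol x0; rewrite E1 => E3.
rewrite /= E2; have -> : laplace1 f x = x * laplace1 f x / x by field; rewrite gt_eqF.
by rewrite E3; ring.
Unshelve. all: by end_near. Qed.

Lemma sol_scaled_le (y z : R) : 1 <= y -> y <= z -> z * f z <= y * f y.
Proof.
move=> y1 yz; rewrite !(sol_eq sol) ?(le_trans y1)//.
by rewrite ler_wpM2l// le_tail// lerB.
Qed.

Lemma sol_scaled_cvg0 : y * f y @[y --> +oo] --> (0 : R).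
Proof.
apply/cvgrPdist_le => e e0.
have b0 : 0 < theta / q by rewrite divr_gt0.
have e1 : 0 < e / (theta / q) by rewrite divr_gt0.
have [A A1 HA] := tail_small dq e1.
near=> y.
have yA : A + 1 < y by near: y; apply: nbhs_pinfty_gt; exact: num_real.
rewrite sub0r normrN (sol_eq sol); last by lra.
rewrite (ger0_norm (mulr_ge0 beta0 (tail_ge0 _ dq))).
by rewrite mulrC -ler_pdivlMr// ltW// HA//; lra.
Unshelve. all: by end_near. Qed.

(** The Tauberian theorem is applied to [y f(y)], which is monotone and has Laplace transform
    [laplace1 f], with exponent [rho = 1 - theta]. *)
Lemma sol_power_decay : theta < 1 ->
  y `^ (1 + theta) * f y @[y --> +oo] -->
    theta * expR (theta * gammaE R) / (kappa_of Q * Gamma (1 - theta)).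
Proof.
move=> t1; pose g y := f y * `|y|.
have gE y : 1 <= y -> g y = y * f y by move=> y1; rewrite /g ger0_norm 1?mulrC//; lra.
have wg : weight g by apply: weightM; [exact: density_weight|exact: weight_norm].
have LE x : Rexpect g (fun y => expR (- (x * y))) = laplace1 f x.
  by apply: eq_Rintegral => y _; rewrite /g mulrA.
have r0 : 0 < 1 - theta by lra.
have r1 : 1 - theta <= 1 by rewrite gerBl ltW.
have := @tauberian R g (1 - theta) (theta * C) wg.
have -> : theta * C / Gamma (1 - theta) =
   theta * expR (theta * gammaE R) / (kappa_of Q * Gamma (1 - theta)).
  by rewrite invfM; ring.
move=> H; have {}H := H ltac:(by move=> y y1; rewrite /g (density_supp df y1) mul0r).
have {}H := H ltac:(by move=> y z y1 yz; rewrite !gE ?(le_trans y1)//; exact: sol_scaled_le).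
have {}H := H ltac:(move=> s s0; have := laplace1K df s0; rewrite /expect;
  under [X in _ = X -> _]eq_integral do rewrite mulrA; move=> <-; exact: ltry).
have {}H := H r0 r1 ltac:(by rewrite mulr_ge0 ?(ltW theta0)// ltW// limit_const_gt0).
have {}H := H ltac:(under eq_fun do rewrite LE; exact: laplace1_asymptotics).
apply: cvg_trans H; apply: near_eq_cvg; near=> y.
have y1 : 1 < y by near: y; apply: nbhs_pinfty_gt; exact: num_real.
rewrite gE ?(ltW y1)//.
have -> : 1 + theta = 2 - (1 - theta) by ring.
have -> : 1 - (1 - theta) = 1 + theta - 1 by ring.
have -> : 2 - (1 - theta) = 1 + theta by ring.
rewrite powRB1; last by lra.
by field; rewrite gt_eqF//; lra.
Unshelve. all: by end_near. Qed.

(** For [theta = 1] the power in [laplace1_asymptotics] disappears, and [- F'(x)] increases to the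
    mean as [x] decreases to 0 along [1 / (n + 1)]. *)
Lemma sol_mean : theta = 1 -> expect f (fun y => `|y|) = (expR (gammaE R) / kappa_of Q)%:E.
Proof.
move=> t1.
pose g (n : nat) (y : R) : \bar R := (f y * (`|y| * expR (- (n.+1%:R^-1 * y))))%:E.
have mg n : measurable_fun setT (g n).
  apply/measurable_EFinP/measurable_funM; first exact: density_meas.
  exact: (weight_exp1 _).1.
have g0 n y : setT y -> (0 <= g n y)%E.
  by move=> _; rewrite lee_fin mulr_ge0 ?(density_ge0 df)// mulr_ge0 ?expR_ge0.
have gmon y : setT y -> {homo g^~ y : n m / (n <= m)%N >-> (n <= m)%E}.
  move=> _ n m nm; rewrite lee_fin; have [y1|y1] := ltP y 1.
    by rewrite (density_supp df y1) !mul0r.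
  rewrite ler_wpM2l ?(density_ge0 df)// ler_wpM2l// ler_expR lerN2 ler_wpM2r//; first by lra.
  by rewrite lef_pV2 ?posrE ?ltr0n// ler_nat.
have glim y : limn (g^~ y) = (f y * `|y|)%:E.
  apply/cvg_lim => //; apply: cvg_EFin; first by near=> n.
  rewrite -[X in _ --> X]mulr1 -mulrA; apply: cvgM; first exact: cvg_cst.
  apply: cvgM; first exact: cvg_cst.
  rewrite -[X in _ --> X]expR0; apply: (@cvg_comp _ _ _ (fun n : nat => - (n.+1%:R^-1 * y)) expR); last exact: continuous_expR.
  have h : - (n.+1%:R^-1 * y) @[n --> \oo] --> - (0 * y).
    by apply: cvgN; apply: cvgM; [exact: cvg_harmonic|exact: cvg_cst].
  by move: h; rewrite mul0r oppr0.
have := @cvg_monotone_convergence _ _ R mu setT measurableT g mg g0 gmon.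
have -> : (\int[mu]_y limn (g^~ y))%E = expect f (fun y => `|y|).
  by apply: eq_integral => y _; rewrite glim.
have gE n : (\int[mu]_y g n y)%E = (laplace1 f n.+1%:R^-1)%:E.
  by rewrite laplace1K// invr_gt0 ltr0n.
under eq_fun do rewrite gE.
move=> H; apply: (cvg_unique _ H) => //.
apply: cvg_EFin; first by near=> n.
have := laplace1_asymptotics; rewrite t1 !mul1r subrr.
under eq_fun do rewrite powRr0 mul1r.
move=> /cvg_at_rightP; apply; split; first by move=> n; rewrite invr_gt0 ltr0n.
exact: cvg_harmonic.
Unshelve. all: by end_near. Qed.

End consequences.

(** * Exponential moments *)

Section clipped_exponential.
Context {R : realType}.
Notation mu := (@lebesgue_measure R).
Implicit Types (s A t y : R).

(** The cap at [A] makes every exponential moment finite from the outset; the task is then a bound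
    uniform in [A]. *)
Definition expclip A s y : R := expR (s * Num.min `|y| A).

Lemma expclip_ge1 A s y : 0 <= A -> 0 <= s -> 1 <= expclip A s y.
Proof. by move=> A0 s0; rewrite -[leLHS]expR0 ler_expR mulr_ge0// le_min normr_ge0. Qed.

Lemma expclip_le A s y : 0 <= s -> expclip A s y <= expR (s * A).
Proof. by move=> s0; rewrite ler_expR ler_wpM2l// ge_min lexx orbT. Qed.

Lemma measurable_normmin A : measurable_fun setT (fun y : R => Num.min `|y| A).
Proof. by apply: measurable_minr. Qed.

Lemma weight_expclip A s : weight (expclip A s).
Proof.
split; last by move=> y; exact: expR_ge0.
apply: measurableT_comp => //; apply: measurable_funM => //; exact: measurable_normmin.
Qed.

Lemma weight_expclipB1 A s : 0 <= A -> 0 <= s -> weight (fun y => expclip A s y - 1).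
Proof.
move=> A0 s0; split; last by move=> y; rewrite subr_ge0 expclip_ge1.
by apply: measurable_funB => //; exact: (weight_expclip A s).1.
Qed.

(** The tested equation multiplies by [y] and not by [min(y, A)], so the cap leaves the overshoot
    [(y - A)^+] on both of its sides. *)
Definition excess A y : R := Num.max 0 (y - A).

Lemma weight_excess A : weight (excess A).
Proof.
split; last by move=> y; rewrite /excess le_max lexx.
by apply: measurable_maxr => //; apply: measurable_funB.
Qed.

Lemma excessE A y : A <= y -> excess A y = y - A.
Proof. by move=> Ay; rewrite /excess max_r// subr_ge0. Qed.

Lemma excess0 A y : y <= A -> excess A y = 0.
Proof. by move=> Ay; rewrite /excess max_l// subr_le0. Qed.

Lemma excess_le A y : 0 <= A -> 0 <= y -> excess A y <= y.
Proof. by move=> A0 y0; rewrite /excess ge_max y0 gerBl. Qed.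

(** [expclip A s y + s exp(s A) (y - A)^+] continues [exp(s y)] beyond [A] along its tangent, so the
    excess enters additively while the capped exponentials multiply. The cases by position relative
    to [A] rest on [1 + x <= exp x]; the right side has the three-product shape of
    [expect_conv_le]. *)
Lemma expclip_cross A s a b : 0 <= s -> 0 <= A -> 0 <= a -> 0 <= b ->
  (expclip A s (a + b) - 1) + s * expR (s * A) * excess A (a + b) <=
  ((expclip A s a - 1) + s * expR (s * A) * excess A a) * 1 +
  1 * ((expclip A s b - 1) + s * expR (s * A) * excess A b) +
  (expclip A s a - 1) * (expclip A s b - 1).
Proof.
move=> s0 A0 a0 b0.
suff : expclip A s (a + b) + s * expR (s * A) * excess A (a + b) <=
  expclip A s a * expclip A s b + s * expR (s * A) * (excess A a + excess A b).
  by move: (expR _) (expclip A s (a + b)) (expclip A s a) (expclip A s b) => *; nra.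
rewrite /expclip !ger0_norm ?addr_ge0//.
have ge1 (x : R) : 1 + x <= expR x by exact: expR_ge1Dx.
have E0 : 0 < expR (s * A) by exact: expR_gt0.
have [abA|Aab] := leP (a + b) A.
  have [aA bA] : a <= A /\ b <= A by split; lra.
  rewrite !excess0// addr0 !mulr0 !addr0 !min_l//.
  by rewrite mulrDr expRD.
rewrite (excessE (ltW Aab)).
have [aA|Aa] := leP a A; have [bA|Ab] := leP b A.
- rewrite !excess0// addr0 mulr0 addr0 -expRD.
  have -> : s * a + s * b = s * A + s * (a + b - A) by ring.
  rewrite expRD; have := ge1 (s * (a + b - A)).
  by move: (expR (s * A)) (expR (s * (a + b - A))) E0 => E F ? ?; nra.
- rewrite (excess0 aA) (excessE (ltW Ab)) add0r.
  have := ge1 (s * a); move: (expR (s * A)) (expR (s * a)) E0 => E F ? ?; nra.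
- rewrite (excess0 bA) (excessE (ltW Aa)) addr0.
  have := ge1 (s * b); move: (expR (s * A)) (expR (s * b)) E0 => E F ? ?; nra.
- rewrite (excessE (ltW Aa)) (excessE (ltW Ab)).
  have := ge1 (s * A); move: (expR (s * A)) E0 => E ? ?; nra.
Qed.

Lemma integral_exp_itv s a b : a < b ->
  (\int[mu]_(y in `[a, b]) (s * expR (s * y))%:E)%E = (expR (s * b) - expR (s * a))%:E.
Proof.
move=> ab.
have dE (z : R) : is_derive z 1 (fun y : R => expR (s * y)) (s * expR (s * z)).
  have := is_derive_expN (- s) z; rewrite !mulNr !opprK.
  by congr is_derive; apply/funext => y; rewrite mulNr opprK.
have dcont : continuous (fun y : R => expR (s * y)).
  by move=> z; exact: is_derive_continuous (dE z).
rewrite (@continuous_FTC2 _ (fun y => s * expR (s * y)) (fun y => expR (s * y)))//.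
- by apply: continuous_subspaceT => z; apply: cvgM; [exact: cvg_cst|exact: dcont].
- split.
  + by move=> z _; have [] := dE z.
  + exact/cvg_at_right_filter/dcont.
  + exact/cvg_at_left_filter/dcont.
- by move=> z _; rewrite derive1E; have [_ ->] := dE z.
Qed.

(** The function [W] that belongs to [w(y) = s * expclip A s y]; beyond [A] the integrand is
    constant, which produces the excess term. *)
Definition expclip_primitive A s t : R :=
  expR (s * Num.min (`|t| + 1) A) - expR s + s * expR (s * A) * excess A (t + 1).

Lemma expclip_integral A s t : 0 <= s -> 1 < A -> 1 <= t ->
  (expclip_primitive A s t)%:E = (\int[mu]_(y in `[1%R, (t + 1)%R]) (s * expclip A s y)%:E)%E.
Proof.
move=> s0 A1 t1; rewrite /expclip_primitive (ger0_norm (_ : 0 <= t)); last by lra.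
have [tA|At] := leP (t + 1) A.
  have t1' : 1 < t + 1 by lra.
  rewrite excess0// mulr0 addr0 -{2}(mulr1 s) -(integral_exp_itv s t1').
  apply: eq_integral => y; rewrite inE /= in_itv /= => /andP[y1 yt].
  by rewrite /expclip ger0_norm ?min_l//; lra.
rewrite (excessE (ltW At)) EFinD -{2}(mulr1 s) -(integral_exp_itv s A1).
rewrite (@itv_bndbnd_setU _ R (BLeft 1) (BRight A) (BRight (t + 1))); last 2 first.
- by rewrite bnd_simp ltW.
- by rewrite bnd_simp ltW.
rewrite ge0_integral_setU//; last 3 first.
- apply: measurable_funTS; apply/measurable_EFinP/measurable_funM => //.
  exact: (weight_expclip A s).1.
- by move=> y _; rewrite lee_fin mulr_ge0// expR_ge0.
- apply/disj_setPS => y [/=]; rewrite !in_itv /= => /andP[_ yA] /andP[].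
  by rewrite ltNge yA.
congr (_ + _)%E.
  apply: eq_integral => y; rewrite inE /= in_itv /= => /andP[y1 yA].
  by rewrite /expclip ger0_norm ?min_l//; lra.
transitivity (\int[mu]_(y in `]A, (t + 1)%R]) (cst (s * expR (s * A))%:E y))%E.
  by rewrite integral_cst//= lebesgue_measure_itv /= lte_fin At -EFinB -EFinM.
apply: eq_integral => y; rewrite inE /= in_itv /= => /andP[Ay yt].
by rewrite /expclip ger0_norm ?min_r//; [exact: ltW|lra].
Qed.

(** The shift by one multiplies the exponential part by [exp s] but leaves the coefficient of the
    excess unchanged, which is what lets the overshoot cancel in [moment_ode]. *)
Lemma expclip_primitive_le A s t : 0 <= s -> 1 < A -> 1 <= t ->
  expclip_primitive A s t <= ((expclip A s t - 1) + s * expR (s * A) * excess A t) +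
    (expR s - 1) * (expclip A s t - 1).
Proof.
move=> s0 A1 t1; rewrite /expclip_primitive /expclip (ger0_norm (_ : 0 <= t)); last by lra.
have ge1 (x : R) : 1 + x <= expR x by exact: expR_ge1Dx.
have E0 : 0 < expR (s * A) by exact: expR_gt0.
have [tA|At] := leP (t + 1) A.
  rewrite !excess0//; last by lra.
  rewrite (min_l (_ : t <= A)); last by lra.
  by rewrite mulrDr mulr1 expRD; lra.
rewrite (excessE (ltW At)).
have [tA|At'] := leP t A.
  rewrite excess0// mulr0 addr0.
  have E1 : expR (s * t) * expR s = expR (s * A) * expR (s * (t + 1 - A)).
    by rewrite -!expRD; congr expR; ring.
  have := ge1 (s * (t + 1 - A)); move: E1 E0.
  move: (expR (s * A)) (expR (s * t)) (expR s) (expR (s * (t + 1 - A))) => E F G H E1 ? ?; nra.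
rewrite (excessE (ltW At')).
have := ge1 s; move: (expR (s * A)) (expR s) E0 => E F ? ?; nra.
Qed.

Lemma weight_expclip_primitive A s : 0 <= s -> 1 <= A -> weight (expclip_primitive A s).
Proof.
move=> s0 A1; apply: weightD; last first.
  apply: weightM; first by apply: weight_cst; rewrite mulr_ge0// expR_ge0.
  have := weight_shift 1 (weight_excess A); exact.
split; last first.
  move=> y; rewrite subr_ge0 ler_expR -[leLHS]mulr1 ler_wpM2l// le_min A1 andbT.
  by rewrite lerDr.
apply: measurable_funB => //; apply: measurableT_comp => //; apply: measurable_funM => //.
by apply: measurable_minr => //; apply: measurable_funD.
Qed.

Context (N : nat) (p : nat -> R).
Context (p0 : forall j : nat, (1 <= j <= N)%N -> 0 <= p j).
Context (p1 : \sum_(1 <= j < N.+1) p j = 1).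
Local Notation Q := (Qpoly N p).
Local Notation q := (\sum_(1 <= j < N.+1) p j * j%:R).
Local Notation qmix := (qmix N p).
Context (f : R -> R) (sol : prob_sol N p (1 / q) f).
Context (mean_fin : (expect f (fun y : R => `|y|%R) < +oo)%E).

Let df := sol_density sol.
Let m1 := sol_mass sol.
Let wf := density_weight df.
Let dq := qmix_density p0 df.
Let wq := density_weight dq.
Let q0 : 0 < q.
Proof. by rewrite (lt_le_trans ltr01)//; exact: mean_degree_ge1. Qed.
Let b0 : 0 <= 1 / q.
Proof. by rewrite divr_ge0// ltW. Qed.

Definition moment A s : R := Rexpect f (fun y => expclip A s y - 1).
Definition moment1 A s : R := Rexpect f (fun y => Num.min `|y| A * expclip A s y).
Definition overshoot A : R := Rexpect f (excess A).

Lemma momentK A s : 0 <= A -> 0 <= s ->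
  (moment A s)%:E = expect f (fun y => expclip A s y - 1).
Proof.
move=> A0 s0; apply: RexpectK => //; first exact: weight_expclipB1.
apply: (@expect_bounded_fin _ _ _ (expR (s * A) - 1)) => //; first exact: weight_expclipB1.
by move=> y _; rewrite lerD2r expclip_le.
Qed.

Lemma weight_moment1 A s : 0 <= A -> weight (fun y => Num.min `|y| A * expclip A s y).
Proof.
move=> A0; apply: weightM; last exact: weight_expclip.
by split; [exact: measurable_normmin|move=> y; rewrite le_min normr_ge0].
Qed.

Lemma moment1K A s : 0 <= A -> 0 <= s ->
  (moment1 A s)%:E = expect f (fun y => Num.min `|y| A * expclip A s y).
Proof.
move=> A0 s0; apply: RexpectK => //; first exact: weight_moment1.
apply: (@expect_bounded_fin _ _ _ (A * expR (s * A))) => //; first exact: weight_moment1.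
move=> y _; apply: ler_pM; rewrite ?expR_ge0 ?expclip_le//.
  by rewrite le_min normr_ge0.
by rewrite ge_min lexx orbT.
Qed.

Lemma overshootK A : 0 <= A -> (overshoot A)%:E = expect f (excess A).
Proof.
move=> A0; apply: RexpectK => //; first exact: weight_excess.
apply: le_lt_trans mean_fin; apply: le_expect => //.
- exact: weight_excess.
- move=> y y1; rewrite ger0_norm; last by lra.
  by apply: excess_le => //; lra.
Qed.

Lemma moment_ge0 A s : 0 <= A -> 0 <= s -> 0 <= moment A s.
Proof.
by move=> A0 s0; rewrite -lee_fin momentK// expect_ge0//; exact: weight_expclipB1.
Qed.

Lemma moment_derive A s : 0 < A -> 0 < s -> is_derive s 1 (moment A) (moment1 A s).
Proof.
move=> A0 s0.
apply: (@expect_derive _ f (fun s y => expclip A s y - 1) (fun s y => Num.min `|y| A * expclip A s y)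
  0 (2 * s) s ((A + 1) * expR (2 * s * A))) => //.
- lra.
- by move=> x x0 _; exact: (weight_expclipB1 (ltW A0) (ltW x0)).1.
- move=> x y x0 xs _; rewrite ger0_norm; last exact: (weight_expclipB1 (ltW A0) (ltW x0)).2.
  have := expclip_le A y (ltW x0).
  have : expR (x * A) <= expR (2 * s * A) by rewrite ler_expR ler_wpM2r// ltW.
  have := expR_gt0 (2 * s * A).
  by move: (expR _) (expR _) (expclip _ _ _) => *; nra.
- move=> x y x0 xs _.
  have h : is_derive x 1 (fun z : R => expR (z * Num.min `|y| A)) (Num.min `|y| A * expclip A x y).
    have := is_derive_expN (- Num.min `|y| A) x; rewrite !mulNr !opprK.
    rewrite /expclip (mulrC x); congr is_derive; apply/funext => z.
    by rewrite mulNr opprK mulrC.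
  by have := is_deriveB h (is_derive_cst (1 : R) x 1); rewrite subr0.
- move=> x y x0 xs _; rewrite ger0_norm; last exact: (weight_moment1 x (ltW A0)).2.
  have m0 : 0 <= Num.min `|y| A by rewrite le_min normr_ge0 ltW.
  apply: ler_pM => //; first exact: expR_ge0.
    by rewrite (@le_trans _ _ A)// ?ge_min ?lexx ?orbT// lerDl.
  apply: le_trans (expclip_le A y (ltW x0)) _.
  by rewrite ler_expR ler_wpM2r// ltW.
Qed.

Let scaled_overshoot A s : R := s * expR (s * A) * overshoot A.

Lemma expect_cross_weight A s : 0 <= A -> 0 <= s ->
  weight (fun y => (expclip A s y - 1) + s * expR (s * A) * excess A y).
Proof.
move=> A0 s0; apply: weightD; first exact: weight_expclipB1.
apply: weightM; last exact: weight_excess.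
by apply: weight_cst; rewrite mulr_ge0// expR_ge0.
Qed.

Lemma convpow_expclip_le j A s : 0 <= A -> 0 <= s ->
  (expect (convpow f j) (fun y => expclip A s y - 1)%R <= ((1 + moment A s) ^+ j.+1 - 1)%:E)%E.
Proof.
move=> A0 s0; elim: j => [|j IH].
  by rewrite expr1 addrC addKr momentK.
have w := weight_expclipB1 A0 s0.
have w1 : weight (cst (1 : R)) by exact: weight_cst.
rewrite -[convpow f j.+1]/(Defs.conv f (convpow f j)).
have dc := convpow_density j df.
have D0 := moment_ge0 A0 s0.
apply: le_trans (@expect_conv_le _ f (convpow f j) (fun y => expclip A s y - 1)
  (fun y => expclip A s y - 1) (cst 1) (cst 1) (fun y => expclip A s y - 1)
  (fun y => expclip A s y - 1) (fun y => expclip A s y - 1) df dc w w w1 w1 w w w _) _.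
  move=> x z x1 z1 /=.
  suff : expclip A s (x + z) <= expclip A s x * expclip A s z by lra.
  rewrite /expclip -expRD ler_expR -mulrDr ler_wpM2l//.
  rewrite !ger0_norm; [|lra..].
  case: (leP x A); case: (leP z A); case: (leP (x + z) A) => *; lra.
rewrite m1 convpow_mass// mule1 mul1e -momentK//.
apply: (@le_trans _ _ ((moment A s)%:E + ((1 + moment A s) ^+ j.+1 - 1)%:E +
   (moment A s)%:E * ((1 + moment A s) ^+ j.+1 - 1)%:E)%E).
  apply: leeD; first by apply: leeD.
  by apply: lee_wpmul2l.
by rewrite -EFinM -!EFinD lee_fin (exprS _ j.+1); lra.
Qed.

(** Iterating [expclip_cross], each of the [j + 1] summands contributes one overshoot, while the
    capped exponentials multiply. *)
Lemma convpow_cross_le j A s : 0 <= A -> 0 <= s ->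
  (expect (convpow f j) (fun y => (expclip A s y - 1) + s * expR (s * A) * excess A y)%R <=
    (j.+1%:R * scaled_overshoot A s + ((1 + moment A s) ^+ j.+1 - 1))%:E)%E.
Proof.
move=> A0 s0.
have w := weight_expclipB1 A0 s0.
have wc := expect_cross_weight A0 s0.
have w1 : weight (cst (1 : R)) by exact: weight_cst.
have c0 : 0 <= s * expR (s * A) by rewrite mulr_ge0// expR_ge0.
have E1 : expect f (fun y => (expclip A s y - 1) + s * expR (s * A) * excess A y) =
    (scaled_overshoot A s + moment A s)%:E.
  rewrite expectD//; last by apply: weightM; [exact: weight_cst|exact: weight_excess].
  rewrite expectZ//; last exact: weight_excess.
  by rewrite -overshootK// -momentK// -EFinM -EFinD addrC.
elim: j => [|j IH].
  by rewrite E1 lee_fin mul1r expr1; lra.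
rewrite -[convpow f j.+1]/(Defs.conv f (convpow f j)).
have dc := convpow_density j df.
have D0 := moment_ge0 A0 s0.
apply: le_trans (@expect_conv_le _ f (convpow f j) _
  (fun y => (expclip A s y - 1) + s * expR (s * A) * excess A y) (cst 1) (cst 1)
  (fun y => (expclip A s y - 1) + s * expR (s * A) * excess A y)
  (fun y => expclip A s y - 1) (fun y => expclip A s y - 1) df dc wc wc w1 w1 wc w w _) _.
  by move=> x z x1 z1; apply: expclip_cross => //; lra.
rewrite m1 convpow_mass// mule1 mul1e E1 -momentK//.
apply: (@le_trans _ _ ((scaled_overshoot A s + moment A s)%:E +
   (j.+1%:R * scaled_overshoot A s + ((1 + moment A s) ^+ j.+1 - 1))%:E +
   (moment A s)%:E * ((1 + moment A s) ^+ j.+1 - 1)%:E)%E).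
  apply: leeD; first by apply: leeD.
  by apply: lee_wpmul2l => //; exact: convpow_expclip_le.
rewrite -EFinM -!EFinD lee_fin (exprS _ j.+1) -(natr1 j.+1).
by move: (_ ^+ j.+1) => *; lra.
Qed.

(** The left side of the tested equation carries one scaled overshoot, the right side at most
    [1 / q] times [q] of them, since [j] summands give [j] and [q] is the mean of [j]. They cancel,
    and the finite mean makes the subtraction legitimate. *)
Lemma moment_ode A s : 1 < A -> 0 < s ->
  s * moment1 A s <= 1 / q * expR s * (Q.[1 + moment A s] - 1).
Proof.
move=> A1 s0; have A0 : 0 <= A by lra.
have s0' := ltW s0.
have c0 : 0 <= s * expR (s * A) by rewrite mulr_ge0// expR_ge0.
have wc := expect_cross_weight A0 s0'.
have we := weight_expclipB1 A0 s0'.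
have wW := weight_expclip_primitive s0' (ltW A1).
have ww : weight (fun y => s * expclip A s y).
  by apply: weightM; [exact: weight_cst|exact: weight_expclip].
have := @expect_tested _ _ _ p0 f (fun y => s * expclip A s y) (expclip_primitive A s)
  (1 / q) df m1 b0 ww wW.
move=> H; have {}H := H (fun _ le1 => expclip_integral s0' A1 le1) (fun _ le1 _ => sol_eq sol le1).
have L : expect f (fun y => `|y| * (s * expclip A s y)) =
    (s * moment1 A s + scaled_overshoot A s)%:E.
  rewrite EFinD !EFinM moment1K// overshootK// -expectZ//; last exact: weight_moment1.
  rewrite -EFinM -expectZ//; last exact: weight_excess.
  rewrite -expectD//; last 2 first.
  - by apply: weightM; [exact: weight_cst|exact: weight_moment1].
  - by apply: weightM; [exact: weight_cst|exact: weight_excess].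
  apply: eq_expect => // y y1; rewrite /expclip ger0_norm; last by lra.
  have [yA|Ay] := leP y A.
    by rewrite excess0//; ring.
  by rewrite (excessE (ltW Ay)); ring.
have U : (expect (qmix f) (expclip_primitive A s) <=
    (q * scaled_overshoot A s + expR s * (Q.[1 + moment A s] - 1))%:E)%E.
  have es : 0 <= expR s - 1 by have := expR_ge1Dx s; lra.
  have wr : weight (fun t => (expclip A s t - 1 + s * expR (s * A) * excess A t) +
    (expR s - 1) * (expclip A s t - 1)).
    by apply: weightD => //; apply: weightM => //; exact: weight_cst.
  apply: (@le_trans _ _ (expect (qmix f) (fun t => (expclip A s t - 1 + s * expR (s * A) * excess A t) +
    (expR s - 1) * (expclip A s t - 1)))).
    by apply: le_expect => // t t1; exact: expclip_primitive_le.
  rewrite expect_qmix// QpolyE.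
  have -> : q * scaled_overshoot A s + expR s * (\sum_(1 <= j < N.+1) p j * (1 + moment A s) ^+ j - 1) =
    \sum_(1 <= j < N.+1) (p j * (j%:R * scaled_overshoot A s + expR s * ((1 + moment A s) ^+ j - 1))).
    rewrite -{3}p1 mulr_suml -sumrB mulr_sumr -big_split /=; apply: eq_bigr => j _; ring.
  rewrite -sumEFin big_nat_cond [leRHS]big_nat_cond; apply: lee_sum => j /andP[/andP[j1 jN] _].
  rewrite EFinM lee_wpmul2l ?lee_fin ?p0 ?j1//.
  have dc := convpow_density j.-1 df; have wcv := density_weight dc.
  rewrite expectD//; last by apply: weightM => //; exact: weight_cst.
  rewrite expectZ//.
  apply: (@le_trans _ _ ((j.-1.+1%:R * scaled_overshoot A s + ((1 + moment A s) ^+ j.-1.+1 - 1))%:E +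
     (expR s - 1)%:E * ((1 + moment A s) ^+ j.-1.+1 - 1)%:E)%E).
    apply: leeD; first exact: convpow_cross_le.
    by apply: lee_wpmul2l => //; exact: convpow_expclip_le.
  rewrite (prednK j1) -EFinM -EFinD lee_fin; lra.
have := @lee_wpmul2l R (1 / q)%:E; rewrite lee_fin => /(_ b0 _ _ U).
rewrite -H L -EFinM lee_fin => h.
have E2 : 1 / q * (q * scaled_overshoot A s) = scaled_overshoot A s by field; rewrite gt_eqF.
by move: h; rewrite mulrDr E2 mulrA; lra.
Qed.

Let mean : R := Rexpect f (fun y => `|y|).
Let meanK : mean%:E = expect f (fun y => `|y|).
Proof. by apply: RexpectK => //; exact: weight_norm. Qed.
Let mean_ge0 : 0 <= mean.
Proof. by rewrite -lee_fin meanK expect_ge0//; exact: weight_norm. Qed.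

(** From [exp u - 1 <= u exp u] with [u <= s |y|]. How small [s] must be depends on [A]; this only
    starts the continuation argument. *)
Lemma moment_small A s : 0 <= A -> 0 <= s -> expR (s * A) <= 3 / 2 ->
  moment A s <= 3 / 2 * s * mean.
Proof.
move=> A0 s0 h; have c0 : 0 <= 3 / 2 * s by lra.
rewrite -lee_fin momentK// EFinM meanK -expectZ//.
apply: le_expect => //; first exact: weight_expclipB1.
  by apply: weightM; [exact: weight_cst|exact: weight_norm].
move=> y _; rewrite /expclip; set u := s * Num.min `|y| A.
have m0 : 0 <= Num.min `|y| A by rewrite le_min normr_ge0.
have u0 : 0 <= u by rewrite mulr_ge0.
have u1 : u <= s * `|y| by rewrite ler_wpM2l// ge_min lexx.
have u2 : expR u <= 3 / 2 by apply: le_trans h; exact: expclip_le.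
have u3 : expR u * expR (- u) = 1 by rewrite -expRD subrr expR0.
have u4 : 1 - u <= expR (- u) := expR_ge1Dx (- u).
have := expR_gt0 u; move: (expR u) (expR (- u)) u2 u3 u4 => E F *.
have : E - 1 <= u * E by nra.
by nra.
Qed.

(** The left side is the derivative of [moment A x / x]. While [D <= 2 c x], the linear part [q D]
    of [Q(1 + D) - 1] cancels the [1 / q], and what exceeds [D] is of order [x ^ 2]; moreover
    [1 + D] stays in [[0, 2]], where [Q2] is bounded by [K]. *)
Lemma moment_slope A x c (Q1 Q2 : {poly R}) (K : R) : 1 < A -> 0 < x -> x <= 1 / 2 -> 0 < c ->
  2 * c * x <= 1 -> moment A x <= 2 * c * x -> 0 <= K ->
  (forall z, 1 - Q.[z] = Q1.[z] * (1 - z)) -> (forall z, q - Q1.[z] = Q2.[z] * (1 - z)) ->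
  (forall z, 0 <= z <= 2 -> `|Q2.[z]| <= K) ->
  (x * moment1 A x - moment A x) / x ^+ 2 <= 2 * c * (2 + 4 * (K / q * c)).
Proof.
move=> A1 x0 x2 c0 xc Dx K0 E1 E2 HK; pose k := K / q.
have k0 : 0 <= k by rewrite divr_ge0// ltW.
have kc0 : 0 <= k * c by rewrite mulr_ge0// ltW.
have A0' : 0 <= A by lra.
have := moment_ode A1 x0.
have D0 := moment_ge0 A0' (ltW x0); move: D0 Dx; set D := moment A x => D0 Dx.
have D1 : D <= 1 by lra.
have zb : 0 <= 1 + D <= 2 by apply/andP; split; lra.
have /(le_trans (ler_norm _)) Kz := HK _ zb.
have -> : Q.[1 + D] - 1 = Q1.[1 + D] * D by have := E1 (1 + D); lra.
have Q1E : Q1.[1 + D] = q + Q2.[1 + D] * D by have := E2 (1 + D); lra.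
rewrite Q1E => ode.
(* From [exp x <= 1 / (1 - x)] and [x <= 1 / 2]. *)
have es : expR x <= 1 + 2 * x.
  have e1 : expR x * expR (- x) = 1 by rewrite -expRD subrr expR0.
  have e2 : 1 - x <= expR (- x) := expR_ge1Dx (- x).
  have := expR_gt0 x; move: (expR x) (expR (- x)) e1 e2 => E F *; nra.
have ode2 : x * moment1 A x <= expR x * (D * (1 + k * D)).
  apply: le_trans ode _.
  have -> : expR x * (D * (1 + k * D)) = 1 / q * expR x * ((q + K * D) * D).
    by rewrite /k; field; rewrite gt_eqF.
  rewrite ler_wpM2l//; first by rewrite mulr_ge0// expR_ge0.
  by rewrite ler_wpM2r// lerD2l ler_wpM2r.
have kD : 0 <= k * D by rewrite mulr_ge0.
have ode3 : x * moment1 A x <= (1 + 2 * x) * (D * (1 + k * D)).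
  apply: le_trans ode2 _; rewrite ler_wpM2r//; nra.
have x20 : 0 < x ^+ 2 by rewrite exprn_gt0.
rewrite ler_pdivrMr//.
have h1 : x * moment1 A x - D <= D * (2 * x + 2 * (k * D)).
  have h0 : (1 + 2 * x) * (1 + k * D) - 1 <= 2 * x + 2 * (k * D).
    have : 2 * x * (k * D) <= k * D by rewrite ler_piMl//; lra.
    by move: (k * D) => w *; lra.
  have := ler_wpM2l D0 h0; move: ode3; move: (x * moment1 A x) (k * D) => m w *; nra.
have h2 : k * D <= k * (2 * c * x) by rewrite ler_wpM2l.
apply: le_trans h1 _.
have h3 : 2 * x + 2 * (k * D) <= x * (2 + 4 * (k * c)) by lra.
apply: (@le_trans _ _ (2 * c * x * (x * (2 + 4 * (k * c))))).
  by apply: ler_pM => //; lra.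
by rewrite -/k le_eqVlt; apply/orP; left; apply/eqP; ring.
Qed.

(* With e(s) = moment A s / s, the differential inequality gives e' <= L as
   long as e <= 2c, and e is at most 3c/2 for small s: hence e <= 2c on an
   interval that does not depend on A. *)
Lemma moment_bounded : exists s0 B : R, 0 < s0 /\ forall A, 1 < A -> moment A s0 <= B.
Proof.
have [Q1 [Q2 [E1 E2 _ _]]] := Qpoly_factor p0 p1.
have [K HK] := horner_bounded Q2 2.
have K0 : 0 <= K.
  by apply: le_trans (HK 0 _); [exact: normr_ge0|apply/andP; split; lra].
have [c c0 cm] : exists2 c, 0 < c & mean <= c.
  by exists (mean + 1); [rewrite ltr_wpDl|rewrite lerDl].
have kc0 : 0 <= K / q * c by rewrite mulr_ge0 ?divr_ge0 ?(ltW q0) ?(ltW c0).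
have [L L0 slopeL] : exists2 L, 0 < L & forall A x, 1 < A -> 0 < x -> x <= 1 / 2 ->
    2 * c * x <= 1 -> moment A x <= 2 * c * x ->
    (x * moment1 A x - moment A x) / x ^+ 2 <= L.
  exists (2 * c * (2 + 4 * (K / q * c))); first by rewrite mulr_gt0//; lra.
  by move=> A x A1 x0 x2 xc Dx; exact: (@moment_slope _ _ _ Q1 Q2).
clear Q1 Q2 E1 E2 HK kc0.
(* [s0 * (2 * c) <= 1] keeps the moment at most 1, and [4 * (L * s0) <= c] limits the growth of
   [moment A x / x] to [c / 4]: from [3 / 2 * c] to at most [7 / 4 * c], strictly below the assumed
   [2 * c]. *)
have [s0 [s00 s01 s02 s03]] : exists s0,
    [/\ 0 < s0, s0 <= 1 / 2, s0 * (2 * c) <= 1 & 4 * (L * s0) <= c].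
  exists (Num.min (1 / 2) (Num.min (1 / (2 * c)) (c / (4 * L)))); split.
  - by rewrite !lt_min; apply/and3P; split; rewrite divr_gt0//; lra.
  - by rewrite ge_min lexx.
  - by rewrite -ler_pdivlMr; [rewrite !ge_min lexx orbT|lra].
  - rewrite mulrA mulrC -ler_pdivlMr; first by rewrite !ge_min lexx !orbT.
    by lra.
exists s0, (2 * c * s0); split => // A A1.
have A0 : 0 < A by lra.
have A0' := ltW A0.
(* The starting point [a] depends on [A]; the endpoint [s0] does not. *)
have [a [a0 as0 aA]] : exists a, [/\ 0 < a, a <= s0 & a * A <= 1 / 3].
  exists (Num.min s0 (1 / (3 * A))); split.
  - by rewrite lt_min s00 divr_gt0//; lra.
  - by rewrite ge_min lexx.
  - have : Num.min s0 (1 / (3 * A)) * (3 * A) <= 1.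
      by rewrite -ler_pdivlMr; [rewrite ge_min lexx orbT|lra].
    by move: (Num.min _ _) => m; lra.
have mc (x : R) : 0 < x -> {for x, continuous (moment A)}.
  by move=> x0; exact: is_derive_continuous (moment_derive A0 x0).
have slope x : 0 < x -> x <= s0 -> moment A x <= 2 * c * x ->
    (x * moment1 A x - moment A x) / x ^+ 2 <= L.
  move=> x0 xs Dx; have x2 : x <= 1 / 2 by apply: le_trans xs s01.
  apply: slopeL => //.
  have : 2 * c * x <= 2 * c * s0 by rewrite ler_wpM2l// mulr_ge0// ltW.
  by lra.
pose e x := moment A x / x.
have de (x : R) : 0 < x -> is_derive x 1 e ((x * moment1 A x - moment A x) / x ^+ 2).
  move=> x0; have xn : x != 0 by rewrite gt_eqF.
  have h := is_deriveM (moment_derive A0 x0) (is_deriveV xn (is_derive_id x (1 : R))).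
  apply: is_derive_eq; rewrite /GRing.scale /=.
  by field.
have ea : e a <= 3 / 2 * c.
  rewrite /e ler_pdivrMr//.
  have h : expR (a * A) <= 3 / 2.
    have e1 : expR (a * A) * expR (- (a * A)) = 1 by rewrite -expRD subrr expR0.
    have e2 : 1 - a * A <= expR (- (a * A)) := expR_ge1Dx (- (a * A)).
    have := expR_gt0 (a * A); move: (expR (a * A)) (expR (- (a * A))) e1 e2 => E F *; nra.
  apply: le_trans (moment_small A0' (ltW a0) h) _.
  by rewrite mulrAC ler_wpM2r ?(ltW a0)// ler_wpM2l.
have key x : a <= x -> x <= s0 -> (forall t, a <= t -> t < x -> moment A t <= 2 * c * t) ->
    moment A x <= 7 / 4 * c * x.
  move=> ax xs Hx; have x0 := lt_le_trans a0 ax.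
  rewrite -ler_pdivrMr// -/(e x).
  move: ax; rewrite le_eqVlt => /orP[/eqP<-|ax]; first by apply: le_trans ea _; lra.
  have dax (t : R) : t \in `]a, x[ -> is_derive t 1 e ((t * moment1 A t - moment A t) / t ^+ 2).
    by rewrite in_itv /= => /andP[at_ _]; apply: de; lra.
  have cax : {within `[a, x], continuous e}.
    apply: derivable_within_continuous => t; rewrite in_itv /= => /andP[at_ _].
    by have [] := de t (lt_le_trans a0 at_).
  have [t + E] := MVT ax dax cax; rewrite in_itv /= => /andP[at_ tx].
  have t0 : 0 < t by lra.
  have sl : (t * moment1 A t - moment A t) / t ^+ 2 * (x - a) <= L * s0.
    apply: le_trans (_ : L * (x - a) <= _); last by rewrite ler_wpM2l; lra.
    rewrite ler_wpM2r ?subr_ge0 ?(ltW ax)//; apply: slope => //; first by lra.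
    by apply: Hx => //; exact: ltW.
  by move: sl; rewrite -E; lra.
have := @real_induction R a s0 (fun x => moment A x <= 2 * c * x).
have P7 x : a <= x -> moment A x <= 7 / 4 * c * x -> moment A x <= 2 * c * x.
  by move=> ax h; apply: le_trans h _; rewrite ler_wpM2r//; lra.
move=> /(_ _ _ _ s0); apply; last by rewrite as0 lexx.
- by apply: P7 => //; apply: key => // t ? ?; lra.
- move=> x ax xs Hx; have x0 := lt_le_trans a0 ax.
  have h : moment A x <= 7 / 4 * c * x.
    by apply: key => // [|t at_ tx]; [exact: ltW|apply: Hx; rewrite at_ ltW].
  have cx0 : 0 < c * x / 8 by rewrite divr_gt0// mulr_gt0.
  have /cvgrPdist_lt/(_ _ cx0)/nbhs_ballP[d /= d0 Hd] := mc x x0.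
  exists (x + d / 2) => [|t /andP[xt tx] _]; first by lra.
  have := Hd t; rewrite /ball /= ltr0_norm; last by lra.
  move=> /(_ ltac:(lra)); rewrite ltr_norml => /andP[h1 h2].
  have cxt : c * x <= c * t by apply: ler_wpM2l; exact: ltW.
  by lra.
- move=> x ax xs Hx; apply: P7; first exact: ltW.
  by apply: key => //; exact: ltW.
Qed.

(** Markov's inequality: beyond [A] the capped exponential equals [exp(s0 A)], so the cap loses
    nothing for the tail at [A]. *)
Lemma exponential_tail : exists s0 B : R, 0 < s0 /\
  forall A, 1 < A -> tail f A <= B * expR (- (s0 * A)).
Proof.
have [s0 [B [s00 H]]] := moment_bounded; exists s0, (1 + B); split => // A A1.
have A0 : 0 <= A by lra.
rewrite expRN -ler_pdivrMr ?invr_gt0 ?expR_gt0// invrK.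
apply: (@le_trans _ _ (1 + moment A s0)); last by rewrite lerD2l H.
rewrite -lee_fin EFinD momentK ?(ltW s00)// -m1.
have w1 : weight (cst (1 : R)) by exact: weight_cst.
have we := weight_expclipB1 A0 (ltW s00).
rewrite -expectD// mulrC EFinM tailK// -expectZ ?expR_ge0//; last exact: weight_gt.
apply: le_expect => //.
- by apply: weightM; [apply: weight_cst; exact: expR_ge0|exact: weight_gt].
- exact: weightD.
- move=> y y1; have := (weight_expclip A s0).2 y.
  rewrite /= addrCA subrr addr0; case: ltP => Ay; rewrite ?mulr0// mulr1 => _.
  by rewrite /expclip ger0_norm ?min_r//; [exact: ltW|lra].
Qed.

Lemma sol_nonincreasing x y : 1 <= x -> x <= y -> f y <= f x.
Proof.
move=> x1 xy; have := sol_scaled_le p0 p1 ltr01 sol x1 xy.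
have := density_ge0 df y; have := density_ge0 df x; nra.
Qed.

(** [f] is nonincreasing, so [f y] is at most its mass on the unit interval before [y]; [2 <= y]
    keeps this interval in [[1, +oo[]. *)
Lemma sol_le_tail y : 2 <= y -> f y <= tail f (y - 1).
Proof.
move=> y2; have y0 := density_ge0 df y.
have := @cdf_increment_ge _ f (f y) (y - 1) y df y0.
have -> : y - (y - 1) = 1 by ring.
rewrite mulr1 => /(_ ltac:(lra)) H.
have {}H : cdf f (y - 1) + f y <= cdf f y.
  by apply: H => t /andP[yt ty]; apply: sol_nonincreasing => //; lra.
have := tailE y df m1; have := tailE (y - 1) df m1; have := tail_ge0 y df; lra.
Qed.

Lemma tail_convpow_ge j y : tail f y <= tail (convpow f j) y.
Proof.
elim: j => // j IH; have dc := convpow_density j df.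
rewrite -[convpow f j.+1]/(Defs.conv f (convpow f j)).
have dcc : density (Defs.conv f (convpow f j)) by exact: conv_density.
rewrite -lee_fin !tailK// -[leLHS]mule1 -(convpow_mass j df m1).
apply: expect_conv_ge => //; [exact: weight_gt..|move=> x z x1 z1 /=].
rewrite mulr1 ler_nat; case: (ltP y x) => // yx; case: ltP => //; lra.
Qed.

(** Of the mixture only the [j]-fold sum is kept: it exceeds [(u - 1) + (v - 1)] if one summand
    exceeds [u - 1] and the others together exceed [v - 1]. As [j >= 2], both probabilities are at
    least tails of [f], hence at least [f u] and [f v]. *)
Lemma sol_supermul j u v : (2 <= j <= N)%N -> 2 <= u -> 2 <= v ->
  p j / q * (f u * f v) <= (u + v - 1) * f (u + v - 1).
Proof.
move=> /andP[j2 jN] u2 v2; rewrite (sol_eq sol); last by lra.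
have pj : 0 <= p j by rewrite p0// jN (ltn_trans _ j2).
have -> : u + v - 1 - 1 = (u - 1) + (v - 1) by ring.
have H1 : p j * (tail f (u - 1) * tail f (v - 1)) <= tail (qmix f) ((u - 1) + (v - 1)).
  rewrite -lee_fin tailK// expect_qmix//; last exact: weight_gt.
  have jin : (1 <= j < N.+1)%N by rewrite ltnS jN (ltn_trans _ j2).
  rewrite (big_rem j)/=; last by rewrite mem_index_iota.
  rewrite -[leLHS]adde0; apply: leeD; last first.
    rewrite big_seq_cond; apply: sume_ge0 => i /andP[/mem_rem + _].
    rewrite mem_index_iota => /andP[i1 iN]; rewrite mule_ge0 ?lee_fin ?p0 ?i1//.
    by apply: expect_ge0; [exact: density_weight (convpow_density _ df)|exact: weight_gt].
  rewrite EFinM lee_wpmul2l// ?lee_fin//.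
  case: j j2 {jN pj jin} => [//|[//|j] _ /=].
  have dc := convpow_density j df.
  apply: (@le_trans _ _ (expect f (fun x => ((u - 1 < x)%R)%:R%R) *
     expect (convpow f j) (fun x => ((v - 1 < x)%R)%:R%R))%E).
    rewrite -!tailK// -EFinM lee_fin ler_wpM2l ?tail_ge0//; exact: tail_convpow_ge.
  apply: expect_conv_ge => //; [exact: weight_gt..|move=> x z x1 z1].
  rewrite -natrM ler_nat; case: (ltP (u - 1) x) => // ux; case: (ltP (v - 1) z) => // vz.
  by rewrite mul1n; case: ltP => //; lra.
apply: (@le_trans _ _ (1 / q * (p j * (tail f (u - 1) * tail f (v - 1))))); last by rewrite ler_wpM2l.
have -> : p j / q * (f u * f v) = 1 / q * (p j * (f u * f v)) by ring.
rewrite ler_wpM2l// ler_wpM2l//.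
by apply: ler_pM; rewrite ?(density_ge0 df)// sol_le_tail.
Qed.

End clipped_exponential.

(** * Logarithmic decay rates *)

Section fekete.
Context {R : realType}.

Lemma ln_le_linear (e x : R) : 0 < e -> 0 < x -> ln x <= e * x - ln e.
Proof.
move=> e0 x0; have := ln_sublinear (mulr_gt0 e0 x0).
by rewrite lnM ?posrE//; lra.
Qed.

(* The logarithmic error forces binary splitting into comparable halves. *)
Lemma subadditive_log_multiples (a : R -> R) (K x0 : R) (n : nat) : 0 <= K -> 1 <= x0 ->
  (forall s t, 1 <= s -> 1 <= t -> a (s + t) <= a s + a t + ln (s + t + 1) + K) ->
  (0 < n)%N ->
  a (n%:R * x0) <= n%:R * (a x0 + ln x0 + (K + ln 18)) - ln (n%:R * x0) - (K + ln 18).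
Proof.
move=> K0 x1 sub; elim/ltn_ind: n => n IH n0.
have [->|n1] := eqVneq n 1%N; first by rewrite !mul1r; lra.
have n2 : (2 <= n)%N by lia.
pose i := n./2; pose j := (n - n./2)%N.
have i0 : (0 < i)%N by rewrite /i; lia.
have j0 : (0 < j)%N by rewrite /j; lia.
have iR : 1 <= i%:R :> R by rewrite ler1n.
have jR : 1 <= j%:R :> R by rewrite ler1n.
have nE : n%:R = i%:R + j%:R :> R by rewrite -natrD; congr _%:R; rewrite /i /j; lia.
have h1 : n%:R <= 3 * i%:R :> R by rewrite -natrM ler_nat /i; lia.
have h2 : n%:R <= 2 * j%:R :> R by rewrite -natrM ler_nat /j; lia.
have Hi := IH i ltac:(rewrite /i; lia) i0.
have Hj := IH j ltac:(rewrite /j; lia) j0.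
have ix : 1 <= i%:R * x0 by nra.
have jx : 1 <= j%:R * x0 by nra.
have nx : 1 <= n%:R * x0 by rewrite nE; nra.
have := sub (i%:R * x0) (j%:R * x0) ix jx; rewrite -mulrDl -nE.
have x0' : 0 < x0 by lra.
(* The halves satisfy [n x0 <= 3 i x0] and [n x0 + 1 <= 6 j x0], whence the 18. The term
   [- ln (n x0)] of the claim is supplied by both halves, and the surplus pays for the logarithmic
   error. *)
have l1 : ln (n%:R * x0) <= ln 3 + ln (i%:R * x0).
  rewrite -lnM ?posrE; [|lra..].
  by rewrite ler_ln ?posrE; [rewrite mulrA ler_wpM2r//; lra|lra|lra].
have l2 : ln (n%:R * x0 + 1) <= ln 6 + ln (j%:R * x0).
  rewrite -lnM ?posrE; [|lra..].
  rewrite ler_ln ?posrE; [|lra..].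
  have : n%:R * x0 <= 2 * j%:R * x0 by rewrite ler_wpM2r//; lra.
  by lra.
have l3 : ln 18 = ln 3 + ln 6 :> R by rewrite -lnM ?posrE//; congr ln; ring.
move: Hi Hj l1 l2 l3; rewrite nE mulrDl.
move: (ln _) (ln _) (ln _) (ln _) (ln _) (ln _) (ln _) (ln _) => *; lra.
Qed.

(** With [ln x + K'] added to [a x], the bound [a (n x) <= n M x] holds along multiples. The limit
    is the infimum of [M x / x]; monotonicity covers the points between multiples, and the linear
    lower bound makes the infimum at least [s0]. *)
Lemma fekete_log (a : R -> R) (K s0 B : R) : 0 <= K -> 0 < s0 ->
  (forall x y, 1 <= x -> x <= y -> a x <= a y) ->
  (forall s t, 1 <= s -> 1 <= t -> a (s + t) <= a s + a t + ln (s + t + 1) + K) ->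
  (forall x, 1 < x -> s0 * x - B <= a x) ->
  exists2 l : R, 0 < l & a x / x @[x --> +oo] --> l.
Proof.
move=> K0 s00 amon sub low.
pose K' := K + ln (18 : R).
have K'0 : 0 <= K' by rewrite addr_ge0// ln_ge0//; lra.
pose M x := a x + ln x + K'.
have step x n : 1 <= x -> (0 < n)%N -> a (n%:R * x) <= n%:R * M x.
  move=> x1 n0; have := subadditive_log_multiples K0 x1 sub n0.
  have n1 : 1 <= n%:R :> R by rewrite ler1n.
  have : 0 <= ln (n%:R * x) by apply: ln_ge0; nra.
  by rewrite -/K' -/(M x); move: (ln _) (n%:R * M x) => *; lra.
(* Otherwise [a (n x) <= n M x] would fall below [s0 n x - B] for large [n]. *)
have Ms x : 1 <= x -> s0 * x <= M x.
  move=> x1; rewrite leNgt; apply/negP => Mx.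
  have d0 : 0 < s0 * x - M x by lra.
  pose n := (Num.truncn (`|B| / (s0 * x - M x))).+2.
  have n0 : (0 < n)%N by [].
  have nB : `|B| < n%:R * (s0 * x - M x).
    rewrite -ltr_pdivrMr//; apply: lt_trans (truncnS_gt _) _.
    by rewrite ltr_nat.
  have n1 : 2 <= n%:R :> R by rewrite ler_nat.
  have nx : 1 < n%:R * x by nra.
  have := step x n x1 n0; have := low _ nx; have := ler_norm B.
  by move: nB; move: (n%:R) => m; nra.
pose S := [set M x / x | x in [set x | 1 <= x]].
have Slb : lbound S s0.
  by move=> _ [x /= x1 <-]; rewrite ler_pdivlMr ?Ms//; lra.
have S0 : S !=set0 by exists (M 1 / 1), 1 => //=.
have Sinf : has_inf S by split => //; exists s0.
exists (inf S); first by apply: lt_le_trans s00 _; exact: lb_le_inf.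
apply/cvgrPdist_le => e e0.
have e2 : 0 < e / 2 by lra.
have [_ [x0 /= x01 <-] Hx0] := inf_adherent e2 Sinf.
have x00 : 0 < x0 by lra.
have M0 : 0 < M x0 by apply: lt_le_trans (Ms _ x01); rewrite mulr_gt0.
pose c := K' - ln (e / 2).
near=> x.
have x1 : 1 <= x by near: x; apply: nbhs_pinfty_ge; exact: num_real.
have xp : 0 < x by lra.
have xx0 : x0 <= x by near: x; apply: nbhs_pinfty_ge; exact: num_real.
have xM : 2 * M x0 / e <= x by near: x; apply: nbhs_pinfty_ge; exact: num_real.
have xc : 2 * c / e <= x by near: x; apply: nbhs_pinfty_ge; exact: num_real.
have lo : inf S <= M x / x by apply: ge_inf; [exists s0|exists x].
have lnx := ln_le_linear e2 xp.
have lo2 : inf S * x <= M x by rewrite -ler_pdivlMr.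
have c2 : c <= e / 2 * x by move: xc; rewrite ler_pdivrMr//; lra.
have M2 : M x0 <= e / 2 * x by move: xM; rewrite ler_pdivrMr//; lra.
have up : a x <= (inf S + e) * x.
  pose n := (Num.truncn (x / x0)).+1.
  have n0 : (0 < n)%N by [].
  have xn : x <= n%:R * x0 by rewrite -ler_pdivrMr// ltW// truncnS_gt.
  have nx : n%:R * x0 <= x + x0.
    rewrite /n -natr1 mulrDl mul1r lerD2r -ler_pdivlMr//.
    by rewrite truncn_le// divr_ge0// ltW.
  have h1 := le_trans (amon _ _ x1 xn) (step x0 n x01 n0).
  apply: le_trans h1 _.
  have h2 : n%:R * M x0 <= (x / x0 + 1) * M x0.
    by rewrite ler_pM2r// -(ler_pM2r x00) mulrDl mul1r divfK// gt_eqF.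
  apply: le_trans h2 _; rewrite mulrDl mul1r.
  have -> : x / x0 * M x0 = M x0 / x0 * x by field; rewrite gt_eqF.
  have : M x0 / x0 * x <= (inf S + e / 2) * x by rewrite ler_pM2r// ltW.
  by lra.
have lo3 : (inf S - e) * x <= a x by move: lo2; rewrite /M /c in c2 *; lra.
have {}lo3 : inf S - e <= a x / x by rewrite ler_pdivlMr.
have {}up : a x / x <= inf S + e by rewrite ler_pdivrMr.
by rewrite ler_norml; apply/andP; split; lra.
Unshelve. all: by end_near. Qed.

End fekete.

(** * Decay rates of the solution for [theta = 1] *)

Section log_decay.
Context {R : realType}.
Notation mu := (@lebesgue_measure R).
Context (N : nat) (p : nat -> R).
Context (p0 : forall j : nat, (1 <= j <= N)%N -> 0 <= p j).
Context (p1 : \sum_(1 <= j < N.+1) p j = 1).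
Local Notation Q := (Qpoly N p).
Local Notation q := (\sum_(1 <= j < N.+1) p j * j%:R).
Local Notation qmix := (qmix N p).
Context (f : R -> R) (sol : prob_sol N p (1 / q) f).
Context (mean_fin : (expect f (fun y : R => `|y|%R) < +oo)%E).
Context (f_gt0 : forall y, 1 <= y -> 0 < f y).

Let df := sol_density sol.
Let m1 := sol_mass sol.
Let wf := density_weight df.
Let q0 : 0 < q.
Proof. by rewrite (lt_le_trans ltr01)//; exact: mean_degree_ge1. Qed.

Lemma Qpoly_coef (j : nat) : Q`_j = if (1 <= j <= N)%N then p j else 0.
Proof.
rewrite /Qpoly coef_sum; under eq_bigr do rewrite coefZ coefXn.
have [jN|jN] := ifPn.
  rewrite (bigD1_seq j) /=; [|by rewrite mem_index_iota ltnS|exact: iota_uniq].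
  rewrite eqxx mulr1 big1 ?addr0// => i ij.
  by rewrite eq_sym (negbTE ij) mulr0.
rewrite big_nat_cond big1// => i /andP[/andP[i1 iN] _].
by case: eqP => [E|_]; rewrite ?mulr0//; move: jN; rewrite E i1 -ltnS iN.
Qed.

Lemma Qpoly_degree_gt1 : (2 < size Q)%N -> exists2 j, (2 <= j <= N)%N & 0 < p j.
Proof.
move=> sQ; have nz : lead_coef Q != 0.
  by rewrite lead_coef_eq0 -size_poly_gt0 (ltn_trans _ sQ).
move: nz; rewrite /lead_coef Qpoly_coef; case: ifPn => [/andP[j1 jN]|]; last by rewrite eqxx.
move=> nz; exists (size Q).-1; first by rewrite jN andbT; case: (size Q) sQ.
by rewrite lt_neqAle eq_sym nz p0// j1.
Qed.

Lemma sol_exponential_rate : (2 < size Q)%N ->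
  exists2 l : R, 0 < l & ln (f y) / y @[y --> +oo] --> - l.
Proof.
move=> /Qpoly_degree_gt1[j jN pj].
have [s0 [B [s00 Htail]]] := exponential_tail p0 p1 sol mean_fin.
(* The shift by one absorbs the offset in [u + v - 1]: with [u = s + 1] and [v = t + 1] it is
   [s + t + 1]. *)
pose a x := - ln (f (x + 1)).
have [c c0 supm] : exists2 c, 0 < c & forall u v, 2 <= u -> 2 <= v ->
    c * (f u * f v) <= (u + v - 1) * f (u + v - 1).
  exists (p j / q); first by rewrite divr_gt0.
  by move=> u v; exact: (sol_supermul p0 p1 sol jN).
have amon x y : 1 <= x -> x <= y -> a x <= a y.
  move=> x1 xy; rewrite lerN2 ler_ln ?posrE ?f_gt0//; [|lra..].
  by apply: (sol_nonincreasing p0 p1 sol); lra.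
have sub s t : 1 <= s -> 1 <= t -> a (s + t) <= a s + a t + ln (s + t + 1) + `|ln c|.
  move=> s1 t1; rewrite /a.
  have := supm (s + 1) (t + 1).
  have -> : s + 1 + (t + 1) - 1 = s + t + 1 by ring.
  move=> /(_ ltac:(lra) ltac:(lra)).
  have fs : 0 < f (s + 1) by apply: f_gt0; lra.
  have ft : 0 < f (t + 1) by apply: f_gt0; lra.
  have fst : 0 < f (s + t + 1) by apply: f_gt0; lra.
  have st : 0 < s + t + 1 by lra.
  move=> h.
  have {h} : ln (c * (f (s + 1) * f (t + 1))) <= ln ((s + t + 1) * f (s + t + 1)).
    have P1 : 0 < c * (f (s + 1) * f (t + 1)) by rewrite mulr_gt0// mulr_gt0.
    have P2 : 0 < (s + t + 1) * f (s + t + 1) by rewrite mulr_gt0.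
    by rewrite ler_ln ?posrE.
  rewrite lnM ?posrE ?mulr_gt0// !lnM ?posrE// => h.
  have := ler_norm (- ln c); rewrite normrN.
  by move: h; move: (ln _) (ln _) (ln _) (ln _) (ln _) => *; lra.
(* This makes [ln B] meaningful; it is forced by [0 < f 3], which is at most the tail at 2. *)
have B0 : 0 < B.
  have h := Htail 2 ltac:(lra).
  have h2 := sol_le_tail p0 p1 sol (_ : 2 <= 3); have h3 := f_gt0 (_ : 1 <= 3).
  have E : 3 - 1 = 2 :> R by ring.
  rewrite E in h2; have := h2 ltac:(lra); have := h3 ltac:(lra) => ? ?.
  by rewrite -(pmulr_lgt0 _ (expR_gt0 (- (s0 * 2)))); lra.
have low x : 1 < x -> s0 * x - ln B <= a x.
  move=> x1; rewrite /a lerNr opprB.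
  have h := sol_le_tail p0 p1 sol (_ : 2 <= x + 1).
  rewrite addrK in h; have {}h := le_trans (h ltac:(lra)) (Htail x x1).
  rewrite -ler_ln ?posrE ?mulr_gt0 ?expR_gt0// in h; last by apply: f_gt0; lra.
  by rewrite lnM ?posrE ?expR_gt0// expRK in h; lra.
have [l l0 Hl] := fekete_log (normr_ge0 _) s00 amon sub low.
exists l => //.
have H1 : a (y - 1) / (y - 1) @[y --> +oo] --> l.
  by apply: (@cvg_comp _ _ _ (fun y : R => y - 1) (fun x => a x / x) _ +oo%R) => //; exact: cvg_addrr.
have H2 : 1 - y^-1 @[y --> +oo] --> (1 - 0 : R).
  apply: cvgB; [exact: cvg_cst|apply/gtr0_cvgV0; [|exact: cvg_id]].
  by apply: nbhs_pinfty_gt; exact: num_real.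
have H3 : - (a (y - 1) / (y - 1) * (1 - y^-1)) @[y --> +oo] --> - (l * (1 - 0)).
  by apply: cvgN; exact: cvgM.
rewrite subr0 mulr1 in H3; apply: cvg_trans H3; apply: near_eq_cvg; near=> y.
have y2 : 2 < y by near: y; apply: nbhs_pinfty_gt; exact: num_real.
rewrite /= /a subrK; field; apply/andP; split; rewrite gt_eqF//; lra.
Unshelve. all: by end_near. Qed.

(** * The case [Q(z) = z] *)

Section identity.
Context (QX : Q = 'X).

Lemma p_identity (j : nat) : (1 <= j <= N)%N -> p j = (j == 1%N)%:R.
Proof. by move=> jN; have := Qpoly_coef j; rewrite jN QX coefX => <-. Qed.

Let N1 : (1 <= N)%N.
Proof.
case: N p1 => //; rewrite big_geq// => /esym/eqP; by rewrite oner_eq0.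
Qed.

Lemma q_identity : q = 1.
Proof.
rewrite big_ltn ?ltnS// p_identity//= mulr1 big_nat_cond big1 ?addr0// => j /andP[/andP[j2 jN] _].
rewrite p_identity ?(ltnW j2)//.
by case: j j2 {jN} => [|[]]//= ? _; rewrite mul0r.
Qed.

Lemma qmix_identity : qmix f = f.
Proof.
apply/funext => y; rewrite /qmix big_ltn ?ltnS// p_identity//= mul1r.
rewrite big_nat_cond big1 ?addr0// => j /andP[/andP[j2 jN] _].
rewrite p_identity ?(ltnW j2)//.
by case: j j2 {jN} => [|[]]//= ? _; rewrite mul0r.
Qed.

Lemma sol_eq_identity y : 1 <= y -> y * f y = tail f (y - 1).
Proof. by move=> y1; rewrite (sol_eq sol y1) qmix_identity q_identity divr1 mul1r. Qed.

(** Testing with the indicator of [y > A] gives [E[X; X > A] = E (X - A + 1)^+]. The left side is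
    [A H(A) + E (X - A)^+], the right side at most [H(A - 1) + E (X - A)^+], and the finite
    overshoots cancel. *)
Lemma tail_identity_le A : 1 <= A -> A * tail f A <= tail f (A - 1).
Proof.
move=> A1.
have WE s : 1 <= s -> (excess (A - 1) s)%:E = (\int[mu]_(y in `[1%R, (s + 1)%R]) ((A < y)%R%:R)%:E)%E.
  move=> s1; transitivity (\int[mu]_(y in `]A, (s + 1)%R]) (cst 1%E y))%E.
    rewrite integral_cst//= lebesgue_measure_itv /= lte_fin mul1e.
    case: ltP => h; first by rewrite excessE -?EFinB ?EFinD; [congr EFin; ring|lra].
    by rewrite excess0//; lra.
  rewrite integral_mkcond [RHS]integral_mkcond; apply: eq_integral => y _.
  rewrite !patchE !mem_setE !in_itv /=; case: (ltP A y) => Ay /=; last by case: ifP.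
  by rewrite (le_trans A1 (ltW Ay)).
have b0 : 0 <= 1 / q by rewrite divr_ge0// ltW.
have := @expect_tested _ _ _ p0 f (fun y => (A < y)%R%:R) (excess (A - 1)) (1 / q) df m1 b0
  (weight_gt A) (weight_excess _) WE (fun y y1 _ => sol_eq sol y1).
rewrite qmix_identity q_identity divr1 mul1e -(overshootK sol mean_fin)//; last by lra.
have A0 : 0 <= A by lra.
have -> : expect f (fun y => `|y| * (A < y)%R%:R) = (A * tail f A + overshoot f A)%:E.
  rewrite EFinD EFinM tailK// (overshootK sol mean_fin)// -expectZ//; last exact: weight_gt.
  rewrite -expectD//; [|by apply: weightM; [exact: weight_cst|exact: weight_gt]|exact: weight_excess].
  apply: eq_expect => // y y1; rewrite ger0_norm; last by lra.
  have [Ay|yA] := ltP A y; first by rewrite (excessE (ltW Ay)) /=; ring.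
  by rewrite (excess0 yA) /= !mulr0 addr0.
move=> [E].
have : overshoot f (A - 1) <= tail f (A - 1) + overshoot f A.
  have A10 : 0 <= A - 1 by lra.
  rewrite -lee_fin EFinD tailK// !(overshootK sol mean_fin)// -expectD//; [|exact: weight_gt|exact: weight_excess].
  apply: le_expect => //; [exact: weight_excess|by apply: weightD; [exact: weight_gt|exact: weight_excess]|].
  move=> y y1; case: (ltP (A - 1) y) => h1.
    rewrite (excessE (ltW h1)); have [h2|h2] := leP y A; first by rewrite excess0// addr0 /=; lra.
    by rewrite (excessE (ltW h2)) /=; lra.
  by rewrite !excess0//; lra.
by lra.
Qed.

(** [exp(y - y ln y)] is the Stirling profile of an inverse factorial: it absorbs the division by
    [y] in a unit step because [(y - 1) (ln y - ln (y - 1)) <= 1]. *)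
Lemma exp_entropy_step (t y : R) : 2 <= y -> t <= expR (y - 1 - (y - 1) * ln (y - 1)) ->
  t / y <= expR (y - y * ln y).
Proof.
move=> y2 ht; have y0 : 0 < y by lra.
have y10 : 0 < y - 1 by lra.
rewrite ler_pdivrMr//; apply: le_trans ht _.
have -> : expR (y - y * ln y) * y = expR (y - y * ln y + ln y) by rewrite [RHS]expRD lnK.
rewrite ler_expR.
have : ln y <= ln (y - 1) + (y - 1)^-1.
  have {1}-> : y = (y - 1) * (1 + (y - 1)^-1) by field; rewrite gt_eqF.
  have i0 : 0 < (y - 1)^-1 by rewrite invr_gt0.
  rewrite lnM ?posrE//; last by lra.
  by rewrite lerD2l; apply: le_ln1Dx; lra.
move=> /(ler_wpM2l (ltW y10)); rewrite mulrDr mulfV ?gt_eqF//.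
by move: (ln _) (ln _) => *; lra.
Qed.

Lemma tail_le_entropy y : 1 <= y -> tail f y <= expR (y - y * ln y).
Proof.
have H n : forall y, 1 <= y -> y < n.+2%:R -> tail f y <= expR (y - y * ln y).
  elim: n => [|n IH] {}y y1 yn.
    (* On [[1, 2[] the asserted bound is at least 1, as [ln y <= y - 1 < 1]. *)
    have : tail f y <= 1 by rewrite (tailE _ df m1) gerBl cdf_ge0.
    move/le_trans; apply; rewrite -[leLHS]expR0 ler_expR.
    have : ln (1 + (y - 1)) <= y - 1 by apply: le_ln1Dx; lra.
    have -> : 1 + (y - 1) = y by ring.
    by move: (ln y) => l ?; nra.
  have [y2|y2] := ltP y 2; first by apply: IH => //; apply: lt_le_trans y2 _; rewrite ler_nat.
  have y0 : 0 < y by lra.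
  have h := tail_identity_le y1.
  have : tail f y <= tail f (y - 1) / y by rewrite ler_pdivlMr// mulrC.
  move/le_trans; apply; apply: exp_entropy_step => //; apply: IH; first by lra.
  by move: yn; rewrite -[n.+3%:R]natr1; lra.
move=> y1; apply: (H (Num.truncn y)) => //.
by apply: lt_trans (truncnS_gt _) _; rewrite ltr_nat.
Qed.

Lemma sol_le_entropy y : 2 <= y -> ln (f y) <= y - y * ln y.
Proof.
move=> y2; have y0 : 0 < y by lra.
rewrite -[leRHS]expRK ler_ln ?posrE ?expR_gt0 ?f_gt0//; last by lra.
have -> : f y = tail f (y - 1) / y.
  rewrite -sol_eq_identity; last by lra.
  by rewrite mulrAC mulfV ?mul1r// gt_eqF.
by apply: exp_entropy_step => //; apply: tail_le_entropy; lra.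
Qed.

Lemma sol_step_ge (d y : R) : 0 < d -> d < 1 -> 2 <= y ->
  ln d - ln y + ln (f (y - 1 + d)) <= ln (f y).
Proof.
move=> d0 d1 y2; have y0 : 0 < y by lra.
have fy : 0 < f y by apply: f_gt0; lra.
have fd : 0 < f (y - 1 + d) by apply: f_gt0; lra.
suff h : d * f (y - 1 + d) <= y * f y.
  have : ln (d * f (y - 1 + d)) <= ln (y * f y) by rewrite ler_ln ?posrE ?mulr_gt0.
  by rewrite !lnM ?posrE//; lra.
rewrite sol_eq_identity; last by lra.
have := @cdf_increment_ge _ f (f (y - 1 + d)) (y - 1) (y - 1 + d) df (ltW fd).
have -> : y - 1 + d - (y - 1) = d by ring.
move=> /(_ ltac:(lra)) H.
have {}H : cdf f (y - 1) + f (y - 1 + d) * d <= cdf f (y - 1 + d).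
  by apply: H => t /andP[yt ty]; apply: (sol_nonincreasing p0 p1 sol) => //; lra.
have := tailE (y - 1 + d) df m1; have := tailE (y - 1) df m1; have := tail_ge0 (y - 1 + d) df; lra.
Qed.

(** Going back from [y] in steps of [tau = 1 - d] takes about [y / tau] steps, each costing at most
    [ln y - ln d]. Steps shorter than 1 cost the factor [1 / tau], which is brought close to 1 at
    the end. *)
Lemma sol_ge_entropy (tau : R) : 0 < tau -> tau < 1 ->
  exists L : R, forall y, 1 <= y -> - (y / tau * (ln y + L)) <= ln (f y).
Proof.
move=> t0 t1; pose d := 1 - tau.
have d0 : 0 < d by rewrite /d; lra.
have d1 : d < 1 by rewrite /d; lra.
have lnd : ln d <= 0 by apply: ln_le0; exact: ltW.
(* The first part pays for one step, the second for the starting interval [[1, 2]]. *)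
pose L := - ln d + `|ln (f 2)|.
have L0 : 0 <= L by rewrite addr_ge0// oppr_ge0.
exists L => y.
have H n : forall y, 1 <= y -> y <= 2 + n%:R * tau -> - (y / tau * (ln y + L)) <= ln (f y).
  elim: n => [|n IH] {}y y1 yn.
    have y2 : y <= 2 by move: yn; rewrite mul0r addr0.
    have h1 : ln (f 2) <= ln (f y).
      rewrite ler_ln ?posrE ?f_gt0//; [|lra].
      by apply: (sol_nonincreasing p0 p1 sol).
    have h2 : - `|ln (f 2)| <= ln (f 2) by rewrite lerNl -normrN ler_norm.
    have h3 : 0 <= ln y by apply: ln_ge0.
    have h4 : 1 <= y / tau by rewrite ler_pdivlMr//; lra.
    have h5 : `|ln (f 2)| <= L by rewrite lerDr oppr_ge0.
    have h6 : ln y + L <= y / tau * (ln y + L) by rewrite ler_peMl// addr_ge0.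
    by move: h1 h2 h3 h5 h6; move: (y / tau * _) => *; lra.
  have [y2|y2] := leP y 2; first by apply: IH => //; rewrite (le_trans y2)// lerDl mulr_ge0// ltW.
  have h1 := sol_step_ge d0 d1 (ltW y2).
  have E : y - 1 + d = y - tau by rewrite /d; ring.
  rewrite E in h1.
  have h2 : - ((y - tau) / tau * (ln (y - tau) + L)) <= ln (f (y - tau)).
    by apply: IH; [lra|move: yn; rewrite -(natr1 n) mulrDl; lra].
  have h3 : ln (y - tau) <= ln y by rewrite ler_ln ?posrE; lra.
  have h4 : (y - tau) / tau * (ln (y - tau) + L) <= (y - tau) / tau * (ln y + L).
    by rewrite ler_wpM2l ?lerD2r// divr_ge0//; lra.
  have h5 : (y - tau) / tau * (ln y + L) = y / tau * (ln y + L) - (ln y + L).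
    by field; rewrite gt_eqF.
  have h6 : - L <= ln d by rewrite /L opprD opprK gerDl oppr_le0.
  by lra.
move=> y1; apply: (H (Num.truncn (y / tau)).+1) => //.
have := truncnS_gt (y / tau); rewrite ltr_pdivrMr//; lra.
Qed.

Lemma sol_entropy_rate : ln (f y) / (y * ln y) @[y --> +oo] --> (-1 : R).
Proof.
apply/cvgrPdist_le => e e0.
(* The factor [1 / tau = 1 + e / 2] uses half of the error; the other half takes the term [L / tau]
   once [ln y] is large. *)
pose tau := (1 + e / 2)^-1.
have te : 0 < 1 + e / 2 by lra.
have t0 : 0 < tau by rewrite invr_gt0.
have t1 : tau < 1 by rewrite invf_lt1//; lra.
have [L HL] := sol_ge_entropy t0 t1.
near=> y.
have y2 : 2 <= y by near: y; apply: nbhs_pinfty_ge; exact: num_real.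
have y0 : 0 < y by lra.
have lny a : a = a -> expR a < y -> a < ln y by move=> _ h; rewrite -ltr_expR lnK.
have l1 : e^-1 < ln y.
  by apply: lny => //; near: y; apply: nbhs_pinfty_gt; exact: num_real.
have l2 : 2 * (1 + e / 2) * L / e < ln y.
  by apply: lny => //; near: y; apply: nbhs_pinfty_gt; exact: num_real.
have l0 : 0 < ln y by apply: lt_trans l1; rewrite invr_gt0.
have yl0 : 0 < y * ln y by rewrite mulr_gt0.
have up : ln (f y) <= (e - 1) * (y * ln y).
  apply: le_trans (sol_le_entropy y2) _.
  have : 1 <= e * ln y by rewrite mulrC -ler_pdivrMr// div1r ltW.
  by move/(ler_wpM2l (ltW y0)); move: (ln y) => l; lra.
have lo : (- 1 - e) * (y * ln y) <= ln (f y).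
  apply: le_trans (HL y ltac:(lra)).
  rewrite /tau invrK; move: l2; rewrite ltr_pdivrMr// => l2.
  have h : (1 + e / 2) * L <= e / 2 * ln y by lra.
  have := ler_wpM2l (ltW y0) h; move: (ln y) => l; nra.
have {}lo : - 1 - e <= ln (f y) / (y * ln y) by rewrite ler_pdivlMr.
have {}up : ln (f y) / (y * ln y) <= e - 1 by rewrite ler_pdivrMr.
by rewrite ler_norml; apply/andP; split; lra.
Unshelve. all: by end_near. Qed.

End identity.

End log_decay.

(** * Transfer to [eta] and assembly of the four claims *)

Lemma eq_cvg_pinfty (R : realType) (g h : R -> R) (l : R) :
  (forall y, 1 <= y -> g y = h y) -> g y @[y --> +oo] --> l -> h y @[y --> +oo] --> l.
Proof.
move=> gh; apply: cvg_trans; apply: near_eq_cvg; near=> y.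
apply: gh; near: y; apply: nbhs_pinfty_ge; exact: num_real.
Unshelve. all: by end_near. Qed.

Unset Implicit Arguments.

Theorem theorem4p6 (R : realType) (N : nat) (p : nat -> R)
  (hN : (1 <= N)%N)
  (hp0 : forall j : nat, (1 <= j <= N)%N -> 0 <= p j)
  (hp1 : \sum_(1 <= j < N.+1) p j = 1)
  (theta : R) (htheta : 0 < theta) (eta : R -> R)
  (heta : is_solution N p (theta / q_of (Qpoly N p)) eta) :
  let Q := Qpoly N p in
  let kappa := kappa_of Q in
  [/\ (in_P eta <-> 0 < theta <= 1),
      (0 < theta <= 1 ->
        [/\ in_P eta,
            (forall y : R, 1 <= y -> 0 < eta y),
            (forall x y : R, 1 <= x -> x < y -> eta y < eta x)
          & (y * eta y @[y --> +oo] --> (0 : R))]),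
      (0 < theta < 1 ->
        y `^ (1 + theta) * eta y @[y --> +oo] -->
          theta * expR (theta * gammaE R) / (kappa * Gamma (1 - theta)))
    & (theta = 1 ->
        [/\ (\int[lebesgue_measure]_(y in `[1%R, +oo[) (y * eta y)%:E
               = (expR (gammaE R) / kappa)%:E)%E,
            ((2 < size Q)%N ->
              exists2 lambda : R, 0 < lambda &
                ln (eta y) / y @[y --> +oo] --> - lambda)
          & (Q = 'X -> ln (eta y) / (y * ln y) @[y --> +oo] --> (-1 : R))])].
Proof.
move=> Q kappa; rewrite q_ofE in heta.
have etaE y : 1 <= y -> ext0 eta y = eta y by move=> y1; rewrite /ext0 y1.
have sol : theta <= 1 -> prob_sol N p (theta / \sum_(1 <= j < N.+1) p j * j%:R) (ext0 eta).
  exact: solution_prob_sol.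
have pos y : theta <= 1 -> 1 <= y -> 0 < eta y.
  by move=> t1 y1; have [] := solution_pos hp0 hp1 htheta heta t1 y1.
split.
- split=> [inP|/andP[_ t1]]; last exact: (prob_sol_in_P heta (sol t1)).
  have solP := in_P_prob_sol hp0 hp1 htheta heta inP.
  by rewrite htheta (prob_sol_theta_le1 hp0 hp1 htheta solP).
- move=> /andP[_ t1]; split.
  + exact: (prob_sol_in_P heta (sol t1)).
  + by move=> y; exact: pos.
  + move=> x y x1 xy; have y1 : 1 <= y by apply: le_trans x1 (ltW xy).
    have := sol_scaled_le hp0 hp1 htheta (sol t1) x1 (ltW xy).
    rewrite !etaE// => le; have x0 : 0 < x by apply: lt_le_trans x1.
    (* Strictness comes from the factor: [x * eta y < y * eta y <= x * eta x]. *)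
    rewrite -(ltr_pM2l x0); apply: lt_le_trans le.
    by rewrite ltr_pM2r// pos.
  + apply: (@eq_cvg_pinfty R (fun y => y * ext0 eta y)).
      by move=> y y1; rewrite etaE.
    exact: (sol_scaled_cvg0 hp0 hp1 htheta (sol t1)).
- move=> /andP[_ t1].
  apply: (@eq_cvg_pinfty R (fun y => y `^ (1 + theta) * ext0 eta y)).
    by move=> y y1; rewrite etaE.
  exact: (sol_power_decay hp0 hp1 htheta (sol (ltW t1)) t1).
- move=> t1; have tle : theta <= 1 by rewrite t1.
  have sol1 := sol tle; have mean1 := sol_mean hp0 hp1 htheta sol1 t1.
  rewrite t1 in sol1.
  have mean_fin : (expect (ext0 eta) (fun y : R => `|y|%R) < +oo)%E by rewrite mean1 ltry.
  have posf y : 1 <= y -> 0 < ext0 eta y by move=> y1; rewrite etaE// pos.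
  split.
  + rewrite -mean1 [LHS]integral_mkcond; apply: eq_integral => y _.
    rewrite patchE mem_setE in_itv /= andbT /ext0; case: ifP => y1; last by rewrite mul0r.
    by rewrite ger0_norm 1?mulrC// (le_trans ler01).
  + move=> /(sol_exponential_rate hp0 hp1 sol1 mean_fin posf)[l l0 H]; exists l => //.
    apply: (@eq_cvg_pinfty R (fun y => ln (ext0 eta y) / y)) => //.
    by move=> y y1; rewrite etaE.
  + move=> QX; apply: (@eq_cvg_pinfty R (fun y => ln (ext0 eta y) / (y * ln y))).
      by move=> y y1; rewrite etaE.
    exact: (sol_entropy_rate hp0 hp1 sol1 mean_fin posf QX).
Qed.
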